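(* Let $K\ge 1$ and let $f\in\mathcal{S}_{H_q}(\mathcal{S},K)$. Then $f\in\mathbf{h}^p$ for $0<p<1/2$, and $f\in\mathbf{a}^p_\beta$ for $0<p<(2+\beta)/2$ and $\beta>-1$.
   Context: $\mathbb{D}=\{z\in\mathbb{C}:|z|<1\}$. $\mathcal{H}$ denotes the class of complex-valued harmonic functions $f=h+\overline{g}$ on $\mathbb{D}$, with $h,g$ analytic in $\mathbb{D}$, normalized by $h(0)=g(0)=0$ and $h'(0)=1$. Such an $f$ is sense-preserving if its Jacobian $J_f=|h'|^2-|g'|^2$ is positive on $\mathbb{D}$; then its analytic dilatation $\omega=g'/h'$ is an analytic map $\mathbb{D}\to\mathbb{D}$. $\mathcal{S}_H$ is the class of all sense-preserving univalent (injective) $f\in\mathcal{H}$. For $K\ge 1$ put $k=(K-1)/(K+1)\in[0,1)$. $\mathcal{S}_H(K)$ is the class of $f\in\mathcal{S}_H$ that are $K$-quasiconformal, i.e. satisfy $|\omega(z)|\le k$ for all $z\in\mathbb{D}$. $\mathcal{S}$ is the class of analytic univalent functions $\psi$ on $\mathbb{D}$ with $\psi(0)=0$, $\psi'(0)=1$. For analytic $\phi,\psi$ on $\mathbb{D}$, $\phi$ is quasi-subordinate to $\psi$, written $\phi\prec_q\psi$, if there exist analytic functions $\xi,\eta$ on $\mathbb{D}$ with $|\xi(z)|\le1$, $|\eta(z)|<1$ on $\mathbb{D}$ and $\eta(0)=0$ such that $\phi(z)=\xi(z)\psi(\eta(z))$ for all $z\in\mathbb{D}$. The class in question is $$\mathcal{S}_{H_q}(\mathcal{S},K)=\{h+\overline{g}\in\mathcal{S}_H(K):\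 h+e^{i\theta}g\prec_q\psi\text{ for some }\theta\in\mathbb{R}\text{ and some }\psi\in\mathcal{S}\}.$$ For $0<p<\infty$, $\mathbf{h}^p$ is the set of complex-valued harmonic functions $\Phi$ on $\mathbb{D}$ with $\sup_{0<r<1}M_p(r,\Phi)<\infty$, where $M_p(r,\Phi)=\left(\frac{1}{2\pi}\int_0^{2\pi}|\Phi(re^{i\theta})|^p\,d\theta\right)^{1/p}$. For $\beta>-1$ and $0<p<\infty$, the weighted harmonic Bergman space $\mathbf{a}^p_\beta$ consists of all $f\in\mathcal{H}$ with $\int_{\mathbb{D}}|f(z)|^p\,dA_\beta(z)<\infty$, where $dA_\beta(z)=(\beta+1)(1-|z|^2)^\beta\,dA(z)$ and $dA(z)=\frac1\pi\,dx\,dy$ is normalized area measure on $\mathbb{D}$. *)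

(* Defs.v *)
From HB Require Import structures.
From mathcomp Require Export all_boot all_order all_algebra.
From mathcomp Require Export complex.
From mathcomp Require Export all_classical all_reals all_analysis.
Set Implicit Arguments.
Unset Strict Implicit.
Unset Printing Implicit Defensive.
Export Order.TTheory GRing.Theory Num.Theory.
Export numFieldNormedType.Exports.
Export Normc.

Local Open Scope classical_set_scope.
Local Open Scope ring_scope.
Local Open Scope complex_scope.

(* Functions on the unit disc are represented by total
   functions R[i] -> R[i] of which only the values on the disc are relevant.
   [`|z|] is the modulus as an element of R[i], [normc z] the same number as an
   element of R. *)

Section Disc.
Variable R : realType.
Implicit Types (f g h phi psi xi eta : R[i] -> R[i]) (z : R[i]).

Definition disc : set R[i] := [set z | `|z| < 1].

(* The normed space structure of the complex numbers over themselves is carried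
   by R[i]^o: [derivable _ z 1] is complex differentiability at z and ['D_1] is
   the complex derivative. *)
Definition analytic phi : Prop :=
  forall z, disc z -> derivable (phi : R[i]^o -> R[i]^o) z 1.

Definition cderiv phi z : R[i] := 'D_1 (phi : R[i]^o -> R[i]^o) z.

Definition complex_point (x : R * R) : R[i] := x.1 +i* x.2.

Definition plane_disc : set (R * R) := [set x | disc (complex_point x)].

Definition axes : set (R * R) := [set (1, 0); (0, 1)].

Fixpoint Ck_on (k : nat) (A : set (R * R)) (u : R * R -> R) : Prop :=
  (forall x, A x -> {for x, continuous u}) /\
  if k is k'.+1 then
    forall e, axes e ->
      (forall x, A x -> derivable u x e) /\ Ck_on k' A ('D_e u)
  else True.

Definition laplacian (u : R * R -> R) (x : R * R) : R :=
  'D_(1, 0) ('D_(1, 0) u) x + 'D_(0, 1) ('D_(0, 1) u) x.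

Definition real_harmonic_on (A : set (R * R)) (u : R * R -> R) : Prop :=
  Ck_on 2 A u /\ forall x, A x -> laplacian u x = 0.

Definition harmonic_disc f : Prop :=
  real_harmonic_on plane_disc (fun x => complex.Re (f (complex_point x))) /\
  real_harmonic_on plane_disc (fun x => complex.Im (f (complex_point x))).

Definition canonical_rep f h g : Prop :=
  [/\ analytic h, analytic g,
      forall z, disc z -> f z = h z + (g z)^*,
      h 0 = 0 /\ g 0 = 0 & cderiv h 0 = 1].

Definition class_H : set (R[i] -> R[i]) :=
  [set f | harmonic_disc f /\ exists h g, canonical_rep f h g].

Definition jacobian h g z : R := normc (cderiv h z) ^+ 2 - normc (cderiv g z) ^+ 2.

Definition sense_preserving h g : Prop :=
  forall z, disc z -> 0 < jacobian h g z.

Definition dilatation h g z : R[i] := cderiv g z / cderiv h z.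

(* The normalization makes h and g unique on the disc, so the existential
   quantifiers over canonical representations below refer to the same pair. *)
Definition class_SH : set (R[i] -> R[i]) :=
  [set f | [/\ class_H f, set_inj disc f &
    exists h g, canonical_rep f h g /\ sense_preserving h g]].

Definition class_SHK (K : R) : set (R[i] -> R[i]) :=
  [set f | class_SH f /\
    exists h g, canonical_rep f h g /\
      forall z, disc z -> normc (dilatation h g z) <= (K - 1) / (K + 1)].

Definition class_S : set (R[i] -> R[i]) :=
  [set psi | [/\ analytic psi, set_inj disc psi, psi 0 = 0 & cderiv psi 0 = 1]].

Definition quasi_subordinate phi psi : Prop :=
  exists xi eta,
    [/\ analytic xi /\ (forall z, disc z -> `|xi z| <= 1),
        analytic eta /\ (forall z, disc z -> `|eta z| < 1),
        eta 0 = 0 &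
        forall z, disc z -> phi z = xi z * psi (eta z)].

Definition cis (t : R) : R[i] := cos t +i* sin t.

Definition class_SHq (K : R) : set (R[i] -> R[i]) :=
  [set f | class_SHK K f /\
    exists h g, canonical_rep f h g /\
      exists (t : R) psi, class_S psi /\
        quasi_subordinate (fun z => h z + cis t * g z) psi].

Definition integral_mean (p r : R) f : \bar R :=
  (((2 * pi)^-1)%:E *
    \int[lebesgue_measure]_(t in `[0%R, (2 * pi)%R])
       ((normc (f (r%:C * cis t))) `^ p)%:E) `^ (p^-1).

Definition harmonic_hardy (p : R) : set (R[i] -> R[i]) :=
  [set f | harmonic_disc f /\
    (ereal_sup [set integral_mean p r f | r in `]0%R, 1%R[] < +oo)%E].

(* Density of A_beta with respect to the Lebesgue measure dx dy. *)
Definition area_density (beta : R) (z : R[i]) : R :=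
  pi^-1 * ((beta + 1) * (1 - normc z ^+ 2) `^ beta).

Definition harmonic_bergman (p beta : R) : set (R[i] -> R[i]) :=
  [set f | class_H f /\
    (\int[lebesgue_measure \x lebesgue_measure]_(x in plane_disc)
       (normc (f (complex_point x)) `^ p * area_density beta (complex_point x))%:E < +oo)%E].

End Disc.

(* Main.v *)
From HB Require Import structures.
Require Import Defs.
From mathcomp Require Import measurable_realfun ring lra.
Set Implicit Arguments.
Unset Strict Implicit.
Unset Printing Implicit Defensive.
Local Open Scope classical_set_scope.
Local Open Scope ring_scope.
Local Open Scope complex_scope.

(** Write [F = h + c g] with [|c| = 1], so that [F = xi * (psi \o eta)] with [psi]
    univalent. Because [|g'| <= k |h'|] with [k < 1], both [|h'|] and [|g'|] are at
    most [|F'| / (1 - k)]: what is known about the analytic function [F] passes to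
    [h] and [g], hence to [f = h + g^*].

    Means of [psi \o eta]. If [psi] takes the value [w], it does so once, and
    dividing by a Blaschke factor gives a zero-free function dominating [psi - w]
    ([zero_free_majorant]). Jensen's formula then bounds the means of
    [ln (1 / |psi (eta) - w|)] from below, and averaging over the circle [|w| = s]
    gives [mean (ln (max |psi (eta)| s)) <= ln s + ln (1 / |zeta|)] with
    [|psi zeta| = s] ([mean_ln_max]). The growth theorem
    [|psi z| <= C / (1 - |z|)^2] makes the last term [O (s^(-1/2))], and summing over
    a geometric progression of values of [s] bounds the means of [|psi (eta)|^q]
    for [q < 1/2] ([mean_subordinate]).

    The growth theorem follows from Koebe's one-quarter theorem [koebe_quarter].
    If [psi] omits [c], a square root of [1 - psi / c] followed by a Cayley
    transform is a function [tau] such that, for every [w], the equations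
    [tau = w] and [tau = 1 / w] have at most one solution between them. By Jensen's
    formula and an average over [|w| = s], the means of [(|ln |tau|| - v)^+] decrease
    with the radius for every [v >= 0], hence so do the means of [ln^2 |tau|], and
    this is only possible if [|tau' 0| <= 1].

    From [F] to [f]. A bound of the means of [|F|^p] does not pass to [h] and [g]
    by a pointwise inequality, since only the derivatives are compared. Put
    [G = psi (eta) / eta], which has no zero, [Q = G^(p/2)] and
    [W = |h|^2 + |g|^2 + |G|^2]. Concavity of [x^(p/2)] and [W >= |G|^2] bound the
    Laplacian of [W^(p/2)] by that of [C1 |xi eta Q|^2 + C2 |Q|^2]
    ([derivative_domination]), so the difference is subharmonic and the means of
    [W^(p/2)], which dominates [|f|^p], are controlled by those of
    [|Q|^2 = |G|^p] ([compare_mean], [hardy_mean]). Subharmonicity is expressed by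
    averages over four points, which suffices for the maximum principle and the
    monotonicity of circular means.

    Bergman spaces. Cauchy's estimate for [F'] and integration along radii give
    [|f| <= K (1 - |z|)^(-2)] ([pair_growth]). With [q < 1/2] close enough to [1/2],
    [|f|^p (1 - |z|^2)^beta] is at most a multiple of [|f|^q (1 - |z|^2)^gam] with
    [gam = beta - 2 (p - q) > -1]. As Lebesgue measure is invariant under rotations,
    [|f|^q] may be replaced by its circular means, which are bounded, and
    [(1 - |z|^2)^gam] is integrable ([area_bound]).

    The complex analysis rests on Goursat's theorem for rectangles: in logarithmic
    coordinates an annulus is a rectangle, which gives the mean value property, and
    from it the regularity of derivatives, the removability of the singularity of a
    difference quotient, primitives and logarithms. *)


(** * Moduli and polar form *)

Section ComplexNorm.
Variable R : realType.
Implicit Types (z w a : R[i]) (x y : R).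

Lemma discE z : disc z <-> normc z < 1.
Proof. by rewrite /disc /=; rewrite -[1]/(1%:C) -ltcR. Qed.

Lemma normc_ge0 z : 0 <= normc z.
Proof. by case: z => a b; rewrite /normc sqrtr_ge0. Qed.

Lemma sqr_normcE z : normc z ^+ 2 = complex.Re z ^+ 2 + complex.Im z ^+ 2.
Proof. by case: z => a b /=; rewrite sqr_sqrtr // addr_ge0 ?sqr_ge0. Qed.

Lemma normc_real x : normc x%:C = `|x|.
Proof. by rewrite /= expr0n /= addr0 sqrtr_sqr. Qed.

Lemma normc_eq0P z : (normc z == 0) = (z == 0).
Proof.
by apply/eqP/eqP => [/eq0_normc//|->]; rewrite normc0.
Qed.

Lemma normc_gt0 z : (0 < normc z) = (z != 0).
Proof. by rewrite lt_def normc_ge0 normc_eq0P andbT. Qed.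

Lemma normcB z w : normc (z - w) <= normc z + normc w.
Proof. by rewrite -[normc w]normcN le_normcD. Qed.

Lemma normc_sub z w : normc (z - w) = normc (w - z).
Proof. by rewrite -normcN opprB. Qed.

Lemma normc_triangle a z w : normc (z - w) <= normc (z - a) + normc (a - w).
Proof. by rewrite (le_trans _ (le_normcD _ _)) // addrA subrK. Qed.

Lemma lerB_normc z w : normc z - normc w <= normc (z - w).
Proof. by rewrite lerBlDr (le_trans _ (le_normcD _ _)) // subrK. Qed.

Lemma normc_dist z w : `|normc z - normc w| <= normc (z - w).
Proof.
rewrite ler_norml lerB_normc andbT lerNl opprB normc_sub; exact: lerB_normc.
Qed.

Lemma normcX z n : normc (z ^+ n) = normc z ^+ n.
Proof. by elim: n => [|n IH]; rewrite ?expr0 ?normc1 // !exprS normcM IH. Qed.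

Lemma normRe_le z : `|complex.Re z| <= normc z.
Proof.
rewrite -(@ler_pXn2r _ 2) ?nnegrE ?normc_ge0 // sqr_normcE -normrX.
by rewrite ger0_norm ?sqr_ge0 // lerDl sqr_ge0.
Qed.

Lemma normIm_le z : `|complex.Im z| <= normc z.
Proof.
rewrite -(@ler_pXn2r _ 2) ?nnegrE ?normc_ge0 // sqr_normcE -normrX.
by rewrite ger0_norm ?sqr_ge0 // lerDr sqr_ge0.
Qed.

Lemma Re_le_normc z : complex.Re z <= normc z.
Proof. exact: le_trans (ler_norm _) (normRe_le z). Qed.

Lemma normc_le_ReIm z : normc z <= `|complex.Re z| + `|complex.Im z|.
Proof.
rewrite -(@ler_pXn2r _ 2) ?nnegrE ?normc_ge0 ?addr_ge0 //.
by rewrite sqr_normcE sqrrD !real_normK ?num_real // lerD2r lerDl mulrn_wge0 ?mulr_ge0.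
Qed.

Lemma normc_conj z : normc z^* = normc z.
Proof. by case: z => a b /=; rewrite sqrrN. Qed.

Lemma mul_conjc z : z * z^* = (normc z ^+ 2)%:C.
Proof. by rewrite sqr_normcE; case: z => a b; simpc; congr (_ +i* _); ring. Qed.

Lemma complex_ext z w :
  complex.Re z = complex.Re w -> complex.Im z = complex.Im w -> z = w.
Proof. by case: z w => a b [c d] /= -> ->. Qed.

Lemma ReD z w : complex.Re (z + w) = complex.Re z + complex.Re w.
Proof. by case: z w => a b [c d]. Qed.
Lemma ImD z w : complex.Im (z + w) = complex.Im z + complex.Im w.
Proof. by case: z w => a b [c d]. Qed.
Lemma ReN z : complex.Re (- z) = - complex.Re z.
Proof. by case: z. Qed.
Lemma ImN z : complex.Im (- z) = - complex.Im z.
Proof. by case: z. Qed.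
Lemma ReM z w : complex.Re (z * w) =
  complex.Re z * complex.Re w - complex.Im z * complex.Im w.
Proof. by case: z w => a b [c d]. Qed.
Lemma ImM z w : complex.Im (z * w) =
  complex.Re z * complex.Im w + complex.Im z * complex.Re w.
Proof. by case: z w => a b [c d]. Qed.
Lemma ReJ z : complex.Re z^* = complex.Re z.
Proof. by case: z. Qed.
Lemma ImJ z : complex.Im z^* = - complex.Im z.
Proof. by case: z. Qed.
Definition ReImE := (ReD, ImD, ReN, ImN, ReM, ImM, ReJ, ImJ).

Lemma normc_cis x : normc (cis x) = 1 :> R.
Proof. by rewrite /= cos2Dsin2 sqrtr1. Qed.

Lemma cis0 : cis (0 : R) = 1.
Proof. by rewrite /cis cos0 sin0. Qed.

Lemma cisD x y : cis (x + y) = cis x * cis y.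
Proof. by rewrite /cis cosD sinD; simpc; congr (_ +i* _); ring. Qed.

Lemma cis_neq0 x : cis x != 0.
Proof. by rewrite -normc_gt0 normc_cis. Qed.

Lemma cisN x : cis (- x) = (cis x)^-1.
Proof.
by apply: (mulfI (cis_neq0 x)); rewrite mulfV ?cis_neq0 // -cisD subrr cis0.
Qed.

Lemma conjc_cis x : (cis x)^* = cis (- x).
Proof. by rewrite /cis cosN sinN. Qed.

Lemma cis2pi : cis (2 * pi) = 1 :> R[i].
Proof. by rewrite /cis mulr_natl cos2pi sin2pi. Qed.

Lemma normc_circle x y : 0 <= x -> normc (x%:C * cis y) = x.
Proof. by move=> x0; rewrite normcM normc_cis mulr1 normc_real ger0_norm. Qed.

Lemma polarE z : exists2 t, - pi <= t <= pi & z = (normc z)%:C * cis t.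
Proof.
have [->|z0] := eqVneq z 0.
  by exists 0; rewrite ?normc0 ?mul0r // oppr_le0 pi_ge0.
have nz : 0 < normc z by rewrite normc_gt0.
set c := complex.Re z / normc z; set s := complex.Im z / normc z.
have cs : c ^+ 2 + s ^+ 2 = 1.
  rewrite /c /s !expr_div_n -mulrDl -sqr_normcE divff //.
  by rewrite expf_neq0 // gt_eqF.
have c1 : -1 <= c <= 1.
  rewrite -ler_norml -(@ler_pXn2r _ 2) ?nnegrE // expr1n -normrX.
  by rewrite ger0_norm ?sqr_ge0 // -cs lerDl sqr_ge0.
have sc : sin (acos c) = `|s|.
  by rewrite sin_acos // -cs addrC addKr sqrtr_sqr.
have pi0 := pi_ge0 R; have a0 := acos_ge0 c1; have a1 := acos_lepi c1.
have h : exists2 t, - pi <= t <= pi & cos t = c /\ sin t = s.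
  have [s0|s0] := leP 0 s.
    exists (acos c); first by apply/andP; split; lra.
    by rewrite sc ger0_norm // acosK // in_itv.
  exists (- acos c); first by apply/andP; split; lra.
  by rewrite cosN sinN sc ltr0_norm // opprK acosK // in_itv.
have nn : normc z != 0 by rewrite gt_eqF.
case: h => t tpi [ct st]; exists t => //; apply: complex_ext; rewrite !ReImE /= ct st.
  by rewrite mul0r subr0 mulrC divfK.
by rewrite mul0r addr0 mulrC divfK.
Qed.

End ComplexNorm.


(** * Continuity and complex differentiability *)

Section ComplexCalculus.
Variable R : realType.
Implicit Types (z w a d e : R[i]) (phi chi q : R[i] -> R[i]) (U V : R[i] -> R).

Definition cont_at phi z := forall eps : R, 0 < eps -> exists2 del : R, 0 < del &
  forall w, normc (w - z) < del -> normc (phi w - phi z) < eps.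

Definition rcont_at U z := forall eps : R, 0 < eps -> exists2 del : R, 0 < del &
  forall w, normc (w - z) < del -> `|U w - U z| < eps.

Lemma rcontE U z : rcont_at U z <-> cont_at (fun w => (U w)%:C) z.
Proof.
by split=> h e /h [d d0 hd]; exists d => // w /hd; rewrite -rmorphB normc_real.
Qed.

Lemma cont_local phi chi z (r : R) : 0 < r ->
  (forall w, normc (w - z) < r -> phi w = chi w) -> cont_at phi z -> cont_at chi z.
Proof.
move=> r0 E h e /h [d d0 hd]; exists (Num.min d r); first by rewrite lt_min d0.
move=> w; rewrite lt_min => /andP[wd wr]; rewrite -!E //; first exact: hd.
by rewrite subrr normc0.
Qed.

Lemma cont_cst a z : cont_at (fun=> a) z.
Proof. by move=> e e0; exists 1 => // w _; rewrite subrr normc0. Qed.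

Lemma cont_id z : cont_at id z.
Proof. by move=> e e0; exists e. Qed.

Lemma cont_add phi chi z : cont_at phi z -> cont_at chi z ->
  cont_at (fun w => phi w + chi w) z.
Proof.
move=> h1 h2 e e0; have e2 : 0 < e / 2 by rewrite divr_gt0.
have [d1 d10 H1] := h1 _ e2; have [d2 d20 H2] := h2 _ e2.
exists (Num.min d1 d2); first by rewrite lt_min d10.
move=> w; rewrite lt_min => /andP[/H1 A /H2 B].
have -> : phi w + chi w - (phi z + chi z) = (phi w - phi z) + (chi w - chi z) by ring.
by apply: le_lt_trans (le_normcD _ _) _; rewrite [e]splitr ltrD.
Qed.

Lemma cont_opp phi z : cont_at phi z -> cont_at (fun w => - phi w) z.
Proof.
by move=> h e /h [d d0 H]; exists d => // w /H; rewrite -opprD normcN.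
Qed.

Lemma cont_sub phi chi z : cont_at phi z -> cont_at chi z ->
  cont_at (fun w => phi w - chi w) z.
Proof. by move=> h1 h2; apply: cont_add => //; exact: cont_opp. Qed.

Lemma cont_bounded phi z : cont_at phi z -> exists M : R, exists2 del : R, 0 < del &
  0 < M /\ forall w, normc (w - z) < del -> normc (phi w) <= M.
Proof.
move=> /(_ 1 ltr01) [d d0 H]; exists (normc (phi z) + 1), d => //; split.
  by rewrite ltr_wpDl ?normc_ge0.
move=> w /H A; rewrite -lerBlDl; apply: le_trans (ltW A); exact: lerB_normc.
Qed.

Lemma cont_mul phi chi z : cont_at phi z -> cont_at chi z ->
  cont_at (fun w => phi w * chi w) z.
Proof.
move=> h1 h2 e e0.
have [M [d0 d00 [M0 HM]]] := cont_bounded h2.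
set A := normc (phi z) + 1; have A0 : 0 < A by rewrite ltr_wpDl ?normc_ge0.
have e1 : 0 < e / 2 / M by rewrite !divr_gt0.
have e2 : 0 < e / 2 / A by rewrite !divr_gt0.
have [d1 d10 H1] := h1 _ e1; have [d2 d20 H2] := h2 _ e2.
exists (Num.min d0 (Num.min d1 d2)); first by rewrite !lt_min d00 d10.
move=> w; rewrite !lt_min => /andP[/HM B0 /andP[/H1 B1 /H2 B2]].
have -> : phi w * chi w - phi z * chi z =
  (phi w - phi z) * chi w + phi z * (chi w - chi z) by ring.
apply: le_lt_trans (le_normcD _ _) _; rewrite !normcM [e]splitr ler_ltD //.
  by rewrite -[leRHS](@divfK _ M) ?gt_eqF // ler_pM ?normc_ge0 // ltW.
rewrite -[ltRHS](@divfK _ A) ?gt_eqF // mulrC.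
apply: le_lt_trans (_ : normc (chi w - chi z) * A < _); last by rewrite ltr_pM2r.
by rewrite ler_wpM2l ?normc_ge0 // lerDl.
Qed.

Lemma cont_inv phi z : cont_at phi z -> phi z != 0 -> cont_at (fun w => (phi w)^-1) z.
Proof.
move=> h nz e e0; set m := normc (phi z); have m0 : 0 < m by rewrite normc_gt0.
have [d1 d10 H1] := h _ (divr_gt0 m0 (ltr0Sn _ 1)).
have e1 : 0 < e * m ^+ 2 / 2 by rewrite divr_gt0 // mulr_gt0 // exprn_gt0.
have [d2 d20 H2] := h _ e1.
exists (Num.min d1 d2); first by rewrite lt_min d10.
move=> w; rewrite lt_min => /andP[/H1 A /H2 B].
have wm : m / 2 < normc (phi w).
  have := lerB_normc (phi z) (phi w); rewrite normc_sub -/m; lra.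
have wnz : phi w != 0 by rewrite -normc_gt0 (lt_trans _ wm) // divr_gt0.
have -> : (phi w)^-1 - (phi z)^-1 = - ((phi w - phi z) / (phi w * phi z)).
  by field; rewrite wnz nz.
rewrite normcN normcM normcV normcM -/m ltr_pdivrMr ?mulr_gt0 //; last first.
  by rewrite (lt_trans _ wm) // divr_gt0.
apply: lt_le_trans B _; rewrite -mulrA ler_pM2l // expr2 mulrAC ler_pM2r //.
exact: ltW.
Qed.

Lemma cont_comp phi chi z : cont_at phi z -> cont_at chi (phi z) ->
  cont_at (fun w => chi (phi w)) z.
Proof.
by move=> h1 h2 e /h2 [d /h1 [d' d'0 H1] H2]; exists d' => // w /H1 /H2.
Qed.

Lemma cont_conj phi z : cont_at phi z -> cont_at (fun w => (phi w)^*) z.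
Proof. by move=> h e /h [d d0 H]; exists d => // w /H; rewrite -rmorphB normc_conj. Qed.

Lemma cont_exp phi n z : cont_at phi z -> cont_at (fun w => phi w ^+ n) z.
Proof.
move=> h; elim: n => [|n IH].
  by move: (@cont_cst 1 z); apply: (@cont_local _ _ _ 1).
by move: (cont_mul h IH); apply: (@cont_local _ _ _ 1) => // w _; rewrite exprS.
Qed.

Lemma rcont_Re phi z : cont_at phi z -> rcont_at (fun w => complex.Re (phi w)) z.
Proof.
move=> h e /h [d d0 H]; exists d => // w /H; apply: le_lt_trans.
by rewrite -ReN -ReD normRe_le.
Qed.

Lemma rcont_Im phi z : cont_at phi z -> rcont_at (fun w => complex.Im (phi w)) z.
Proof.
move=> h e /h [d d0 H]; exists d => // w /H; apply: le_lt_trans.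
by rewrite -ImN -ImD normIm_le.
Qed.

Lemma rcont_normc phi z : cont_at phi z -> rcont_at (fun w => normc (phi w)) z.
Proof.
by move=> h e /h [d d0 H]; exists d => // w /H; apply: le_lt_trans; rewrite normc_dist.
Qed.

Lemma rcont_add U V z : rcont_at U z -> rcont_at V z -> rcont_at (fun w => U w + V w) z.
Proof.
move=> /rcontE h1 /rcontE h2; apply/rcontE; move: (cont_add h1 h2).
by apply: (@cont_local _ _ _ 1) => // w _; rewrite rmorphD.
Qed.

Lemma rcont_opp U z : rcont_at U z -> rcont_at (fun w => - U w) z.
Proof.
move=> /rcontE h1; apply/rcontE; move: (cont_opp h1).
by apply: (@cont_local _ _ _ 1) => // w _; rewrite rmorphN.
Qed.

Lemma rcont_mul U V z : rcont_at U z -> rcont_at V z -> rcont_at (fun w => U w * V w) z.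
Proof.
move=> /rcontE h1 /rcontE h2; apply/rcontE; move: (cont_mul h1 h2).
by apply: (@cont_local _ _ _ 1) => // w _; rewrite rmorphM.
Qed.

Lemma rcont_cst (x : R) z : rcont_at (fun=> x) z.
Proof. by move=> e e0; exists 1 => // w _; rewrite subrr normr0. Qed.

Lemma rcont_exp U n z : rcont_at U z -> rcont_at (fun w => U w ^+ n) z.
Proof.
move=> /rcontE h1; apply/rcontE; move: (cont_exp n h1).
by apply: (@cont_local _ _ _ 1) => // w _; rewrite rmorphXn.
Qed.

Lemma rcont_comp (f : R -> R) U z : rcont_at U z -> {for U z, continuous f} ->
  rcont_at (fun w => f (U w)) z.
Proof.
move=> h /cvgrPdist_lt hf e /hf /nbhs_ballP[d /= /h [d' d'0 H] Hd].
exists d' => // w /H A; rewrite distrC; apply: Hd.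
by rewrite /ball /= distrC.
Qed.

(** Caratheodory's form of differentiability: the product, chain and inverse
    rules become statements about continuity of the slope. *)
Definition hasd phi z d := exists q, [/\ forall w, phi w = phi z + q w * (w - z),
  cont_at q z & q z = d].

Lemma hasd_cont phi z d : hasd phi z d -> cont_at phi z.
Proof.
case=> q [E cq _]; suff : cont_at (fun w => phi z + q w * (w - z)) z.
  by apply: (@cont_local _ _ _ 1) => // w _; rewrite -E.
apply: cont_add; first exact: cont_cst.
by apply: cont_mul => //; apply: cont_sub; [exact: cont_id|exact: cont_cst].
Qed.

Lemma hasd_cst a z : hasd (fun=> a) z 0.
Proof.
by exists (fun=> 0); split=> // [w|]; [rewrite mul0r addr0|exact: cont_cst].
Qed.

Lemma hasd_id z : hasd id z 1.
Proof.
exists (fun=> 1); split=> //; first by move=> w; rewrite mul1r addrC subrK.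
exact: cont_cst.
Qed.

Lemma hasd_add phi chi z d e : hasd phi z d -> hasd chi z e ->
  hasd (fun w => phi w + chi w) z (d + e).
Proof.
move=> [q [E cq <-]] [q' [E' cq' <-]]; exists (fun w => q w + q' w); split => //.
  by move=> w; rewrite E E'; ring.
exact: cont_add.
Qed.

Lemma hasd_opp phi z d : hasd phi z d -> hasd (fun w => - phi w) z (- d).
Proof.
move=> [q [E cq <-]]; exists (fun w => - q w); split => //.
  by move=> w; rewrite E; ring.
exact: cont_opp.
Qed.

Lemma hasd_sub phi chi z d e : hasd phi z d -> hasd chi z e ->
  hasd (fun w => phi w - chi w) z (d - e).
Proof. by move=> h1 h2; apply: hasd_add => //; exact: hasd_opp. Qed.

Lemma hasd_mul phi chi z d e : hasd phi z d -> hasd chi z e ->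
  hasd (fun w => phi w * chi w) z (d * chi z + phi z * e).
Proof.
move=> h [q' [E' cq' <-]]; have cphi := hasd_cont h; case: h => q [E cq <-].
exists (fun w => q w * chi z + phi w * q' w); split => //.
  by move=> w; rewrite (E' w) (E w); ring.
by apply: cont_add; apply: cont_mul => //; exact: cont_cst.
Qed.

Lemma hasd_scale a phi z d : hasd phi z d -> hasd (fun w => a * phi w) z (a * d).
Proof.
by move=> h; have := hasd_mul (hasd_cst a z) h; rewrite mul0r add0r.
Qed.

Lemma hasd_comp phi chi z d e : hasd phi z d -> hasd chi (phi z) e ->
  hasd (fun w => chi (phi w)) z (e * d).
Proof.
move=> h [q' [E' cq' <-]]; have cphi := hasd_cont h; case: h => q [E cq <-].
exists (fun w => q' (phi w) * q w); split => //.
  by move=> w; rewrite [LHS]E' -mulrA [phi w]E; congr (_ + _ * _); ring.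
by apply: cont_mul => //; apply: (@cont_comp phi q').
Qed.

Lemma hasd_local phi chi z d (r : R) : 0 < r ->
  (forall w, normc (w - z) < r -> phi w = chi w) -> hasd phi z d -> hasd chi z d.
Proof.
move=> r0 E [q [Eq cq qz]].
pose q' w := if w == z then d else (chi w - chi z) / (w - z).
exists q'; split.
- move=> w; rewrite /q'; case: eqVneq => [->|wz]; first by rewrite subrr mulr0 addr0.
  by rewrite divfK ?subr_eq0 // addrC subrK.
- move: cq; apply: (cont_local r0) => w wr; rewrite /q'; case: eqVneq => [->//|wz].
  rewrite -!E //; last by rewrite subrr normc0.
  by rewrite Eq [phi z + _]addrC addrK mulfK // subr_eq0.
by rewrite /q' eqxx.
Qed.

Lemma hasd_inv phi z d : hasd phi z d -> phi z != 0 ->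
  hasd (fun w => (phi w)^-1) z (- d / phi z ^+ 2).
Proof.
move=> h nz; have cphi := hasd_cont h.
have n0 : 0 < normc (phi z) by rewrite normc_gt0.
have [del del0 Hd] := cphi _ n0.
(* Freezing the function where it could vanish makes the slope of the inverse
   meaningful everywhere. *)
pose g w := if normc (w - z) < del then phi w else phi z.
have gnz w : g w != 0.
  rewrite /g; case: ifPn => // /Hd; apply: contraTneq => ->.
  by rewrite sub0r normcN ltxx.
have gz : g z = phi z by rewrite /g; case: ifP.
have hg : hasd g z d.
  by apply: (@hasd_local phi _ _ _ del) => // w wr; rewrite /g wr.
have cg := hasd_cont hg; case: hg => p [Ep cp pz].
apply: (@hasd_local (fun w => (g w)^-1) _ _ _ del) => //.
  by move=> w wr; rewrite /g wr.
exists (fun w => - p w / (g w * g z)); split.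
- move=> w; have nw := gnz w; have nz' := gnz z.
  have -> : - p w / (g w * g z) * (w - z) = - (p w * (w - z)) / (g w * g z) by ring.
  have -> : p w * (w - z) = g w - g z by rewrite [g w in RHS]Ep; ring.
  by field; rewrite nw nz'.
- apply: cont_mul; first exact: cont_opp.
  apply: cont_inv; last by rewrite mulf_neq0.
  by apply: cont_mul => //; exact: cont_cst.
by rewrite pz gz expr2.
Qed.

Lemma hasd_eps phi z d : hasd phi z d -> forall eps : R, 0 < eps ->
  exists2 del : R, 0 < del & forall w, normc (w - z) < del ->
  normc (phi w - phi z - d * (w - z)) <= eps * normc (w - z).
Proof.
move=> [q [E cq qz]] e /cq [del d0 H]; exists del => // w /H A.
rewrite E -qz.
have -> : phi z + q w * (w - z) - phi z - q z * (w - z) = (q w - q z) * (w - z) by ring.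
by rewrite normcM ler_wpM2r ?normc_ge0 // ltW.
Qed.

Lemma eps_hasd phi z d : (forall eps : R, 0 < eps ->
  exists2 del : R, 0 < del & forall w, normc (w - z) < del ->
  normc (phi w - phi z - d * (w - z)) <= eps * normc (w - z)) -> hasd phi z d.
Proof.
move=> H; pose q w := if w == z then d else (phi w - phi z) / (w - z).
have qE w : phi w = phi z + q w * (w - z).
  rewrite /q; case: eqVneq => [->|wz]; first by rewrite subrr mulr0 addr0.
  by rewrite divfK ?subr_eq0 // addrC subrK.
exists q; split=> //; last by rewrite /q eqxx.
move=> e e0; have [del d0 Hd] := H _ (divr_gt0 e0 (ltr0Sn _ 1)).
exists del => // w wd; have [->|wz] := eqVneq w z; first by rewrite subrr normc0.
have := Hd _ wd; rewrite (qE w).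
have -> : phi z + q w * (w - z) - phi z - d * (w - z) = (q w - d) * (w - z) by ring.
rewrite normcM ler_pM2r ?normc_gt0 ?subr_eq0 // => A.
have -> : q z = d by rewrite /q eqxx.
by apply: le_lt_trans A _; lra.
Qed.

Lemma hasd_unique phi z d e : hasd phi z d -> hasd phi z e -> d = e.
Proof.
move=> [q [E cq <-]] [q' [E' cq' <-]].
apply/eqP; rewrite -subr_eq0 -normc_eq0P; apply/eqP/le_anti; rewrite normc_ge0 andbT.
apply/ler_addgt0Pr => eps e0; rewrite add0r.
have [d1 d10 H] := cont_sub cq cq' e0.
pose w := z + (d1 / 2)%:C.
have wz : w - z = (d1 / 2)%:C by rewrite /w addrC addKr.
have wz0 : w - z != 0 by rewrite wz -normc_gt0 normc_real normr_gt0 gt_eqF // divr_gt0.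
have qq : q w = q' w.
  by apply: (mulIf wz0); apply: (addrI (phi z)); rewrite -E -E'.
have := H w; rewrite qq subrr sub0r normcN => h; apply/ltW/h.
by rewrite wz normc_real gtr0_norm ?divr_gt0 //; lra.
Qed.

Lemma derivable_hasd phi z : derivable (phi : R[i]^o -> R[i]^o) z 1 ->
  hasd phi z (cderiv phi z).
Proof.
move=> h; apply: eps_hasd => eps e0.
have e0' : 0 < eps%:C by rewrite ltcR.
have /cvgrPdist_lt/(_ _ e0') := h.
rewrite /prop_near1 /dnbhs /within /= => /(@nbhs_ballP R[i] R[i]^o)[del /= del0 B].
have dE : del = (complex.Re del)%:C.
  by apply: complex_ext => //=; move: del0; rewrite ltcE /= => /andP[/eqP].
exists (complex.Re del); first by rewrite -ltcR -dE.
move=> w wd; have [->|wz] := eqVneq w z; first by rewrite !subrr mulr0 subrr normc0 mulr0.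
have wz0 : w - z != 0 by rewrite subr_eq0.
have /B : ball (0 : R[i]^o) del (w - z).
  by rewrite -ball_normE /ball_ /= sub0r normrN dE ltcR.
move=> /(_ wz0).
rewrite -/(cderiv phi z) [(w - z)%:A]mulr1 subrK => C.
have {C} : normc (cderiv phi z - (w - z)^-1 * (phi w - phi z)) < eps by rewrite -ltcR.
move/ltW => C.
have -> : phi w - phi z - cderiv phi z * (w - z) =
  - (cderiv phi z - (w - z)^-1 * (phi w - phi z)) * (w - z) by field.
by rewrite normcM normcN ler_wpM2r ?normc_ge0.
Qed.

Definition holo_on (A : set R[i]) phi := forall z, A z -> exists d, hasd phi z d.

Lemma analytic_hasd phi z : analytic phi -> disc z -> hasd phi z (cderiv phi z).
Proof. by move=> h /h; exact: derivable_hasd. Qed.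



End ComplexCalculus.


(** * Integrals of continuous functions over segments *)

Section SegmentIntegral.
Variable R : realType.
Implicit Types (a b c M : R) (f g : R -> R).
Notation mu := (@lebesgue_measure R).

Definition segint a b f : R := \int[mu]_(x in `[a, b]) f x.

Definition cont_seg a b f := forall x, a <= x <= b -> {for x, continuous f}.

Lemma cont_seg_integrable a b f : cont_seg a b f -> mu.-integrable `[a, b] (EFin \o f).
Proof.
move=> cf; apply: continuous_compact_integrable; first exact: segment_compact.
by apply: continuous_in_subspaceT => x /set_mem /=; rewrite in_itv /= => /cf.
Qed.

Lemma cont_segW a b a' b' f : a <= a' -> b' <= b -> cont_seg a b f -> cont_seg a' b' f.
Proof. by move=> aa bb cf x /andP[h1 h2]; apply: cf; apply/andP; split; lra. Qed.

Lemma eq_segint a b f g : (forall x, a <= x <= b -> f x = g x) -> segint a b f = segint a b g.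
Proof. by move=> E; apply: eq_Rintegral => x /set_mem /=; rewrite in_itv /= => /E. Qed.

Lemma segint_split a b c f : a <= b -> b <= c -> cont_seg a c f ->
  segint a c f = segint a b f + segint b c f.
Proof.
move=> ab bc cf; have := @Rintegral_itvB R f (BLeft a) (BRight c) b (cont_seg_integrable cf).
rewrite !bnd_simp => /(_ ab bc) => E.
rewrite /segint -(@Rintegral_itv_obnd_cbnd R b (BRight c) f).
  by rewrite -E addrC subrK.
have := cont_seg_integrable (cont_segW ab (lexx c) cf).
apply: integrableS => //.
by apply: subset_itvr; rewrite bnd_simp.
Qed.

Lemma segint_cst a b c : a <= b -> segint a b (fun=> c) = (b - a) * c.
Proof.
move=> ab; rewrite /segint Rintegral_cst //= lebesgue_measure_itv /= lte_fin mulrC.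
by case: ltP => //= ba; congr (_ * _); lra.
Qed.

Lemma segintD a b f g : cont_seg a b f -> cont_seg a b g ->
  segint a b (fun x => f x + g x) = segint a b f + segint a b g.
Proof. by move=> cf cg; apply: RintegralD => //; exact: cont_seg_integrable. Qed.

Lemma segintB a b f g : cont_seg a b f -> cont_seg a b g ->
  segint a b (fun x => f x - g x) = segint a b f - segint a b g.
Proof. by move=> cf cg; apply: RintegralB => //; exact: cont_seg_integrable. Qed.

Lemma segintZ a b c f : cont_seg a b f ->
  segint a b (fun x => c * f x) = c * segint a b f.
Proof. by move=> cf; apply: RintegralZl => //; exact: cont_seg_integrable. Qed.

Lemma le_segint a b f g : cont_seg a b f -> cont_seg a b g ->
  (forall x, a <= x <= b -> f x <= g x) -> segint a b f <= segint a b g.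
Proof.
by move=> cf cg H; apply: le_Rintegral => //; exact: cont_seg_integrable.
Qed.

Lemma cont_seg_cst a b c : cont_seg a b (fun=> c).
Proof. by move=> x _; exact: cst_continuous. Qed.

Lemma cont_segB a b f g : cont_seg a b f -> cont_seg a b g ->
  cont_seg a b (fun x => f x - g x).
Proof. by move=> cf cg x ab; apply: (@continuousB _ R^o R^o f g x); [exact: cf|exact: cg]. Qed.

Lemma cont_segD a b f g : cont_seg a b f -> cont_seg a b g ->
  cont_seg a b (fun x => f x + g x).
Proof. by move=> cf cg x ab; apply: (@continuousD _ R^o R^o f g x); [exact: cf|exact: cg]. Qed.

Lemma cont_segM a b f g : cont_seg a b f -> cont_seg a b g ->
  cont_seg a b (fun x => f x * g x).
Proof. by move=> cf cg x ab; apply: (@continuousM R R^o f g x); [exact: cf|exact: cg]. Qed.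

Lemma segint_dist a b c M f : a <= b -> cont_seg a b f ->
  (forall x, a <= x <= b -> `|f x - c| <= M) -> `|segint a b f - (b - a) * c| <= (b - a) * M.
Proof.
move=> ab cf H.
have H1 : segint a b (fun=> c - M) <= segint a b f.
  apply: le_segint => //; first exact: cont_seg_cst.
  by move=> x /H; rewrite ler_norml => /andP[]; lra.
have H2 : segint a b f <= segint a b (fun=> c + M).
  apply: le_segint => //; first exact: cont_seg_cst.
  by move=> x /H; rewrite ler_norml => /andP[]; lra.
rewrite !segint_cst // in H1 H2; rewrite ler_norml; apply/andP; split; lra.
Qed.

End SegmentIntegral.

(** * Goursat's theorem for rectangles *)

Section Goursat.
Variable R : realType.
Implicit Types (x y w h : R) (H : R[i] -> R[i]).

(** An additive quantity on rectangles keeps at least a quarter of its absolute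
    value on one of the four quarters; iterating, these shrink to a point. *)
Lemma bisection (J : nat -> R -> R -> R) x0 y0 w h : 0 <= w -> 0 <= h ->
  (forall n x y, x0 <= x -> x + w / 2 ^+ n <= x0 + w ->
     y0 <= y -> y + h / 2 ^+ n <= y0 + h ->
     J n x y = J n.+1 x y + J n.+1 (x + w / 2 ^+ n.+1) y +
       J n.+1 x (y + h / 2 ^+ n.+1) + J n.+1 (x + w / 2 ^+ n.+1) (y + h / 2 ^+ n.+1)) ->
  exists p q, forall n, exists x y,
    [/\ x0 <= x /\ x + w / 2 ^+ n <= x0 + w, y0 <= y /\ y + h / 2 ^+ n <= y0 + h,
      x <= p <= x + w / 2 ^+ n, y <= q <= y + h / 2 ^+ n &
      `|J 0%N x0 y0| <= 4 ^+ n * `|J n x y|].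
Proof.
move=> w0 h0 HJ.
pose inside n (s : R * R) := [/\ x0 <= s.1, s.1 + w / 2 ^+ n <= x0 + w,
  y0 <= s.2 & s.2 + h / 2 ^+ n <= y0 + h].
pose child n (s s' : R * R) := [/\ s.1 <= s'.1 /\ s'.1 + w / 2 ^+ n.+1 <= s.1 + w / 2 ^+ n,
  s.2 <= s'.2 /\ s'.2 + h / 2 ^+ n.+1 <= s.2 + h / 2 ^+ n &
  inside n s -> `|J n s.1 s.2| <= 4 * `|J n.+1 s'.1 s'.2|].
have half (v : R) n : v / 2 ^+ n = v / 2 ^+ n.+1 + v / 2 ^+ n.+1.
  by rewrite exprS; field; rewrite expf_neq0.
have pos (v : R) n : 0 <= v -> 0 <= v / 2 ^+ n.
  by move=> v0; rewrite divr_ge0 // exprn_ge0.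
have next (k : nat * (R * R)) : exists s', child k.1 k.2 s'.
  case: k => n [x y] /=.
  have [ins|nins] := pselect (inside n (x, y)); last first.
    exists (x, y); split => //=; rewrite (half _ n);
    split => //; have := pos w n.+1 w0; have := pos h n.+1 h0; lra.
  have := HJ n x y; case: (ins) => /= i1 i2 i3 i4 /(_ i1 i2 i3 i4) E.
  set a1 := J n.+1 x y in E; set a2 := J n.+1 _ y in E; set a3 := J n.+1 x _ in E.
  set a4 := J n.+1 _ _ in E.
  have tri : `|J n x y| <= `|a1| + `|a2| + `|a3| + `|a4|.
    by rewrite E; do 3 (apply: le_trans (ler_normD _ _) _; rewrite lerD2r).
  have pw := pos w n.+1 w0; have ph := pos h n.+1 h0.
  have hw := half w n; have hh := half h n.
  have [b1|b1] := leP `|J n x y| (4 * `|a1|).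
    by exists (x, y); split => //=; split; lra.
  have [b2|b2] := leP `|J n x y| (4 * `|a2|).
    by exists (x + w / 2 ^+ n.+1, y); split => //=; split; lra.
  have [b3|b3] := leP `|J n x y| (4 * `|a3|).
    by exists (x, y + h / 2 ^+ n.+1); split => //=; split; lra.
  have [b4|b4] := leP `|J n x y| (4 * `|a4|).
    by exists (x + w / 2 ^+ n.+1, y + h / 2 ^+ n.+1); split => //=; split; lra.
  by exfalso; lra.
have [F HF] := choice next.
pose s := fix s n := if n is m.+1 then F (m, s m) else (x0, y0).
have sS n : child n (s n) (s n.+1) by exact: HF (n, s n).
have ins n : inside n (s n).
  elim: n => [|n [a1 a2 a3 a4]]; first by split; rewrite /= ?expr0 ?divr1.
  by case: (sS n) => -[b1 b2] [b3 b4] _; split; lra.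
have mono1 n m : (s n).1 <= (s (n + m)%N).1 /\
    (s (n + m)%N).1 + w / 2 ^+ (n + m) <= (s n).1 + w / 2 ^+ n.
  elim: m => [|m [IH1 IH2]]; first by rewrite addn0.
  by rewrite addnS; case: (sS (n + m)%N) => -[b1 b2] _ _; split; lra.
have mono2 n m : (s n).2 <= (s (n + m)%N).2 /\
    (s (n + m)%N).2 + h / 2 ^+ (n + m) <= (s n).2 + h / 2 ^+ n.
  elim: m => [|m [IH1 IH2]]; first by rewrite addn0.
  by rewrite addnS; case: (sS (n + m)%N) => _ [b1 b2] _; split; lra.
have ub1 n m : (s m).1 <= (s n).1 + w / 2 ^+ n.
  have [A _] := mono1 m n; have [_ B] := mono1 n m.
  by have := pos w (n + m)%N w0; rewrite addnC in A; lra.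
have ub2 n m : (s m).2 <= (s n).2 + h / 2 ^+ n.
  have [A _] := mono2 m n; have [_ B] := mono2 n m.
  by have := pos h (n + m)%N h0; rewrite addnC in A; lra.
pose X := range (fun n => (s n).1); pose Y := range (fun n => (s n).2).
have supX : has_sup X.
  by split; [exists (s 0%N).1, 0%N|exists ((s 0%N).1 + w / 2 ^+ 0) => _ [m _ <-]; exact: ub1].
have supY : has_sup Y.
  by split; [exists (s 0%N).2, 0%N|exists ((s 0%N).2 + h / 2 ^+ 0) => _ [m _ <-]; exact: ub2].
exists (sup X), (sup Y) => n; exists (s n).1, (s n).2.
have [i1 i2 i3 i4] := ins n; split => //.
- apply/andP; split; first by apply: (ub_le_sup supX.2); exists n.
  by apply: ge_sup => [|_ [m _ <-]]; [exact: supX.1|exact: ub1].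
- apply/andP; split; first by apply: (ub_le_sup supY.2); exists n.
  by apply: ge_sup => [|_ [m _ <-]]; [exact: supY.1|exact: ub2].
elim: n {i1 i2 i3 i4} => [|n IH]; first by rewrite expr0 mul1r.
apply: le_trans IH _; case: (sS n) => _ _ /(_ (ins n)) B.
by rewrite exprSr -mulrA ler_wpM2l // exprn_ge0.
Qed.

(** The real part of the integral of [H] along the boundary of a rectangle. *)
Definition rectint H x y w h :=
  segint x (x + w) (fun s => complex.Re (H (s +i* y)) - complex.Re (H (s +i* (y + h)))) -
  segint y (y + h) (fun t => complex.Im (H ((x + w) +i* t)) - complex.Im (H (x +i* t))).

Definition in_rect x y w h (z : R[i]) :=
  (x <= complex.Re z <= x + w) && (y <= complex.Im z <= y + h).

Lemma cont_at_row H x y : cont_at H (x +i* y) ->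
  {for x, continuous (fun s => complex.Re (H (s +i* y)))} /\
  {for x, continuous (fun s => complex.Im (H (s +i* y)))}.
Proof.
move=> ch; split; apply/cvgrPdist_lt => e /ch [d d0 Hd]; apply/nbhs_ballP;
exists d => // s; rewrite /ball /= => sd;
rewrite distrC -?ReN -?ImN -?ReD -?ImD.
- apply: le_lt_trans (normRe_le _) _; apply: Hd.
  have -> : s +i* y - x +i* y = (s - x)%:C by apply: complex_ext; rewrite !ReImE /= ?subrr.
  by rewrite normc_real distrC.
- apply: le_lt_trans (normIm_le _) _; apply: Hd.
  have -> : s +i* y - x +i* y = (s - x)%:C by apply: complex_ext; rewrite !ReImE /= ?subrr.
  by rewrite normc_real distrC.
Qed.

Lemma normc_imag y : normc (0 +i* y) = `|y|.
Proof. by rewrite /= expr0n /= add0r sqrtr_sqr. Qed.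

Lemma cont_at_col H x y : cont_at H (x +i* y) ->
  {for y, continuous (fun t => complex.Re (H (x +i* t)))} /\
  {for y, continuous (fun t => complex.Im (H (x +i* t)))}.
Proof.
move=> ch; split; apply/cvgrPdist_lt => e /ch [d d0 Hd]; apply/nbhs_ballP;
exists d => // s; rewrite /ball /= => sd;
rewrite distrC -?ReN -?ImN -?ReD -?ImD.
- apply: le_lt_trans (normRe_le _) _; apply: Hd.
  have -> : x +i* s - x +i* y = 0 +i* (s - y) by apply: complex_ext; rewrite !ReImE /= ?subrr.
  by rewrite normc_imag distrC.
- apply: le_lt_trans (normIm_le _) _; apply: Hd.
  have -> : x +i* s - x +i* y = 0 +i* (s - y) by apply: complex_ext; rewrite !ReImE /= ?subrr.
  by rewrite normc_imag distrC.
Qed.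

(** Near the limit point of the bisection, [H] is affine up to an error that is
    small compared to the size of the rectangle. Affine functions have boundary
    integral [0], and the error is beaten by the factor [4 ^ n]. *)
Lemma goursat H x y w h : 0 <= w -> 0 <= h ->
  holo_on (in_rect x y w h) H -> rectint H x y w h = 0.
Proof.
move=> w0 h0 holH.
have cH z : in_rect x y w h z -> cont_at H z by move=> /holH [d /hasd_cont].
have pos (v : R) n : 0 <= v -> 0 <= v / 2 ^+ n.
  by move=> v0; rewrite divr_ge0 // exprn_ge0.
pose J n x' y' := rectint H x' y' (w / 2 ^+ n) (h / 2 ^+ n).
have half (v : R) n : v / 2 ^+ n = v / 2 ^+ n.+1 + v / 2 ^+ n.+1.
  by rewrite exprS; field; rewrite expf_neq0.
have [] := @bisection J x y w h w0 h0.
  move=> n x' y' i1 i2 i3 i4; rewrite /J /rectint !(half _ n).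
  have := pos w n.+1 w0; have := pos h n.+1 h0; rewrite !(half _ n) in i2 i4.
  set w' := w / _; set h' := h / _; rewrite -/w' -/h' in i2 i4 => h'0 w'0.
  have cr u v : x' <= u <= x' + w' + w' -> y' <= v <= y' + h' + h' ->
      cont_at H (u +i* v).
    by move=> A B; apply: cH; rewrite /in_rect /=; lra.
  pose u v s := complex.Re (H (s +i* v)); pose v u t := complex.Im (H (u +i* t)).
  have crow b : y' <= b <= y' + h' + h' -> cont_seg x' (x' + w' + w') (u b).
    by move=> B s A; case: (@cont_at_row H s b (cr _ _ A B)).
  have ccol a : x' <= a <= x' + w' + w' -> cont_seg y' (y' + h' + h') (v a).
    by move=> B s A; case: (@cont_at_col H a s (cr _ _ B A)).
  have IA b b' l m : x' <= l -> l <= m -> m <= x' + w' + w' -> y' <= b <= y' + h' + h' ->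
      y' <= b' <= y' + h' + h' ->
      segint l m (fun s => u b s - u b' s) = segint l m (u b) - segint l m (u b').
    move=> A1 A2 A3 B1 B2; apply: segintB; [move: (crow _ B1)|move: (crow _ B2)];
    by apply: cont_segW.
  have IB b b' l m : y' <= l -> l <= m -> m <= y' + h' + h' -> x' <= b <= x' + w' + w' ->
      x' <= b' <= x' + w' + w' ->
      segint l m (fun s => v b s - v b' s) = segint l m (v b) - segint l m (v b').
    move=> A1 A2 A3 B1 B2; apply: segintB; [move: (ccol _ B1)|move: (ccol _ B2)];
    by apply: cont_segW.
  have SA b : y' <= b <= y' + h' + h' -> segint x' (x' + w' + w') (u b) =
      segint x' (x' + w') (u b) + segint (x' + w') (x' + w' + w') (u b).
    by move=> B; apply: segint_split; [lra|lra|exact: crow].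
  have SB b : x' <= b <= x' + w' + w' -> segint y' (y' + h' + h') (v b) =
      segint y' (y' + h') (v b) + segint (y' + h') (y' + h' + h') (v b).
    by move=> B; apply: segint_split; [lra|lra|exact: ccol].
  rewrite !addrA -!/(u _ _) -!/(v _ _).
  have [l0 l1 l2] : [/\ x' <= x', x' <= x' + w' & x' + w' <= x' + w' + w'].
    by rewrite lexx !lerDl.
  have [m0 m1 m2] : [/\ y' <= y', y' <= y' + h' & y' + h' <= y' + h' + h'].
    by rewrite lexx !lerDl.
  have X0 : x' <= x' <= x' + w' + w' by rewrite l0 (le_trans l1).
  have X1 : x' <= x' + w' <= x' + w' + w' by rewrite l1.
  have X2 : x' <= x' + w' + w' <= x' + w' + w' by rewrite lexx (le_trans l1).
  have Y0 : y' <= y' <= y' + h' + h' by rewrite m0 (le_trans m1).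
  have Y1 : y' <= y' + h' <= y' + h' + h' by rewrite m1.
  have Y2 : y' <= y' + h' + h' <= y' + h' + h' by rewrite lexx (le_trans m1).
  have [lt mt] := (le_trans l1 l2, le_trans m1 m2).
  rewrite !IA ?IB // ?SA // ?SB //.
  by set a1 := segint _ _ _; clear; lra.
move=> p [q Hpq].
have pqin : in_rect x y w h (p +i* q).
  have [x' [y' [[a1 a2] [a3 a4] a5 a6 _]]] := Hpq 0%N.
  by rewrite /in_rect /=; rewrite expr0 !divr1 in a2 a4 a5 a6; lra.
have [d Hd] := holH _ pqin.
apply/eqP; rewrite -normr_eq0; apply/eqP/le_anti; rewrite normr_ge0 andbT.
set D := (w + h).
apply/ler_addgt0Pr => eps eps0; rewrite add0r.
have e1 : 0 < eps / (2 * D ^+ 2 + 1).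
  by rewrite divr_gt0 // ltr_wpDl // mulr_ge0 // sqr_ge0.
set e := eps / _ in e1.
have [del del0 Hdel] := hasd_eps Hd e1.
have [n Hn] : exists n, D / 2 ^+ n < del.
  have [n hn] : exists n, D / del < n%:R.
    by exists (Num.truncn (D / del)).+1; rewrite truncnS_gt.
  exists n; rewrite ltr_pdivrMr ?exprn_gt0 // mulrC -ltr_pdivrMr //.
  apply: lt_le_trans hn _; rewrite -natrX ler_nat; exact: ltnW (ltn_expl _ _).
have [x' [y' [[a1 a2] [a3 a4] a5 a6 HJ]]] := Hpq n.
have J0 : J 0%N x y = rectint H x y w h by rewrite /J expr0 !divr1.
rewrite -J0; apply: le_trans HJ _.
rewrite /J; set w' := w / _; set h' := h / _.
have w'0 : 0 <= w' by exact: pos.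
have h'0 : 0 <= h' by exact: pos.
rewrite -/w' in a2 a5; rewrite -/h' in a4 a6.
have D' : w' + h' = D / 2 ^+ n by rewrite /w' /h' -mulrDl.
have rem a b : x' <= a <= x' + w' -> y' <= b <= y' + h' ->
    normc (H (a +i* b) - H (p +i* q) - d * (a +i* b - p +i* q)) <= e * (w' + h').
  move=> A B.
  have nd : normc (a +i* b - p +i* q) <= w' + h'.
    apply: le_trans (normc_le_ReIm _) _; rewrite !ReImE /=.
    by apply: lerD; rewrite ler_norml; lra.
  apply: le_trans (Hdel _ _) _; first by apply: le_lt_trans nd _; rewrite D'.
  by rewrite ler_pM2l.
have ix0 : x' <= x' <= x' + w' by rewrite lexx lerDl.
have ix1 : x' <= x' + w' <= x' + w' by rewrite lexx lerDl w'0.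
have iy0 : y' <= y' <= y' + h' by rewrite lexx lerDl.
have iy1 : y' <= y' + h' <= y' + h' by rewrite lexx lerDl h'0.
have wh0 : 0 <= e * (w' + h') by rewrite mulr_ge0 ?addr_ge0 // ltW.
have Hrow s : x' <= s <= x' + w' -> `|complex.Re (H (s +i* y')) -
    complex.Re (H (s +i* (y' + h'))) - h' * complex.Im d| <= 2 * (e * (w' + h')).
  move=> A; have B1 := rem s y' A; have B2 := rem s (y' + h') A.
  have {B1}B1 := le_trans (normRe_le _) (B1 iy0).
  have {B2}B2 := le_trans (normRe_le _) (B2 iy1).
  move: B1 B2; rewrite !ReImE /= !ler_norml; clear; lra.
have Hcol s : y' <= s <= y' + h' -> `|complex.Im (H ((x' + w') +i* s)) -
    complex.Im (H (x' +i* s)) - w' * complex.Im d| <= 2 * (e * (w' + h')).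
  move=> A; have B1 := rem x' s; have B2 := rem (x' + w') s.
  have {B1}B1 := le_trans (normIm_le _) (B1 ix0 A).
  have {B2}B2 := le_trans (normIm_le _) (B2 ix1 A).
  move: B1 B2; rewrite !ReImE /= !ler_norml; clear; lra.
have cr u v : x' <= u <= x' + w' -> y' <= v <= y' + h' -> cont_at H (u +i* v).
  by move=> A B; apply: cH; rewrite /in_rect /=; lra.
have K1 : `|segint x' (x' + w') (fun s => complex.Re (H (s +i* y')) -
    complex.Re (H (s +i* (y' + h')))) - (x' + w' - x') * (h' * complex.Im d)| <=
    (x' + w' - x') * (2 * (e * (w' + h'))).
  apply: segint_dist => //; first by rewrite lerDl.
  apply: cont_segB => s A; first by have [] := cont_at_row (cr _ _ A iy0).
  by have [] := cont_at_row (cr _ _ A iy1).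
have K2 : `|segint y' (y' + h') (fun s => complex.Im (H ((x' + w') +i* s)) -
    complex.Im (H (x' +i* s))) - (y' + h' - y') * (w' * complex.Im d)| <=
    (y' + h' - y') * (2 * (e * (w' + h'))).
  apply: segint_dist => //; first by rewrite lerDl.
  apply: cont_segB => s A; first by have [] := cont_at_col (cr _ _ ix1 A).
  by have [] := cont_at_col (cr _ _ ix0 A).
have K : `|rectint H x' y' w' h'| <= 2 * e * (w' + h') ^+ 2.
  rewrite /rectint; move: K1 K2; set I1 := segint _ _ _; set I2 := segint _ _ _.
  have -> : x' + w' - x' = w' by ring.
  have -> : y' + h' - y' = h' by ring.
  have E1 : w' * (h' * complex.Im d) = h' * (w' * complex.Im d) by ring.
  rewrite E1; set c := h' * _.
  have -> : 2 * e * (w' + h') ^+ 2 = w' * (2 * (e * (w' + h'))) + h' * (2 * (e * (w' + h'))).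
    by ring.
  rewrite !ler_norml; lra.
apply: le_trans (ler_wpM2l (exprn_ge0 _ _) K) _ => //.
rewrite D' expr_div_n.
have -> : 4 ^+ n * (2 * e * (D ^+ 2 / (2 ^+ n) ^+ 2)) = e * (2 * D ^+ 2) :> R.
  have -> : 4 = 2 ^+ 2 :> R by ring.
  by rewrite -!exprM mulnC; field; rewrite expf_neq0.
rewrite /e mulrAC ler_pdivrMr; last by rewrite ltr_wpDl // mulr_ge0 // sqr_ge0.
by rewrite ler_pM2l // lerDl.
Qed.

End Goursat.


(** * The complex exponential *)

Section ComplexExponential.
Variable R : realType.
Implicit Types (z w : R[i]) (x y : R).

Lemma is_derive_eps (f : R -> R) x (d : R) : is_derive x 1 f d ->
  forall eps : R, 0 < eps -> exists2 del : R, 0 < del & forall y, `|y - x| < del ->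
  `|f y - f x - d * (y - x)| <= eps * `|y - x|.
Proof.
move=> [df <-] eps eps0; have /cvgrPdist_lt/(_ _ eps0) := df.
rewrite /prop_near1 /dnbhs /within /= => /(@nbhs_ballP R R^o)[del /= del0 B].
exists del => // y yd; have [->|yx] := eqVneq y x.
  by rewrite !subrr mulr0 subrr normr0 mulr0.
have yx0 : y - x != 0 by rewrite subr_eq0.
have /B : ball (0 : R^o) del (y - x) by rewrite -ball_normE /ball_ /= sub0r normrN.
move=> /(_ yx0); rewrite -/('D_1 f x) [(y - x)%:A]mulr1 subrK => /ltW C.
have -> : f y - f x - 'D_1 f x * (y - x) =
  - ('D_1 f x - (y - x)^-1 * (f y - f x)) * (y - x) by field.
by rewrite normrM normrN ler_wpM2r.
Qed.

Definition cexp z : R[i] := (expR (complex.Re z))%:C * cis (complex.Im z).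

Lemma cexpD z w : cexp (z + w) = cexp z * cexp w.
Proof. by rewrite /cexp ReD ImD expRD cisD rmorphM /=; ring. Qed.

Lemma cexp0 : cexp 0 = 1 :> R[i].
Proof. by rewrite /cexp /= expR0 cis0 mulr1. Qed.

Lemma normc_cexp z : normc (cexp z) = expR (complex.Re z).
Proof. by rewrite normc_circle // expR_ge0. Qed.

Lemma cexp_neq0 z : cexp z != 0.
Proof. by rewrite -normc_gt0 normc_cexp expR_gt0. Qed.

Lemma cexpN z : cexp (- z) = (cexp z)^-1.
Proof.
by apply: (mulfI (cexp_neq0 z)); rewrite mulfV ?cexp_neq0 // -cexpD subrr cexp0.
Qed.

Lemma cexpMn z n : cexp (z *+ n) = cexp z ^+ n.
Proof. by elim: n => [|n IH]; rewrite ?mulr0n ?cexp0 // mulrS cexpD IH exprS. Qed.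

Lemma hasd_cexp0 : hasd cexp (0 : R[i]) 1.
Proof.
apply: eps_hasd => eps eps0.
have e0 : 0 < Num.min (eps / 6) 1 by rewrite lt_min divr_gt0 //=.
set e := Num.min _ _ in e0.
have e6 : e <= eps / 6 by rewrite ge_min lexx.
have e1 : e <= 1 by rewrite ge_min lexx orbT.
have [d1 d10 H1] := is_derive_eps (is_derive_expR (0 : R)) e0.
have [d2 d20 H2] := is_derive_eps (is_derive_cos (0 : R)) e0.
have [d3 d30 H3] := is_derive_eps (is_derive_sin (0 : R)) e0.
exists (Num.min (Num.min d1 d2) (Num.min d3 (e / 2))).
  by rewrite !lt_min d10 d20 d30 divr_gt0.
move=> w; rewrite !subr0 mul1r cexp0 !lt_min => /andP[/andP[w1 w2] /andP[w3 w4]].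
set x := complex.Re w; set y := complex.Im w.
have xw : `|x| <= normc w by exact: normRe_le.
have yw : `|y| <= normc w by exact: normIm_le.
have {}H1 := H1 x; have {}H2 := H2 y; have {}H3 := H3 y.
rewrite !subr0 expR0 mul1r in H1; rewrite !subr0 cos0 sin0 oppr0 mul0r subr0 in H2.
rewrite !subr0 sin0 cos0 subr0 mul1r in H3.
have {}H1 := H1 (le_lt_trans xw w1); have {}H2 := H2 (le_lt_trans yw w2).
have {}H3 := H3 (le_lt_trans yw w3).
apply: le_trans (normc_le_ReIm _) _; rewrite /cexp !ReImE /= !mul0r subr0 addr0.
rewrite -/x -/y ?oppr0 ?addr0.
set E := expR x in H1 *.
have x0 := normr_ge0 x; have y0 := normr_ge0 y; have n0 := normc_ge0 w.
have E1 : `|E - 1| <= e.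
  have -> : E - 1 = (E - 1 - x) + x by ring.
  apply: le_trans (ler_normD _ _) _.
  have : e * `|x| <= `|x| by rewrite ler_piMl.
  lra.
have E2 : `|E| <= 2.
  have -> : E = (E - 1) + 1 by ring.
  by apply: le_trans (ler_normD _ _) _; rewrite normr1; lra.
have B1 : `|E * cos y - 1 - x| <= e * `|x| + 2 * (e * `|y|).
  have -> : E * cos y - 1 - x = (E - 1 - x) + E * (cos y - 1) by ring.
  by apply: le_trans (ler_normD _ _) _; rewrite normrM lerD // ler_pM.
have B2 : `|E * sin y - y| <= 2 * (e * `|y|) + e * `|y|.
  have -> : E * sin y - y = E * (sin y - y) + (E - 1) * y by ring.
  by apply: le_trans (ler_normD _ _) _; rewrite !normrM lerD // ler_pM.
rewrite -addrA in B1.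
have ex : e * `|x| <= e * normc w by rewrite ler_pM2l.
have ey : e * `|y| <= e * normc w by rewrite ler_pM2l.
have ee : 6 * (e * normc w) <= eps * normc w by rewrite mulrA ler_wpM2r //; lra.
move: B1 B2; rewrite addrA; lra.
Qed.

Lemma hasd_cexp z : hasd cexp z (cexp z).
Proof.
have hs : hasd (fun w => w - z) z 1.
  by have := hasd_sub (hasd_id z) (hasd_cst z z); rewrite subr0.
have h0 : hasd cexp (z - z) 1 by rewrite subrr; exact: hasd_cexp0.
have := hasd_scale (cexp z) (hasd_comp hs h0); rewrite !mulr1.
apply: (@hasd_local _ _ _ _ _ 1) => // w _.
by rewrite -cexpD addrC subrK.
Qed.

Lemma cexp_imag y : cexp (0 +i* y) = cis y.
Proof. by rewrite /cexp expR0 mul1r. Qed.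

Lemma cexp_ln x y : 0 < x -> cexp (ln x +i* y) = x%:C * cis y.
Proof. by move=> x0; rewrite /cexp /= lnK. Qed.

End ComplexExponential.

(** * Means over circles and the mean value property *)

Section CircleMean.
Variable R : realType.
Implicit Types (a z w : R[i]) (r : R) (U V : R[i] -> R) (phi : R[i] -> R[i]).

Lemma pi2_gt0 : 0 < 2 * pi :> R. Proof. by rewrite mulr_gt0 // pi_gt0. Qed.

Definition circle a r t : R[i] := a + r%:C * cis t.

Definition circ_mean U a r : R := (2 * pi)^-1 * segint 0 (2 * pi) (fun t => U (circle a r t)).

Lemma circle_cont a r t (e : R) : 0 < e -> exists2 del : R, 0 < del &
  forall s, `|s - t| < del -> normc (circle a r s - circle a r t) < e.
Proof.
move=> e0; have A : cont_at (fun w => r%:C * cexp w) (0 +i* t).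
  by apply: (cont_mul (cont_cst _ _)); apply: hasd_cont; exact: hasd_cexp.
have [d d0 H] := A _ e0; exists d => // s st.
have -> : circle a r s - circle a r t = r%:C * cis s - r%:C * cis t.
  by rewrite /circle; ring.
rewrite -!cexp_imag; apply: H.
rewrite (_ : _ - _ = 0 +i* (s - t)) ?normc_imag //.
by apply: complex_ext; rewrite !ReImE /= ?subrr.
Qed.

Lemma rcont_circle U a r t : rcont_at U (circle a r t) ->
  {for t, continuous (fun s => U (circle a r s))}.
Proof.
move=> cU; apply/cvgrPdist_lt => e /cU [d d0 Hd].
have [d' d'0 Hd'] := circle_cont a r t d0; apply/nbhs_ballP; exists d' => // s.
by rewrite /ball /= distrC => /Hd' /Hd; rewrite distrC.
Qed.

Lemma rcont_circle_seg U a r x y : (forall t, rcont_at U (circle a r t)) ->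
  cont_seg x y (fun s => U (circle a r s)).
Proof. by move=> H t _; exact: rcont_circle. Qed.

Lemma normc_circleB a r t : 0 <= r -> normc (circle a r t - a) = r.
Proof. by move=> r0; rewrite /circle addrAC subrr add0r normc_circle. Qed.

Lemma normc_circle0 r t : 0 <= r -> normc (circle 0 r t) = r.
Proof. by move=> r0; rewrite /circle add0r normc_circle. Qed.

Lemma circle2pi a r t : circle a r (t + 2 * pi) = circle a r t.
Proof. by rewrite /circle cisD cis2pi mulr1. Qed.

Lemma circ_mean_dist U a r c (M : R) : (forall t, rcont_at U (circle a r t)) ->
  (forall t, `|U (circle a r t) - c| <= M) -> `|circ_mean U a r - c| <= M.
Proof.
move=> cU H; have p0 := pi2_gt0.
have := @segint_dist R 0 (2 * pi) c M _ (ltW p0) (rcont_circle_seg cU) (fun t _ => H t).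
rewrite subr0 /circ_mean; set I := segint _ _ _ => B.
have -> : (2 * pi)^-1 * I - c = (2 * pi)^-1 * (I - 2 * pi * c).
  by rewrite mulrBr mulKf // gt_eqF.
by rewrite normrM gtr0_norm ?invr_gt0 // ler_pdivrMl.
Qed.

Lemma circ_meanD U V a r : (forall t, rcont_at U (circle a r t)) ->
  (forall t, rcont_at V (circle a r t)) ->
  circ_mean (fun z => U z + V z) a r = circ_mean U a r + circ_mean V a r.
Proof.
by move=> cU cV; rewrite /circ_mean -mulrDr segintD //; exact: rcont_circle_seg.
Qed.

Lemma circ_meanZ c U a r : (forall t, rcont_at U (circle a r t)) ->
  circ_mean (fun z => c * U z) a r = c * circ_mean U a r.
Proof.
by move=> cU; rewrite /circ_mean segintZ 1?mulrCA //; exact: rcont_circle_seg.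
Qed.

Lemma eq_circ_mean U V a r : (forall t, U (circle a r t) = V (circle a r t)) ->
  circ_mean U a r = circ_mean V a r.
Proof. by move=> E; congr (_ * _); apply: eq_segint. Qed.

Lemma le_circ_mean U V a r : (forall t, rcont_at U (circle a r t)) ->
  (forall t, rcont_at V (circle a r t)) ->
  (forall t, U (circle a r t) <= V (circle a r t)) -> circ_mean U a r <= circ_mean V a r.
Proof.
move=> cU cV H; rewrite /circ_mean ler_pM2l ?invr_gt0 ?pi2_gt0 //.
by apply: le_segint => //; exact: rcont_circle_seg.
Qed.

Lemma circ_mean_cst c a r : circ_mean (fun=> c) a r = c.
Proof.
rewrite /circ_mean segint_cst ?subr0 ?mulKf // ?gt_eqF ?ltW ?pi2_gt0 //.
Qed.

(** In logarithmic coordinates an annulus is a rectangle whose horizontal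
    sides are identified, so Goursat's theorem says that the mean over circles
    does not depend on the radius; continuity at the centre gives its value.
    No differentiability at the centre is required, which makes the lemma
    applicable to difference quotients. *)
Lemma circ_mean_Im phi a (rho r : R) : 0 < r -> r < rho -> cont_at phi a ->
  holo_on [set z | 0 < normc (z - a) < rho] phi ->
  circ_mean (fun z => complex.Im (phi z)) a r = complex.Im (phi a).
Proof.
move=> r0 rrho ca hp; set U := fun z => complex.Im (phi z).
have cU s t : 0 < s -> s < rho -> rcont_at U (circle a s t).
  move=> s0 srho; apply: rcont_Im.
  have [|d /hasd_cont //] := hp (circle a s t).
  by rewrite /= normc_circleB ?s0 // ltW.
have indep s : 0 < s -> s <= r -> circ_mean U a s = circ_mean U a r.
  move=> s0 sr; pose H w := phi (a + cexp w).
  have G : rectint H (ln s) 0 (ln r - ln s) (2 * pi) = 0.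
    apply: goursat; [by rewrite subr_ge0 ler_ln|exact/ltW/pi2_gt0|].
    move=> z /andP[/andP[z1 z2] _].
    have [|d hd] := hp (a + cexp z).
      rewrite /= addrC addKr normc_cexp expR_gt0 /= (le_lt_trans _ rrho) //.
      by rewrite -[leRHS]lnK // ler_expR; lra.
    have := hasd_comp (hasd_add (hasd_cst a z) (hasd_cexp z)) hd.
    by move=> E; eexists; exact: E.
  have cisp (x : R) : cexp (x +i* (2 * pi)) = cexp (x +i* 0).
    by rewrite /cexp /= cis2pi cis0.
  move: G; rewrite /rectint !add0r [ln s + _]addrC subrK.
  rewrite (eq_segint (g := fun=> 0)); last by move=> x _; rewrite /H cisp subrr.
  rewrite segint_cst ?ler_ln // mulr0 sub0r => /eqP; rewrite oppr_eq0 segintB.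
  - rewrite subr_eq0 => /eqP E; rewrite /circ_mean; congr (_ * _).
    transitivity (segint 0 (2 * pi) (fun t => complex.Im (H (ln s +i* t)))).
      by apply: eq_segint => t _; rewrite /U /H /circle cexp_ln.
    by rewrite -E; apply: eq_segint => t _; rewrite /U /H /circle cexp_ln.
  - move=> t _; have := @rcont_circle U a r t (cU _ _ r0 rrho).
    rewrite /U /H /circle; congr (continuous_at _ _); apply/funext => t'.
    by rewrite cexp_ln.
  - move=> t _; have := @rcont_circle U a s t (cU _ _ s0 (le_lt_trans sr rrho)).
    rewrite /U /H /circle; congr (continuous_at _ _); apply/funext => t'.
    by rewrite cexp_ln.
apply/eqP; rewrite -subr_eq0 -normr_eq0; apply/eqP/le_anti; rewrite normr_ge0 andbT.
apply/ler_addgt0Pr => eps eps0; rewrite add0r.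
have [del del0 Hd] := rcont_Im ca eps0.
pose s := Num.min r (del / 2).
have s0 : 0 < s by rewrite lt_min r0 divr_gt0.
have sr : s <= r by rewrite ge_min lexx.
have sd : s < del.
  by apply: le_lt_trans (_ : del / 2 < _); [rewrite ge_min lexx orbT|lra].
rewrite -(indep s) //; apply: circ_mean_dist.
  by move=> t; apply: cU => //; exact: le_lt_trans rrho.
by move=> t; apply/ltW/Hd; rewrite normc_circleB // ltW.
Qed.

Lemma circ_mean_Re phi a (rho r : R) : 0 < r -> r < rho -> cont_at phi a ->
  holo_on [set z | 0 < normc (z - a) < rho] phi ->
  circ_mean (fun z => complex.Re (phi z)) a r = complex.Re (phi a).
Proof.
move=> r0 rrho ca hp.
have E z : complex.Re (phi z) = complex.Im ((0 +i* 1) * phi z).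
  by rewrite !ReImE /= mul0r add0r mul1r.
rewrite E -(@circ_mean_Im (fun z => (0 +i* 1) * phi z) a rho r) //.
- by apply: eq_circ_mean => t; rewrite E.
- by apply: cont_mul => //; exact: cont_cst.
by move=> z /hp [d hd]; eexists; exact: (hasd_scale _ hd).
Qed.

End CircleMean.


(** * Closed discs and the mean value inequality *)

Section ClosedDisc.
Variable R : realType.
Implicit Types (a z w : R[i]) (r : R) (U : R[i] -> R) (phi : R[i] -> R[i]).

Lemma circle_dist a (r s t u : R) :
  normc (circle a r t - circle a s u) <= `|r - s| + normc (circle a s t - circle a s u).
Proof.
apply: le_trans (normc_triangle (circle a s t) _ _) _; rewrite lerD2r.
have -> : circle a r t - circle a s t = (r - s)%:C * cis t.
  by rewrite /circle rmorphB /=; ring.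
by rewrite normcM normc_cis mulr1 normc_real.
Qed.

(** Polar coordinates make the closed disc a continuous image of a rectangle. *)
Lemma closed_disc_max U a r : 0 <= r -> (forall z, normc (z - a) <= r -> rcont_at U z) ->
  exists2 z0, normc (z0 - a) <= r & forall z, normc (z - a) <= r -> U z <= U z0.
Proof.
move=> r0 cU; pose K := (`[0, r] `*` `[- pi, pi])%classic : set (R * R).
have kK : compact K by apply: compact_setX; exact: segment_compact.
have K0 : K !=set0.
  by exists (0, 0); split; rewrite /= in_itv /= ?lexx // oppr_le0 pi_ge0.
pose f (x : R * R) := U (circle a x.1 x.2).
have cf : {within K, continuous f}.
  apply: continuous_in_subspaceT => -[s t] /set_mem [/= ]; rewrite !in_itv /= => /andP[s0 sr] _.
  apply/cvgrPdist_lt => e e0.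
  have [|d d0 Hd] := cU (circle a s t) _ e e0; first by rewrite normc_circleB.
  have d20 : 0 < d / 2 by rewrite divr_gt0.
  have [d' d'0 Hd'] := circle_cont a s t d20.
  exists (ball s (d / 2), ball t d'); first by split; exact: nbhsx_ballx.
  case=> s' t' [/= A B].
  rewrite distrC; apply: Hd; apply: le_lt_trans (circle_dist _ _ _ _ _) _.
  by rewrite [d]splitr ltrD 1?distrC //; apply: Hd'; rewrite distrC.
have [[s t] /set_mem [/= Ks _] Hmax] := compact_EVT_max K0 kK cf.
move: Ks; rewrite in_itv /= => /andP[s0 sr].
exists (circle a s t); first by rewrite normc_circleB.
move=> z zr; have [u upi zu] := polarE (z - a).
have -> : z = circle a (normc (z - a)) u by rewrite /circle -zu addrC subrK.
by apply: (Hmax (normc (z - a), u)); rewrite inE; split; rewrite /= in_itv /= ?normc_ge0.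
Qed.

Lemma closed_disc_bounded phi a r : 0 <= r ->
  (forall z, normc (z - a) <= r -> cont_at phi z) ->
  exists2 M, 0 < M & forall z, normc (z - a) <= r -> normc (phi z) <= M.
Proof.
move=> r0 c; have [|z0 _ H] := @closed_disc_max (fun z => normc (phi z)) a r r0.
  by move=> z /c; exact: rcont_normc.
exists (normc (phi z0) + 1); first by rewrite ltr_wpDl ?normc_ge0.
by move=> z /H; move/le_trans; apply; rewrite lerDl.
Qed.

Lemma eps_is_derive (f : R -> R) x (d : R) : (forall eps : R, 0 < eps ->
  exists2 del : R, 0 < del & forall y, `|y - x| < del ->
  `|f y - f x - d * (y - x)| <= eps * `|y - x|) -> is_derive x 1 f d.
Proof.
move=> H; suff h : h^-1 *: ((f \o shift x) (h *: 1) - f x) @[h --> (0 : R)^'] --> d.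
  by apply: DeriveDef; [apply/cvg_ex; exists d|exact: cvg_lim].
apply/cvgrPdist_le => e /H [del del0 Hd].
rewrite /prop_near1 /dnbhs /within /=; apply/(@nbhs_ballP R R^o); exists del => //= h.
rewrite -ball_normE /ball_ /= sub0r normrN => hd h0.
have := Hd (h + x); rewrite addrK => /(_ hd) A.
rewrite [h%:A]mulr1 -(ler_pM2r (_ : 0 < `|h|)) ?normr_gt0 // -normrM -normrN.
apply: le_trans A; rewrite le_eqVlt; apply/orP; left; apply/eqP; congr (`|_|).
by rewrite /GRing.scale /=; field.
Qed.

Lemma hasd_ray_Re phi z (s : R) u d : hasd phi (z + s%:C * u) d ->
  is_derive s 1 (fun s : R => complex.Re (phi (z + s%:C * u))) (complex.Re (d * u)).
Proof.
move=> hd; apply: eps_is_derive => eps eps0.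
have e0 : 0 < eps / (normc u + 1) by rewrite divr_gt0 // ltr_wpDl ?normc_ge0.
have u0 : 0 < normc u + 1 by rewrite ltr_wpDl ?normc_ge0.
have [del del0 H] := hasd_eps hd e0.
exists (del / (normc u + 1)) => [|y yd]; first by rewrite divr_gt0.
have E : z + y%:C * u - (z + s%:C * u) = (y - s)%:C * u by rewrite rmorphB /=; ring.
have := H (z + y%:C * u); rewrite E normcM normc_real => A.
have {A}A : normc (phi (z + y%:C * u) - phi (z + s%:C * u) - d * ((y - s)%:C * u)) <=
    eps / (normc u + 1) * (`|y - s| * normc u).
  apply: A; rewrite ltr_pdivlMr // in yd; apply: le_lt_trans yd.
  by rewrite ler_wpM2l // lerDl.
have -> : complex.Re (phi (z + y%:C * u)) - complex.Re (phi (z + s%:C * u)) -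
    complex.Re (d * u) * (y - s) = complex.Re (phi (z + y%:C * u) - phi (z + s%:C * u) -
    d * ((y - s)%:C * u)).
  by rewrite !ReImE /=; ring.
apply: le_trans (normRe_le _) _; apply: le_trans A _.
rewrite mulrAC ler_pdivrMr // -!mulrA ler_pM2l // ler_wpM2l // lerDl //.
Qed.

(** A complex mean value inequality; the factor [2] comes from treating the real
    and imaginary parts separately. *)
Lemma normc_MVT phi phi' a c r (M : R) x y :
  (forall z, normc (z - a) < r -> hasd phi z (phi' z)) ->
  (forall z, normc (z - a) < r -> normc (phi' z - c) <= M) ->
  normc (x - a) < r -> normc (y - a) < r ->
  normc (phi y - phi x - c * (y - x)) <= 2 * M * normc (y - x).
Proof.
move=> hd hM xr yr.
have key k : normc k = 1 -> `|complex.Re (k * (phi y - phi x - c * (y - x)))| <=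
    M * normc (y - x).
  move=> k1; pose chi z := k * (phi z - c * z).
  have hchi z : normc (z - a) < r -> hasd chi z (k * (phi' z - c)).
    move=> /hd h; apply: hasd_scale; apply: hasd_sub => //.
    by have := hasd_scale c (hasd_id z); rewrite mulr1.
  pose f (s : R) := complex.Re (chi (x + s%:C * (y - x))).
  have seg (s : R) : 0 <= s <= 1 -> normc (x + s%:C * (y - x) - a) < r.
    move=> /andP[s0 s1].
    have -> : x + s%:C * (y - x) - a = (1 - s)%:C * (x - a) + s%:C * (y - a).
      by rewrite rmorphB /= rmorph1; ring.
    apply: le_lt_trans (le_normcD _ _) _; rewrite !normcM !normc_real !ger0_norm ?subr_ge0 //.
    have [A|A] := leP (normc (x - a)) (normc (y - a)).
      apply: le_lt_trans yr; have : (1 - s) * normc (x - a) <= (1 - s) * normc (y - a).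
        by rewrite ler_wpM2l // subr_ge0.
      lra.
    apply: le_lt_trans xr; have : s * normc (y - a) <= s * normc (x - a).
      by rewrite ler_wpM2l // ltW.
    lra.
  have [||s sI] := @MVT R f (fun s => complex.Re (k * (phi' (x + s%:C * (y - x)) - c) * (y - x)))
    0 1 ltr01.
  - move=> s; rewrite in_itv /= => /andP[s0 s1]; apply: hasd_ray_Re.
    by apply: hchi; apply: seg; rewrite !ltW.
  - apply: continuous_in_subspaceT => s /set_mem; rewrite /= in_itv /= => sI.
    apply: differentiable_continuous; apply/derivable1_diffP.
    by have [] := hasd_ray_Re (hchi _ (seg _ sI)).
  rewrite /f subr0 mulr1 mul1r mul0r addr0 [x + _]addrC subrK => E.
  have -> : k * (phi y - phi x - c * (y - x)) = chi y - chi x by rewrite /chi; ring.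
  rewrite ReD ReN E; apply: le_trans (normRe_le _) _.
  rewrite !normcM k1 mul1r ler_wpM2r ?normc_ge0 //; apply: hM; apply: seg.
  by move: sI; rewrite in_itv /= => /andP[s0 s1]; rewrite !ltW.
have n1 : normc (0 +i* -1 : R[i]) = 1 by rewrite normc_imag normrN normr1.
have A := key 1 (normc1 _); have B := key _ n1.
rewrite mul1r in A; apply: le_trans (normc_le_ReIm _) _.
have -> : 2 * M * normc (y - x) = M * normc (y - x) + M * normc (y - x) by ring.
rewrite lerD //; move: B; rewrite ReM /= mul0r mulN1r opprK add0r => B; exact: B.
Qed.

End ClosedDisc.


(** * Differentiability of the derivative *)

Section Regularity.
Variable R : realType.
Implicit Types (a b z w : R[i]) (r rho : R) (phi chi : R[i] -> R[i]).

Definition cmean phi r : R[i] :=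
  circ_mean (fun z => complex.Re (phi z)) 0 r +i* circ_mean (fun z => complex.Im (phi z)) 0 r.

Definition circle_cont_at phi r := forall t, cont_at phi (circle 0 r t).

Lemma cmean_dist phi c r (M : R) : circle_cont_at phi r ->
  (forall t, normc (phi (circle 0 r t) - c) <= M) -> normc (cmean phi r - c) <= 2 * M.
Proof.
move=> cphi H; apply: le_trans (normc_le_ReIm _) _; rewrite !ReImE /=.
rewrite mulr_natl mulr2n; apply: lerD; apply: circ_mean_dist => t.
- exact: rcont_Re.
- by rewrite -ReN -ReD; apply: le_trans (normRe_le _) (H t).
- exact: rcont_Im.
by rewrite -ImN -ImD; apply: le_trans (normIm_le _) (H t).
Qed.

Lemma cmeanD phi chi r : circle_cont_at phi r -> circle_cont_at chi r ->
  cmean (fun z => phi z + chi z) r = cmean phi r + cmean chi r.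
Proof.
move=> c1 c2; apply: complex_ext; rewrite !ReImE /=.
  rewrite -circ_meanD; [|by move=> t; exact: rcont_Re..].
  by apply: eq_circ_mean => t; rewrite ReD.
rewrite -circ_meanD; [|by move=> t; exact: rcont_Im..].
by apply: eq_circ_mean => t; rewrite ImD.
Qed.

Lemma cmeanZ c phi r : circle_cont_at phi r ->
  cmean (fun z => c * phi z) r = c * cmean phi r.
Proof.
move=> c1; have cR t : rcont_at (fun z => complex.Re (phi z)) (circle 0 r t) by exact: rcont_Re.
have cI t : rcont_at (fun z => complex.Im (phi z)) (circle 0 r t) by exact: rcont_Im.
have cZ (k : R) (U : R[i] -> R) : (forall t, rcont_at U (circle 0 r t)) ->
    forall t, rcont_at (fun z => k * U z) (circle 0 r t).
  by move=> cU t; apply: rcont_mul => //; exact: rcont_cst.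
apply: complex_ext; rewrite !ReImE /=.
  rewrite -!circ_meanZ // -mulN1r -circ_meanZ //; last exact: cZ.
  rewrite -circ_meanD; [|exact: cZ|by apply: (cZ); exact: cZ].
  by apply: eq_circ_mean => t; rewrite !ReImE mulN1r.
rewrite -!circ_meanZ // -circ_meanD; [|exact: cZ..].
by apply: eq_circ_mean => t; rewrite !ReImE.
Qed.

Definition diff_quot phi b w := (phi (b + w) - phi b) / w.

Lemma cont_shift phi b w : cont_at phi (b + w) -> cont_at (fun w => phi (b + w)) w.
Proof.
move=> c; apply: (@cont_comp _ (fun w => b + w) phi) => //.
by apply: cont_add; [exact: cont_cst|exact: cont_id].
Qed.

Lemma cont_diff_quot phi b w : w != 0 -> cont_at phi (b + w) -> cont_at (diff_quot phi b) w.
Proof.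
move=> w0 c; apply: cont_mul; first by apply: cont_sub; [exact: cont_shift|exact: cont_cst].
by apply: cont_inv => //; exact: cont_id.
Qed.

Lemma circle_neq0 r t : 0 < r -> circle 0 r t != 0 :> R[i].
Proof. by move=> r0; rewrite -normc_gt0 normc_circle0 // ltW. Qed.

(** The difference quotient, with value [phi' b] at its centre, is continuous
    there and differentiable elsewhere. *)
Lemma deriv_cmean phi phi' b r rho : 0 < r -> r < rho ->
  (forall z, normc (z - b) < rho -> hasd phi z (phi' z)) ->
  phi' b = cmean (diff_quot phi b) r.
Proof.
move=> r0 rrho hd; have rho0 := lt_trans r0 rrho.
have hb : hasd phi b (phi' b) by apply: hd; rewrite subrr normc0.
pose k w := if w == 0 then phi' b else diff_quot phi b w.
have ck : cont_at k 0.
  case: hb => q [E cq qb].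
  have := @cont_shift q b 0; rewrite addr0 => /(_ cq).
  apply: (@cont_local _ _ _ _ 1) => // w _; rewrite /k; case: eqVneq => [->|w0].
    by rewrite addr0.
  by rewrite /diff_quot E [b + w]addrC addrK [phi b + _]addrC addrK mulfK.
have hk : holo_on [set z | 0 < normc (z - 0) < rho] k.
  move=> w /=; rewrite subr0 => /andP[w0 wrho].
  have wn0 : w != 0 by rewrite -normc_gt0.
  have h1 : hasd phi (b + w) (phi' (b + w)) by apply: hd; rewrite addrC addKr.
  have h2 := hasd_comp (hasd_add (hasd_cst b w) (hasd_id w)) h1.
  have h3 := hasd_mul (hasd_sub h2 (hasd_cst (phi b) w)) (hasd_inv (hasd_id w) wn0).
  eexists; move: h3; apply: (@hasd_local _ _ _ _ _ (normc w)) => // v vw.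
  by rewrite /k; case: eqVneq => // v0; move: vw; rewrite v0 sub0r normcN ltxx.
apply: complex_ext; rewrite /= /k.
- transitivity (complex.Re (k 0)); first by rewrite /k eqxx.
  rewrite -(circ_mean_Re r0 rrho ck hk); apply: eq_circ_mean => t.
  by rewrite /k (negbTE (circle_neq0 _ r0)).
- transitivity (complex.Im (k 0)); first by rewrite /k eqxx.
  rewrite -(circ_mean_Im r0 rrho ck hk); apply: eq_circ_mean => t.
  by rewrite /k (negbTE (circle_neq0 _ r0)).
Qed.

Lemma deriv_bound phi phi' b r rho (M : R) : 0 < r -> r < rho ->
  (forall z, normc (z - b) < rho -> hasd phi z (phi' z)) ->
  (forall z, normc (z - b) <= r -> normc (phi z) <= M) ->
  normc (phi' b) <= 4 * M / r.
Proof.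
move=> r0 rrho hd hM; rewrite (deriv_cmean r0 rrho hd) -[cmean _ _]subr0.
have -> : 4 * M / r = 2 * (2 * M / r) by rewrite !mulrA -natrM.
apply: cmean_dist => t.
  apply: cont_diff_quot; first exact: circle_neq0.
  apply: hasd_cont; apply: hd.
  by rewrite addrC addKr normc_circle0 // ltW.
have nw : normc (circle 0 r t : R[i]) = r by rewrite normc_circle0 // ltW.
rewrite subr0 /diff_quot normcM normcV nw ler_pM2r ?invr_gt0 //.
apply: le_trans (normcB _ _) _; rewrite mulr_natl mulr2n lerD // hM //.
  by rewrite addrC addKr nw.
by rewrite subrr normc0 ltW.
Qed.

Lemma ball_sub a b z (r s t : R) : normc (b - a) < r -> normc (z - b) < s -> r + s <= t ->
  normc (z - a) < t.
Proof.
move=> h1 h2 h3; apply: le_lt_trans (normc_triangle b _ _) _; lra.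
Qed.

(** Complex differentiability in a disc makes the derivative differentiable: the
    mean value formula for the derivative only involves the function, so the
    regularity of the function is inherited, in three rounds, by its derivative:
    locally bounded, locally Lipschitz, differentiable. *)
Lemma hasd_deriv phi phi' a rho : 0 < rho ->
  (forall z, normc (z - a) < rho -> hasd phi z (phi' z)) -> exists d, hasd phi' a d.
Proof.
move=> rho0 hd; pose r := rho / 4; pose r2 := r / 4.
have r0 : 0 < r by rewrite divr_gt0.
have r20 : 0 < r2 by rewrite divr_gt0.
have rE : rho = 4 * r by rewrite /r; lra.
have r2E : r = 4 * r2 by rewrite /r2; lra.
have [M M0 hM] : exists2 M, 0 < M & forall z, normc (z - a) <= 2 * r -> normc (phi z) <= M.
  apply: closed_disc_bounded => [|z zr]; first by rewrite mulr_ge0 // ltW.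
  by apply: hasd_cont; apply: hd; lra.
have B z : normc (z - a) < r -> normc (phi' z) <= 4 * M / r.
  move=> za; apply: (@deriv_bound phi phi' z r (2 * r)) => //; first lra.
    by move=> w wz; apply: hd; apply: (ball_sub za wz); lra.
  move=> w wz; apply: hM; apply: le_trans (normc_triangle z _ _) _; lra.
set L := 4 * M / r in B.
have Lip1 x y : normc (x - a) < r -> normc (y - a) < r ->
    normc (phi y - phi x) <= 2 * L * normc (y - x).
  move=> xr yr; have := @normc_MVT _ phi phi' a 0 r L x y.
  rewrite mul0r subr0; apply => // z zr; last by rewrite subr0 B.
  by apply: hd; lra.
have formula b s : 0 < s -> s < r -> normc (b - a) < r -> phi' b = cmean (diff_quot phi b) s.
  move=> s0 sr br; apply: (@deriv_cmean _ _ _ _ r) => // z zb.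
  by apply: hd; apply: (ball_sub br zb); lra.
have cdq b s t : 0 < s -> s < r -> normc (b - a) < r -> cont_at (diff_quot phi b) (circle 0 s t).
  move=> s0 sr br; apply: cont_diff_quot; first exact: circle_neq0.
  apply: hasd_cont; apply: hd; apply: (@ball_sub a b _ r r) => //; last lra.
  by rewrite addrC addKr normc_circle0 // ltW.
pose L2 := 2 * (4 * L / r2).
have Lip2 x y : normc (x - a) < r2 -> normc (y - a) < r2 ->
    normc (phi' y - phi' x) <= L2 * normc (y - x).
  move=> xr yr.
  have xr' : normc (x - a) < r by lra.
  have yr' : normc (y - a) < r by lra.
  have r2r : r2 < r by lra.
  rewrite (formula x r2) // (formula y r2) // -mulN1r -cmeanZ => [|t]; last exact: cdq.
  rewrite -cmeanD; first last.
  - by move=> t; apply: cont_mul; [exact: cont_cst|exact: cdq].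
  - by move=> t; exact: cdq.
  rewrite -[cmean _ _]subr0 /L2 -mulrA; apply: cmean_dist.
    move=> t; apply: cont_add; first exact: cdq.
    by apply: cont_mul; [exact: cont_cst|exact: cdq].
  move=> t; set w := circle 0 r2 t; have nw : normc w = r2 by rewrite normc_circle0 // ltW.
  have -> : diff_quot phi y w + -1 * diff_quot phi x w - 0 =
      ((phi (y + w) - phi (x + w)) - (phi y - phi x)) / w by rewrite /diff_quot; ring.
  rewrite normcM normcV nw ler_pdivrMr //.
  have -> : 4 * L / r2 * normc (y - x) * r2 = 2 * L * normc (y - x) + 2 * L * normc (y - x).
    by field; rewrite gt_eqF.
  apply: le_trans (normcB _ _) _; apply: lerD; last exact: Lip1.
  have inr v : normc (v - a) < r2 -> normc (v + w - a) < r.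
    move=> va; have -> : v + w - a = (v - a) + w by ring.
    by apply: le_lt_trans (le_normcD _ _) _; rewrite nw; lra.
  have := Lip1 (x + w) (y + w) (inr _ xr) (inr _ yr).
  by have -> : y + w - (x + w) = y - x by ring.
have L20 : 0 < L2 by rewrite /L2 /L mulr_gt0 // divr_gt0 // mulr_gt0 // divr_gt0 // mulr_gt0.
have Tay z w : normc (z - a) < r2 / 2 -> normc w < r2 / 2 ->
    normc (phi (z + w) - phi z - phi' z * w) <= 2 * (L2 * normc w) * normc w.
  move=> za wr; set s := normc w.
  have [w0|w0] := eqVneq w 0.
    by rewrite /s w0 addr0 subrr mulr0 subrr normc0 !mulr0.
  (* The mean value inequality is used on discs shrinking to the one of radius
     [normc w], whose boundary contains the end point. *)
  apply/ler_addgt0Pr => e e0.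
  have s0 : 0 < s by rewrite normc_gt0.
  have K0 : 0 < 2 * L2 * s by rewrite mulr_gt0 // mulr_gt0.
  pose eta := Num.min (e / (2 * L2 * s)) (r2 / 2 - s).
  have eta0 : 0 < eta by rewrite lt_min divr_gt0 //= subr_gt0.
  have := @normc_MVT _ phi phi' z (phi' z) (s + eta) (L2 * (s + eta)) z (z + w).
  rewrite [z + w]addrC addrK subrr normc0 [w + z]addrC => H.
  have etar : eta <= r2 / 2 - s by rewrite ge_min lexx orbT.
  have {}H := H _ _ (addr_gt0 s0 eta0) _.
  apply: le_trans (H _ _ _) _.
  - by move=> v vz; apply: hd; apply: (ball_sub za vz); lra.
  - move=> v vz; have A : normc (v - a) < r2 by apply: (ball_sub za vz); lra.
    apply: le_trans (Lip2 _ _ _ A) _; first lra.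
    by rewrite ler_pM2l // ltW.
  - by rewrite ltrDl.
  rewrite -/s; have : 2 * L2 * s * eta <= e.
    by rewrite mulrC -ler_pdivlMr // ge_min lexx.
  have -> : 2 * (L2 * (s + eta)) * s = 2 * (L2 * s) * s + 2 * L2 * s * eta by ring.
  lra.
pose r3 := r2 / 4.
have r30 : 0 < r3 by rewrite divr_gt0.
have r3E : r2 = 4 * r3 by rewrite /r3; lra.
have cphi' z : normc (z - a) < r2 -> cont_at phi' z.
  move=> za e e0; exists (Num.min (e / L2) (r2 - normc (z - a))).
    by rewrite lt_min divr_gt0 //= subr_gt0.
  move=> w; rewrite lt_min => /andP[w1 w2].
  have A : normc (w - a) < r2.
    by apply: le_lt_trans (normc_triangle z _ _) _; rewrite -ltrBrDr.
  by apply: le_lt_trans (Lip2 _ _ za A) _; rewrite mulrC -ltr_pdivlMr.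
exists (cmean (diff_quot phi' a) r3); apply: eps_hasd => eps eps0.
pose K := 2 * (4 * L2 / r3).
have K0 : 0 < K by rewrite /K mulr_gt0 // divr_gt0 // mulr_gt0.
exists (Num.min r3 (eps / K)); first by rewrite lt_min r30 divr_gt0.
move=> b; rewrite lt_min => /andP[b1 b2]; set h := b - a.
have bE : b = a + h by rewrite /h addrC subrK.
have r3r : r3 < r by lra.
have aa : normc (a - a) < r by rewrite subrr normc0.
have bb : normc (b - a) < r by lra.
have cdq' t : cont_at (diff_quot phi' a) (circle 0 r3 t).
  apply: cont_diff_quot; first exact: circle_neq0.
  by apply: cphi'; rewrite addrC addKr normc_circle0; lra.
have cZ (c : R[i]) (q : R[i] -> R[i]) : circle_cont_at q r3 -> circle_cont_at (fun w => c * q w) r3.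
  by move=> cq t; apply: cont_mul => //; exact: cont_cst.
have c1 : circle_cont_at (diff_quot phi b) r3 by move=> t; exact: cdq.
have c2 : circle_cont_at (diff_quot phi a) r3 by move=> t; exact: cdq.
rewrite (formula b r3) // (formula a r3) // -[- cmean (diff_quot phi a) _]mulN1r.
rewrite [cmean (diff_quot phi' a) r3 * h]mulrC -mulNr -!cmeanZ // -!cmeanD //; first last.
- exact: cZ.
- exact: cZ.
- by move=> t; apply: cont_add => //; exact: cZ.
apply: le_trans (_ : K * normc h * normc h <= _); last first.
  by rewrite ler_wpM2r ?normc_ge0 // mulrC -ler_pdivlMr // ltW.
rewrite -[cmean _ _]subr0.
have -> : K * normc h * normc h = 2 * (4 * L2 / r3 * normc h ^+ 2) by rewrite /K; ring.
apply: cmean_dist => t.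
  by apply: cont_add; [apply: cont_add => //|]; exact: cZ.
set w := circle 0 r3 t; have nw : normc w = r3 by rewrite normc_circle0 // ltW.
have w0 : w != 0 by exact: circle_neq0.
have -> : diff_quot phi b w + -1 * diff_quot phi a w + - h * diff_quot phi' a w - 0 =
    ((phi ((a + w) + h) - phi (a + w) - phi' (a + w) * h) -
     (phi (a + h) - phi a - phi' a * h)) / w.
  have bw : b + w = a + w + h by rewrite bE; ring.
  by rewrite /diff_quot bw bE; ring.
rewrite normcM normcV nw ler_pdivrMr //.
have -> : 4 * L2 / r3 * normc h ^+ 2 * r3 =
    2 * (L2 * normc h) * normc h + 2 * (L2 * normc h) * normc h.
  by field; rewrite gt_eqF.
have hr : normc h < r2 / 2 by rewrite /h; lra.
apply: le_trans (normcB _ _) _; apply: lerD; apply: Tay => //.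
  by rewrite addrC addKr nw; lra.
by rewrite subrr normc0; lra.
Qed.

End Regularity.


(** * Difference quotients, primitives and logarithms on the disc *)

Section Holomorphic.
Variable R : realType.
Implicit Types (a b c d z w u l : R[i]) (r s t : R) (phi chi eta N Phi L : R[i] -> R[i])
  (U : R[i] -> R).

Definition hol phi := forall z, normc z < 1 -> exists d, hasd phi z d.

Definition dv phi z : R[i] := xget 0 [set d | hasd phi z d].

Lemma dvE phi z d : hasd phi z d -> dv phi z = d.
Proof.
move=> hd; rewrite /dv; case: xgetP => [y -> /= hy|/(_ d) //].
exact: hasd_unique hy hd.
Qed.

Lemma hasd_dv phi z : (exists d, hasd phi z d) -> hasd phi z (dv phi z).
Proof. by move=> [d hd]; rewrite (dvE hd). Qed.

Lemma hol_dv phi z : hol phi -> normc z < 1 -> hasd phi z (dv phi z).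
Proof. by move=> h /h; exact: hasd_dv. Qed.

Lemma hol_cont phi z : hol phi -> normc z < 1 -> cont_at phi z.
Proof. by move=> h /h [d /hasd_cont]. Qed.

Lemma analytic_hol phi : analytic phi -> hol phi.
Proof. by move=> h z /discE z1; exists (cderiv phi z); exact: analytic_hasd. Qed.

Lemma cderiv_dv phi z : analytic phi -> normc z < 1 -> cderiv phi z = dv phi z.
Proof. by move=> h /discE z1; rewrite (dvE (analytic_hasd h z1)). Qed.

Lemma in_disc_sub z w : normc (w - z) < 1 - normc z -> normc w < 1.
Proof. have := lerB_normc w z; lra. Qed.

Lemma hol_deriv phi : hol phi -> hol (dv phi).
Proof.
move=> h z z1; apply: (@hasd_deriv _ phi (dv phi) z (1 - normc z)).
  by rewrite subr_gt0.
by move=> w wz; apply: hol_dv => //; exact: in_disc_sub wz.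
Qed.

Lemma eq_hol phi chi : (forall z, normc z < 1 -> phi z = chi z) -> hol phi -> hol chi.
Proof.
move=> E h z z1; have [d hd] := h _ z1; exists d; move: hd.
apply: (@hasd_local _ _ _ _ _ (1 - normc z)); first by rewrite subr_gt0.
by move=> w /in_disc_sub /E.
Qed.

Lemma hol_cst a : hol (fun=> a).
Proof. by move=> z _; exists 0; exact: hasd_cst. Qed.

Lemma hol_id : hol id.
Proof. by move=> z _; exists 1; exact: hasd_id. Qed.

Lemma hol_add phi chi : hol phi -> hol chi -> hol (fun z => phi z + chi z).
Proof.
by move=> h1 h2 z z1; eexists; exact: (hasd_add (hol_dv h1 z1) (hol_dv h2 z1)).
Qed.

Lemma hol_sub phi chi : hol phi -> hol chi -> hol (fun z => phi z - chi z).
Proof.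
by move=> h1 h2 z z1; eexists; exact: (hasd_sub (hol_dv h1 z1) (hol_dv h2 z1)).
Qed.

Lemma hol_mul phi chi : hol phi -> hol chi -> hol (fun z => phi z * chi z).
Proof.
by move=> h1 h2 z z1; eexists; exact: (hasd_mul (hol_dv h1 z1) (hol_dv h2 z1)).
Qed.

Lemma hol_scale a phi : hol phi -> hol (fun z => a * phi z).
Proof. by move=> h z z1; eexists; exact: (hasd_scale a (hol_dv h z1)). Qed.

Lemma hol_inv phi : hol phi -> (forall z, normc z < 1 -> phi z != 0) ->
  hol (fun z => (phi z)^-1).
Proof. by move=> h nz z z1; eexists; exact: (hasd_inv (hol_dv h z1) (nz _ z1)). Qed.

Lemma hol_comp phi eta : hol eta -> (forall z, normc z < 1 -> normc (eta z) < 1) ->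
  hol phi -> hol (fun z => phi (eta z)).
Proof.
by move=> h1 e1 h2 z z1; eexists; exact: (hasd_comp (hol_dv h1 z1) (hol_dv h2 (e1 _ z1))).
Qed.

Lemma hol_cexp phi : hol phi -> hol (fun z => cexp (phi z)).
Proof. by move=> h z z1; eexists; exact: (hasd_comp (hol_dv h z1) (hasd_cexp _)). Qed.

Lemma hol_exp phi n : hol phi -> hol (fun z => phi z ^+ n).
Proof.
move=> h; elim: n => [|n IH]; first exact: hol_cst.
by have := hol_mul h IH; apply: eq_hol => z _; rewrite exprS.
Qed.

(** The removable singularity of a difference quotient. *)
Definition ddiff phi w z := if z == w then dv phi w else (phi z - phi w) / (z - w).

Lemma ddiffE phi w z : phi z = phi w + (z - w) * ddiff phi w z.
Proof.
rewrite /ddiff; case: eqVneq => [->|zw]; first by rewrite subrr mul0r addr0.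
by rewrite mulrC divfK ?subr_eq0 // addrC subrK.
Qed.

Lemma hol_ddiff phi w : hol phi -> normc w < 1 -> hol (ddiff phi w).
Proof.
move=> h w1 z z1; have [->|zw] := eqVneq z w; last first.
  have zw0 : z - w != 0 by rewrite subr_eq0.
  have h1 := hasd_mul (hasd_sub (hol_dv h z1) (hasd_cst (phi w) z))
    (hasd_inv (hasd_sub (hasd_id z) (hasd_cst w z)) zw0).
  eexists; move: h1; apply: (@hasd_local _ _ _ _ _ (normc (z - w))).
    by rewrite normc_gt0.
  by move=> v vz; rewrite /ddiff; case: eqVneq => // vw; move: vz; rewrite vw normc_sub ltxx.
have [d2 hd2] := hol_deriv h w1.
exists (d2 / 2); apply: eps_hasd => eps eps0.
have [del del0 Hd] := hasd_eps hd2 (divr_gt0 eps0 (ltr0Sn _ 3)).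
exists (Num.min (del / 2) ((1 - normc w) / 2)).
  by rewrite lt_min !divr_gt0 // subr_gt0.
move=> v; rewrite lt_min => /andP[v1 v2].
have dw : ddiff phi w w = dv phi w by rewrite /ddiff eqxx.
rewrite dw; have [->|vw] := eqVneq v w.
  by rewrite dw !subrr mulr0 subrr normc0 mulr0.
pose chi z := phi z - d2 / 2 * ((z - w) * (z - w)).
pose chi' z := dv phi z - d2 * (z - w).
set s := normc (v - w) in v1 v2 *; have s0 : 0 < s by rewrite normc_gt0 subr_eq0.
have A : normc (chi v - chi w - dv phi w * (v - w)) <= 2 * (eps / 4 * (2 * s)) * s.
  apply: (@normc_MVT _ chi chi' w (dv phi w) (2 * s)).
  - move=> u uw; have u1 : normc u < 1 by apply: (@in_disc_sub w); lra.
    have hs : hasd (fun u => u - w) u 1.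
      by have := hasd_sub (hasd_id u) (hasd_cst w u); rewrite subr0.
    have := hasd_sub (hol_dv h u1) (hasd_scale (d2 / 2) (hasd_mul hs hs)).
    rewrite mulr1 mul1r (_ : d2 / 2 * _ = d2 * (u - w)) //.
    by field.
  - move=> u uw.
    have -> : chi' u - dv phi w = dv phi u - dv phi w - d2 * (u - w) by rewrite /chi'; ring.
    apply: le_trans (Hd _ _) _; first lra.
    by rewrite ler_pM2l ?divr_gt0 // ltW.
  - by rewrite subrr normc0 mulr_gt0.
  by rewrite -/s ltr_pMl // ltr1n.
have vw0 : v - w != 0 by rewrite subr_eq0.
have E : ddiff phi w v - dv phi w - d2 / 2 * (v - w) =
    (chi v - chi w - dv phi w * (v - w)) / (v - w).
  by rewrite /ddiff (negbTE vw) /chi subrr !mulr0 subr0; field.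
by rewrite E normcM normcV -/s ler_pdivrMr // (le_trans A) //; lra.
Qed.

Lemma dv0_cst phi : hol phi -> (forall z, normc z < 1 -> dv phi z = 0) ->
  forall z, normc z < 1 -> phi z = phi 0.
Proof.
move=> h h0 z z1; have := @normc_MVT _ phi (dv phi) 0 0 1 0 0 z.
rewrite mulr0 !mul0r !subr0 normc0 => H.
apply/eqP; rewrite -subr_eq0 -normc_eq0P; apply/eqP/le_anti; rewrite normc_ge0 andbT.
apply: H => // w; rewrite subr0 => w1; first exact: hol_dv.
by rewrite h0 // subrr normc0.
Qed.

Definition csegint (F : R -> R[i]) : R[i] :=
  segint 0 1 (fun s => complex.Re (F s)) +i* segint 0 1 (fun s => complex.Im (F s)).

Lemma csegint_dist (F : R -> R[i]) c (M : R) :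
  (forall s, 0 <= s <= 1 -> {for s, continuous (fun s => complex.Re (F s))}) ->
  (forall s, 0 <= s <= 1 -> {for s, continuous (fun s => complex.Im (F s))}) ->
  (forall s, 0 <= s <= 1 -> normc (F s - c) <= M) -> normc (csegint F - c) <= 2 * M.
Proof.
move=> cR cI H; apply: le_trans (normc_le_ReIm _) _; rewrite !ReImE /=.
rewrite mulr_natl mulr2n.
have := @segint_dist R 0 1 (complex.Re c) M _ ler01 cR.
have := @segint_dist R 0 1 (complex.Im c) M _ ler01 cI.
rewrite subr0 !mul1r => H1 H2; apply: lerD; [apply: H2|apply: H1] => s /H;
rewrite -?ReN -?ReD -?ImN -?ImD; apply: le_trans; [exact: normRe_le|exact: normIm_le].
Qed.


Definition ccont_seg (F : R -> R[i]) :=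
  cont_seg 0 1 (fun s => complex.Re (F s)) /\ cont_seg 0 1 (fun s => complex.Im (F s)).

Lemma ccont_segB (F G : R -> R[i]) : ccont_seg F -> ccont_seg G -> ccont_seg (fun s => F s - G s).
Proof.
move=> [f1 f2] [g1 g2]; split; [have := cont_segB f1 g1|have := cont_segB f2 g2];
by congr (cont_seg _ _ _); apply/funext => s; rewrite !ReImE.
Qed.

Lemma ccont_segZ c (F : R -> R[i]) : ccont_seg F -> ccont_seg (fun s => c * F s).
Proof.
move=> [f1 f2]; have cc (x : R) := @cont_seg_cst R 0 1 x.
split.
  have := cont_segB (cont_segM (cc (complex.Re c)) f1) (cont_segM (cc (complex.Im c)) f2).
  by congr (cont_seg _ _ _); apply/funext => s; rewrite !ReImE.
have := cont_segD (cont_segM (cc (complex.Re c)) f2) (cont_segM (cc (complex.Im c)) f1).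
by congr (cont_seg _ _ _); apply/funext => s; rewrite !ReImE.
Qed.

Lemma csegintB (F G : R -> R[i]) : ccont_seg F -> ccont_seg G ->
  csegint (fun s => F s - G s) = csegint F - csegint G.
Proof.
move=> [f1 f2] [g1 g2]; apply: complex_ext; rewrite !ReImE /= -segintB //;
by apply: eq_segint => s _; rewrite !ReImE.
Qed.

Lemma csegintZ c (F : R -> R[i]) : ccont_seg F -> csegint (fun s => c * F s) = c * csegint F.
Proof.
move=> [f1 f2]; have cc (x : R) := @cont_seg_cst R 0 1 x.
apply: complex_ext; rewrite !ReImE /= -!segintZ //.
  rewrite -segintB; [|exact: cont_segM..].
  by apply: eq_segint => s _; rewrite !ReImE.
rewrite -segintD; [|exact: cont_segM..].
by apply: eq_segint => s _; rewrite !ReImE.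
Qed.

Lemma segint_FTC (f F : R -> R) (x y : R) : x < y ->
  (forall s, x <= s <= y -> is_derive s 1 F (f s)) -> cont_seg x y f ->
  segint x y f = F y - F x.
Proof.
move=> xy hF cf.
have cF s : x <= s <= y -> {for s, continuous F}.
  by move=> /hF [h _]; apply: differentiable_continuous; exact/derivable1_diffP.
rewrite /segint /Rintegral (@continuous_FTC2 _ f F x y xy) //.
- by apply: continuous_in_subspaceT => s /set_mem /=; rewrite in_itv /=; exact: cf.
- split.
  + move=> s; rewrite in_itv /= => /andP[xs sy].
    by have [|] := hF s; rewrite ?(ltW xs) ?(ltW sy).
  + by apply: cvg_at_right_filter; apply: cF; rewrite lexx ltW.
  + by apply: cvg_at_left_filter; apply: cF; rewrite lexx ltW.
move=> s; rewrite in_itv /= => /andP[xs sy].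
by have [|_ <-] := hF s; rewrite ?(ltW xs) ?(ltW sy) // derive1E.
Qed.

Lemma cont_ray phi z u s : cont_at phi (z + s%:C * u) ->
  {for s, continuous (fun s => complex.Re (phi (z + s%:C * u)))} /\
  {for s, continuous (fun s => complex.Im (phi (z + s%:C * u)))}.
Proof.
move=> c.
have key e : 0 < e -> exists2 del : R, 0 < del & forall y, `|y - s| < del ->
    normc (phi (z + y%:C * u) - phi (z + s%:C * u)) < e.
  move=> /c [d d0 Hd]; have u0 : 0 < normc u + 1 by rewrite ltr_wpDl ?normc_ge0.
  exists (d / (normc u + 1)) => [|y yd]; first by rewrite divr_gt0.
  apply: Hd; have -> : z + y%:C * u - (z + s%:C * u) = (y - s)%:C * u.
    by rewrite rmorphB /=; ring.
  rewrite normcM normc_real; rewrite ltr_pdivlMr // in yd; apply: le_lt_trans yd.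
  by rewrite ler_wpM2l // lerDl.
split; apply/cvgrPdist_lt => e /key [d d0 Hd]; apply/nbhs_ballP; exists d => // y;
rewrite /ball /= distrC => /Hd A; rewrite distrC -?ReN -?ReD -?ImN -?ImD;
apply: le_lt_trans A; [exact: normRe_le|exact: normIm_le].
Qed.

Lemma normc_scale s z : 0 <= s <= 1 -> normc (s%:C * z) <= normc z.
Proof.
move=> /andP[s0 s1]; rewrite normcM normc_real ger0_norm //.
by rewrite ler_piMl ?normc_ge0.
Qed.

Lemma ccont_ray phi z : hol phi -> normc z < 1 -> ccont_seg (fun s => phi (s%:C * z)).
Proof.
move=> h z1; have c s : 0 <= s <= 1 -> cont_at phi (0 + s%:C * z).
  by move=> s01; apply: hol_cont => //; rewrite add0r (le_lt_trans (normc_scale _ s01)).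
split=> s s01; have [c1 c2] := cont_ray (c _ s01).
  move: c1; congr (continuous_at _ _); apply/funext => x; by rewrite add0r.
move: c2; congr (continuous_at _ _); apply/funext => x; by rewrite add0r.
Qed.

(** The integrand is the derivative of [s * phi (s z)]. *)
Lemma csegint_ray phi z : hol phi -> normc z < 1 ->
  csegint (fun s => phi (s%:C * z) + s%:C * z * dv phi (s%:C * z)) = phi z.
Proof.
move=> h z1.
have seg s : 0 <= s <= 1 -> normc (s%:C * z) < 1.
  by move=> s01; exact: le_lt_trans (normc_scale _ s01) z1.
pose G w := phi w + w * dv phi w.
have hG : hol G by apply: hol_add => //; apply: hol_mul; [exact: hol_id|exact: hol_deriv].
have [cG1 cG2] := ccont_ray hG z1.
pose F w := w * phi (w * z).
have hF s : 0 <= s <= 1 -> hasd F (0 + s%:C * 1) (G (s%:C * z)).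
  move=> s01; rewrite add0r mulr1.
  have h1 : hasd (fun w => w * z) s%:C z.
    by have := hasd_mul (hasd_id s%:C) (hasd_cst z s%:C); rewrite mulr0 addr0 mul1r.
  have := hasd_mul (hasd_id s%:C) (hasd_comp h1 (hol_dv h (seg _ s01))).
  by rewrite mul1r /G (_ : s%:C * (_ * z) = s%:C * z * dv phi (s%:C * z)) //; ring.
have FE s : F (0 + s%:C * 1) = s%:C * phi (s%:C * z) by rewrite /F add0r mulr1.
apply: complex_ext => /=.
  transitivity (complex.Re (F (0 + 1%:C * 1)) - complex.Re (F (0 + 0%:C * 1))).
    apply: (segint_FTC (F := fun s => complex.Re (F (0 + s%:C * 1)))) => // s s01.
    by have := hasd_ray_Re (hF _ s01); rewrite mulr1.
  by rewrite !FE !mul0r !mul1r subr0.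
transitivity (complex.Im (F (0 + 1%:C * 1)) - complex.Im (F (0 + 0%:C * 1))).
  apply: (segint_FTC (F := fun s => complex.Im (F (0 + s%:C * 1)))) => // s s01.
  have ImE (x : R[i]) : complex.Im x = complex.Re ((0 +i* -1) * x).
    by rewrite ReM /= mul0r sub0r mulN1r opprK.
  have := hasd_ray_Re (hasd_scale (0 +i* -1) (hF _ s01)).
  rewrite mulr1 -ImE; congr (is_derive _ _ _ _); apply/funext => x.
  by rewrite -ImE.
by rewrite !FE !mul0r !mul1r subr0.
Qed.

(** The primitive is the integral along rays. *)
Lemma hol_primitive phi : hol phi -> exists2 Phi, Phi 0 = 0 &
  forall z, normc z < 1 -> hasd Phi z (phi z).
Proof.
move=> h; pose Phi w := csegint (fun s => w * phi (s%:C * w)); exists Phi.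
  by rewrite /Phi; apply: complex_ext => /=; rewrite (eq_segint (g := fun=> 0));
    rewrite ?segint_cst ?mulr0 // => s _; rewrite mul0r.
move=> z z1; have h' := hol_deriv h; have h'' := hol_deriv h'.
pose rho := (1 - normc z) / 2.
have rho0 : 0 < rho by rewrite divr_gt0 // subr_gt0.
pose r1 := normc z + rho.
have r11 : r1 < 1 by rewrite /r1 /rho; lra.
have r10 : 0 <= r1 by rewrite addr_ge0 ?normc_ge0 // ltW.
have bound chi : hol chi -> exists2 M, 0 < M & forall w, normc w <= r1 -> normc (chi w) <= M.
  move=> hchi; have [|M M0 HM] := @closed_disc_bounded _ chi 0 r1 r10.
    by move=> w; rewrite subr0 => wr; apply: hol_cont => //; lra.
  by exists M => // w wr; apply: HM; rewrite subr0.
have [M1 M10 HM1] := bound _ h'; have [M2 M20 HM2] := bound _ h''.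
pose L := 2 * M1 + M2; have L0 : 0 < L by rewrite /L addr_gt0 // mulr_gt0.
apply: eps_hasd => eps eps0.
exists (Num.min (rho / 2) (eps / (16 * L))).
  by rewrite lt_min; apply/andP; split; apply: divr_gt0 => //; apply: mulr_gt0.
move=> w; rewrite lt_min => /andP[w1 w2].
have wr : normc w < r1.
  by have := lerB_normc w z; rewrite /r1; lra.
have [->|wz] := eqVneq w z; first by rewrite !subrr mulr0 subrr normc0 mulr0.
have wz0 : 0 < normc (w - z) by rewrite normc_gt0 subr_eq0.
set T := normc (w - z) in w1 w2 wz0 *.
pose D s := phi (s%:C * z) + s%:C * z * dv phi (s%:C * z).
have cD : ccont_seg D.
  pose G w := phi w + w * dv phi w.
  have hG : hol G by apply: hol_add => //; apply: hol_mul; [exact: hol_id|exact: hol_deriv].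
  exact: (ccont_ray hG z1).
have c1 := ccont_segZ w (ccont_ray h (lt_trans wr r11)).
have c2 := ccont_segZ z (ccont_ray h z1).
have c3 := ccont_segZ (w - z) cD.
rewrite -(csegint_ray h z1) [_ * (w - z)]mulrC -csegintZ // -!csegintB //; last exact: ccont_segB.
rewrite -[csegint _]subr0.
apply: le_trans (_ : 2 * (8 * L * T ^+ 2) <= _); last first.
  have -> : 2 * (8 * L * T ^+ 2) = T * (16 * L) * T by ring.
  by rewrite ler_pM2r // -ler_pdivlMr ?mulr_gt0 // ltW.
have [cc1 cc2] := ccont_segB (ccont_segB c1 c2) c3.
apply: csegint_dist => // s s01; rewrite subr0.
have /andP[s0 s1] := s01.
pose g v := v * phi (s%:C * v).
pose g' v := phi (s%:C * v) + s%:C * v * dv phi (s%:C * v).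
have hs v : hasd (fun v => s%:C * v) v s%:C.
  by have := hasd_scale s%:C (hasd_id v); rewrite mulr1.
have seg v : normc v <= r1 -> normc (s%:C * v) <= r1.
  by move=> vr; exact: le_trans (normc_scale _ s01) vr.
have hg v : normc v < 1 -> hasd g v (g' v).
  move=> v1; have sv := le_lt_trans (normc_scale _ s01) v1.
  have := hasd_mul (hasd_id v) (hasd_comp (hs v) (hol_dv h sv)).
  by rewrite mul1r /g' (_ : v * (_ * s%:C) = s%:C * v * dv phi (s%:C * v)) //; ring.
have hg' v : normc v < 1 -> hasd g' v (2 * s%:C * dv phi (s%:C * v) +
    s%:C * v * (s%:C * dv (dv phi) (s%:C * v))).
  move=> v1; have sv := le_lt_trans (normc_scale _ s01) v1.
  have := hasd_add (hasd_comp (hs v) (hol_dv h sv))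
     (hasd_mul (hs v) (hasd_comp (hs v) (hol_dv h' sv))).
  set d1 := (X in hasd _ _ X); set d2 := (X in _ -> hasd _ _ X).
  by have -> : d2 = d1 by rewrite /d1 /d2; ring.
have nr v : normc (v - z) < rho -> normc v <= r1.
  by move=> vz; have := lerB_normc v z; rewrite /r1; lra.
have g''M v : normc v <= r1 -> normc (2 * s%:C * dv phi (s%:C * v) +
    s%:C * v * (s%:C * dv (dv phi) (s%:C * v))) <= L.
  move=> vr; apply: le_trans (le_normcD _ _) _; rewrite !normcM !normc_real.
  have -> : normc (2 : R[i]) = 2.
    by rewrite -[2 : R[i]]/(2%:R) -(rmorph_nat (@real_complex R)) normc_real ger0_norm.
  rewrite ger0_norm //; have A1 := HM1 _ (seg _ vr); have A2 := HM2 _ (seg _ vr).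
  apply: lerD.
    rewrite -mulrA ler_pM2l // -[leRHS]mul1r ler_pM ?normc_ge0 //.
  have v1 : normc v <= 1 by rewrite (le_trans vr) // ltW.
  rewrite -[leRHS]mul1r -[X in X * M2]mulr1.
  apply: ler_pM; rewrite ?mulr_ge0 ?normc_ge0 //; first by rewrite ler_pM ?normc_ge0.
  by rewrite -[leRHS]mul1r ler_pM ?normc_ge0.
have g'L v : normc (v - z) < rho -> normc (g' v - g' z) <= 2 * L * normc (v - z).
  move=> vz; have := @normc_MVT _ g' _ z 0 rho L z v.
  rewrite mul0r subr0; apply => //.
  - by move=> u uz; apply: hg'; have := nr _ uz; lra.
  - by move=> u /nr /g''M; rewrite subr0.
  by rewrite subrr normc0.
have := @normc_MVT _ g g' z (g' z) (2 * T) (2 * L * (2 * T)) z w.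
have -> : w * phi (s%:C * w) - z * phi (s%:C * z) - (w - z) * D s = g w - g z - g' z * (w - z).
  by rewrite /g /g' /D; ring.
rewrite -/T; have -> : 2 * (2 * L * (2 * T)) * T = 8 * L * T ^+ 2 by ring.
apply.
- move=> u uz; apply: hg; have : normc u <= r1 by apply: nr; lra.
  lra.
- move=> u uz; apply: le_trans (g'L _ _) _; first lra.
  by rewrite ler_pM2l ?mulr_gt0 // ltW.
- by rewrite subrr normc0 mulr_gt0.
by rewrite ltr_pMl // ltr1n.
Qed.

Lemma cexp_surj c : c != 0 -> exists l, cexp l = c.
Proof.
move=> c0; have [t _ ct] := polarE c; exists (ln (normc c) +i* t).
by rewrite cexp_ln // normc_gt0.
Qed.

(** A primitive of [N' / N], corrected by a constant, is a logarithm: the quotient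
    of [N] by its exponential has derivative [0]. *)
Lemma hol_log N : hol N -> (forall z, normc z < 1 -> N z != 0) ->
  exists2 L, hol L & forall z, normc z < 1 -> N z = cexp (L z).
Proof.
move=> h nz; have hN := hol_mul (hol_deriv h) (hol_inv h nz).
have [Phi Phi0 hPhi] := hol_primitive hN.
have [l El] := cexp_surj (nz 0 (eq_ind_r (fun x => x < 1) ltr01 (normc0 R))).
exists (fun z => l + Phi z).
  by move=> z /hPhi hz; eexists; exact: hasd_add (hasd_cst l z) hz.
pose E z := N z * cexp (- Phi z).
have hE z : normc z < 1 -> hasd E z 0.
  move=> z1; have := hasd_mul (hol_dv h z1) (hasd_comp (hasd_opp (hPhi _ z1)) (hasd_cexp _)).
  have -> // : dv N z * cexp (- Phi z) + N z * (cexp (- Phi z) * - (dv N z / N z)) = 0.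
  by field; exact: nz.
have holE : hol E by move=> z /hE; exists 0.
have dE w : normc w < 1 -> dv E w = 0 by move=> w1; exact/dvE/hE.
move=> z z1; have := dv0_cst holE dE z1.
rewrite /E Phi0 oppr0 cexp0 mulr1 cexpN -El cexpD => <-.
by rewrite divfK // cexp_neq0.
Qed.

Lemma circle_in_disc r t : 0 <= r -> r < 1 -> normc (circle 0 r t) < 1.
Proof. by move=> r0 r1; rewrite normc_circle0. Qed.

Lemma hol_circ_mean_Re phi r : hol phi -> 0 < r -> r < 1 ->
  circ_mean (fun z => complex.Re (phi z)) 0 r = complex.Re (phi 0).
Proof.
move=> h r0 r1; apply: (@circ_mean_Re _ _ _ 1) => //.
  by apply: hol_cont => //; rewrite normc0.
by move=> z /=; rewrite subr0 => /andP[_ /h].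
Qed.

(** A nonvanishing holomorphic function is an exponential, so the logarithm of
    its modulus is the real part of a holomorphic function. *)
Lemma circ_mean_ln N r : hol N -> (forall z, normc z < 1 -> N z != 0) -> 0 < r -> r < 1 ->
  circ_mean (fun z => ln (normc (N z))) 0 r = ln (normc (N 0)).
Proof.
move=> h nz r0 r1; have [L hL NE] := hol_log h nz.
rewrite NE ?normc0 // normc_cexp expRK -(hol_circ_mean_Re hL r0 r1).
apply: eq_circ_mean => t; rewrite NE ?normc_cexp ?expRK //.
by apply: circle_in_disc => //; exact: ltW.
Qed.

Lemma rcont_ln U z : 0 < U z -> rcont_at U z -> rcont_at (fun z => ln (U z)) z.
Proof. by move=> U0 cU; apply: rcont_comp => //; exact: continuous_ln. Qed.

End Holomorphic.


(** * Subharmonic functions and monotonicity of circular means *)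

Section Subharmonic.
Variable R : realType.
Implicit Types (a z w u : R[i]) (r s t M : R) (U V : R[i] -> R) (phi : R[i] -> R[i]).

Definition imu : R[i] := 0 +i* 1.

Lemma imu2 : imu * imu = -1.
Proof. by apply: complex_ext; rewrite !ReImE /=; ring. Qed.

Lemma normc_imu : normc imu = 1.
Proof. by rewrite normc_imag normr1. Qed.

Definition avg4 U z u := (U (z + u) + U (z - u) + U (z + imu * u) + U (z - imu * u)) / 4.

(** A pointwise substitute for a nonnegative Laplacian, stable under
    taking minorants that touch the function. *)
Definition sub4 U z := forall eps : R, 0 < eps -> exists2 del : R, 0 < del &
  forall u, normc u < del -> U z - eps * normc u ^+ 2 <= avg4 U z u.

Lemma sqr_normcD z w : normc (z + w) ^+ 2 =
  normc z ^+ 2 + 2 * complex.Re (z * w^*) + normc w ^+ 2.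
Proof. by rewrite !sqr_normcE !ReImE; ring. Qed.

Lemma sqr_normcD_dist z w :
  `|normc (z + w) ^+ 2 - normc z ^+ 2| <= normc w * (2 * normc z + normc w).
Proof.
have A := normc_dist (z + w) z; rewrite addrAC subrr add0r in A.
have B := le_normcD z w.
have n1 := normc_ge0 (z + w); have n2 := normc_ge0 z; have n3 := normc_ge0 w.
rewrite subr_sqr normrM ler_pM ?normr_ge0 // ger0_norm; lra.
Qed.

Lemma parallelogram z w : normc (z + w) ^+ 2 + normc (z - w) ^+ 2 =
  2 * (normc z ^+ 2 + normc w ^+ 2).
Proof. by rewrite !sqr_normcE !ReImE; ring. Qed.

Lemma avg4_sqr z u : avg4 (fun w => normc w ^+ 2) z u = normc z ^+ 2 + normc u ^+ 2.
Proof.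
rewrite /avg4 !sqr_normcD !normcN normcM normc_imu mul1r.
have n4 : 4 != 0 :> R by rewrite pnatr_eq0.
by apply: (mulIf n4); rewrite divfK // !ReImE /=; ring.
Qed.

(** Adding [k |z|^2] makes the inequality for four-point averages strict, so the
    maximum can only be on the circle; then [k] tends to [0]. *)
Lemma max_principle U r M : 0 <= r -> (forall z, normc z <= r -> rcont_at U z) ->
  (forall z, normc z < r -> sub4 U z) -> (forall z, normc z = r -> U z <= M) ->
  forall z, normc z <= r -> U z <= M.
Proof.
move=> r0 cU sU hM z zr; apply/ler_addgt0Pr => e e0.
pose k := e / (r ^+ 2 + 1).
have r21 : 0 < r ^+ 2 + 1 by rewrite ltr_wpDl // sqr_ge0.
have k0 : 0 < k by rewrite divr_gt0.
pose V w := U w + k * normc w ^+ 2.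
have [|z0 z0r Hmax] := @closed_disc_max _ V 0 r r0.
  move=> w; rewrite subr0 => /cU h; apply: rcont_add => //.
  apply: rcont_mul; first exact: rcont_cst.
  by apply: rcont_exp; apply: rcont_normc; exact: cont_id.
rewrite subr0 in z0r.
have Vmax w : normc w <= r -> V w <= V z0 by move=> wr; apply: Hmax; rewrite subr0.
have UV w : U w <= V w by rewrite lerDl mulr_ge0 ?sqr_ge0 // ltW.
move: z0r; rewrite le_eqVlt => /predU1P[z0r|z0r].
  apply: le_trans (UV _) _; apply: le_trans (Vmax _ zr) _.
  rewrite /V z0r lerD ?hM // /k mulrAC ler_pdivrMr // ler_pM2l // lerDl //.
exfalso; have [del del0 Hdel] := sU _ z0r _ (divr_gt0 k0 (ltr0Sn _ 1)).
pose m := Num.min (del / 2) ((r - normc z0) / 2).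
have m0 : 0 < m by rewrite lt_min !divr_gt0 // subr_gt0.
have mdel : m < del.
  by have : m <= del / 2; [rewrite ge_min lexx|lra].
have mr : normc z0 + m <= r.
  by have : m <= (r - normc z0) / 2; [rewrite ge_min lexx orbT|lra].
have nm : normc (m%:C : R[i]) = m by rewrite normc_real gtr0_norm.
have nim : normc (imu * m%:C) = m by rewrite normcM normc_imu mul1r.
have /Hdel : normc (m%:C : R[i]) < del by rewrite nm.
have A : avg4 V z0 m%:C = avg4 U z0 m%:C + k * (normc z0 ^+ 2 + m ^+ 2).
  by have := avg4_sqr z0 m%:C; rewrite nm => <-; rewrite /avg4 /V; ring.
have in1 w : normc w = m -> V (z0 + w) <= V z0.
  by move=> wm; apply: Vmax; apply: le_trans (le_normcD _ _) _; rewrite wm.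
have B : avg4 V z0 m%:C <= V z0.
  have b1 := in1 _ nm; have b2 := in1 (- m%:C); rewrite normcN in b2.
  have b3 := in1 _ nim; have b4 := in1 (- (imu * m%:C)); rewrite normcN in b4.
  by have {}b2 := b2 nm; have {}b4 := b4 nim; rewrite /avg4; lra.
have m2 : 0 < k * m ^+ 2 by rewrite mulr_gt0 // exprn_gt0.
rewrite A /V in B; rewrite nm; lra.
Qed.

Lemma uniform_continuity (f : R -> R) (x y : R) : cont_seg x y f -> forall e : R, 0 < e ->
  exists2 d : R, 0 < d & forall s t, x <= s <= y -> `|s - t| < d -> `|f s - f t| < e.
Proof.
move=> cf e e0.
have /compact_near_coveringP/(_ R (nbhs (0 : R))
  (fun d s => forall t, `|s - t| < d -> `|f s - f t| < e)) H : compact `[x, y].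
  exact: segment_compact.
have {}H : \forall d \near 0, `[x, y] `<=` (fun s => forall t, `|s - t| < d -> `|f s - f t| < e).
  apply: H => s; rewrite /= in_itv /= => /cf /cvgrPdist_lt/(_ _ (divr_gt0 e0 (ltr0Sn _ 1))).
  move=> /nbhs_ballP[d /= d0 Hd].
  exists (ball s (d / 2), ball 0 (d / 2)).
    by split; apply: nbhsx_ballx; rewrite divr_gt0.
  case=> s' d' [/= A B] t st.
  rewrite /ball /= in A; rewrite /ball /= sub0r normrN in B.
  have d'd : d' < d / 2 by exact: le_lt_trans (ler_norm _) B.
  have A1 := Hd s'; have A2 := Hd t; rewrite /ball /= in A1 A2.
  have {}A1 := A1 ltac:(lra).
  have {}A2 : `|f s - f t| < e / 2.
    apply: A2; apply: le_lt_trans (ler_distD s' _ _) _; lra.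
  by apply: le_lt_trans (ler_distD (f s) _ _) _; rewrite [X in X + _]distrC; lra.
case/nbhs_ballP : H => d /= d0 Hd; exists (d / 2); first by rewrite divr_gt0.
move=> s t sI; have := Hd (d / 2); rewrite /ball /= sub0r normrN gtr0_norm ?divr_gt0 //.
by move=> /(_ ltac:(lra) s); apply; rewrite /= in_itv.
Qed.

Lemma segint_sum (f : R -> R) (h : R) n : 0 <= h -> cont_seg 0 (h *+ n) f ->
  segint 0 (h *+ n) f = \sum_(j < n) segint (h *+ j) (h *+ j.+1) f.
Proof.
move=> h0; elim: n => [|n IH] cf.
  by rewrite big_ord0 mulr0n /segint set_itv1 Rintegral_set1.
have hn : 0 <= h *+ n by rewrite mulrn_wge0.
have hS : h *+ n <= h *+ n.+1 by rewrite mulrSr lerDl.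
rewrite (segint_split hn hS cf) big_ord_recr /= IH //.
exact: cont_segW cf.
Qed.

Definition rotsum U n z := (n.+1%:R)^-1 * \sum_(j < n.+1) U (cis (2 * pi / n.+1%:R *+ j) * z).

Lemma rotsum_cvg U r : 0 <= r -> (forall t, rcont_at U (circle 0 r t)) -> forall e : R, 0 < e ->
  exists n0, forall n, (n0 <= n)%N -> forall t, 0 <= t <= 2 * pi / n.+1%:R ->
  `|rotsum U n (circle 0 r t) - circ_mean U 0 r| <= e.
Proof.
move=> r0 cU e e0; pose f t := U (circle 0 r t).
have cf : cont_seg 0 (2 * pi) f by exact: rcont_circle_seg.
have [d d0 Hd] := uniform_continuity cf e0.
have p0 := pi2_gt0 R.
exists (Num.truncn (2 * pi / d)) => n n0n t tI.
set h : R := 2 * pi / n.+1%:R in tI *.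
have h0 : 0 < h by rewrite divr_gt0.
have hn : h *+ n.+1 = 2 * pi by rewrite -[_ *+ n.+1]mulr_natr divfK.
have hd : h < d.
  rewrite ltr_pdivrMr // [d * _]mulrC -ltr_pdivrMr //.
  by apply: lt_le_trans (truncnS_gt _) _; rewrite ler_nat ltnS.
have jle (j : 'I_n.+1) : h *+ j + h <= 2 * pi.
  by rewrite -hn -mulrSr ler_wpMn2l // ltW.
rewrite /rotsum /circ_mean -/f.
have -> : segint 0 (2 * pi) f = \sum_(j < n.+1) segint (h *+ j) (h *+ j.+1) f.
  by rewrite -hn segint_sum ?hn // ltW.
have -> : (2 * pi)^-1 = (n.+1%:R)^-1 * h^-1.
  by rewrite /h invf_div mulrA mulVf // mul1r.
rewrite -[_ * h^-1 * _]mulrA -mulrBr mulr_sumr -sumrB normrM gtr0_norm ?invr_gt0 // ler_pdivrMl //.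
apply: le_trans (ler_norm_sum _ _ _) _.
have -> : n.+1%:R * e = \sum_(j < n.+1) e by rewrite sumr_const card_ord mulr_natl.
apply: ler_sum => j _.
have hj0 : 0 <= h *+ j by rewrite mulrn_wge0 // ltW.
have fE : U (cis (h *+ j) * circle 0 r t) = f (t + h *+ j).
  by rewrite /f /circle !add0r cisD; congr (U _); ring.
rewrite fE.
have tj : h *+ j <= t + h *+ j <= h *+ j.+1 by rewrite mulrSr; lra.
have := @segint_dist _ (h *+ j) (h *+ j.+1) (f (t + h *+ j)) e f.
rewrite mulrSr lerDl => /(_ (ltW h0)).
have -> : h *+ j + h - h *+ j = h by rewrite addrAC subrr add0r.
move=> H; rewrite distrC.
have -> : h^-1 * segint (h *+ j) (h *+ j + h) f - f (t + h *+ j) =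
    h^-1 * (segint (h *+ j) (h *+ j + h) f - h * f (t + h *+ j)).
  by rewrite mulrBr mulKf // gt_eqF.
rewrite normrM gtr0_norm ?invr_gt0 // ler_pdivrMl //; apply: H.
  by apply: cont_segW cf => //; exact: jle.
move=> x /andP[x1 x2]; rewrite mulrSr in tj.
apply/ltW/Hd; first by have := jle j; lra.
by apply: le_lt_trans hd; rewrite ler_norml; lra.
Qed.

Lemma rotsum_period U n z : rotsum U n (cis (2 * pi / n.+1%:R) * z) = rotsum U n z.
Proof.
congr (_ * _); set h : R := 2 * pi / n.+1%:R.
have E (j : nat) : U (cis (h *+ j) * (cis h * z)) = U (cis (h *+ j.+1) * z).
  by rewrite mulrA -cisD mulrSr.
under eq_bigr do rewrite E.
rewrite big_ord_recr /= big_ord_recl /= mulr0n cis0 addrC.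
have -> : h *+ n.+1 = 2 * pi by rewrite -[_ *+ n.+1]mulr_natr divfK.
by rewrite cis2pi; congr (_ + _); apply: eq_bigr.
Qed.

Lemma sub4_rotsum U n r : (forall z, normc z < r -> sub4 U z) ->
  forall z, normc z < r -> sub4 (rotsum U n) z.
Proof.
move=> sU z zr e e0; set h : R := 2 * pi / n.+1%:R.
have H (j : 'I_n.+1) : exists d : R, 0 < d /\ forall u, normc u < d ->
    U (cis (h *+ j) * z) - e * normc u ^+ 2 <= avg4 U (cis (h *+ j) * z) (cis (h *+ j) * u).
  have [|d d0 Hd] := sU (cis (h *+ j) * z) _ e e0; first by rewrite normcM normc_cis mul1r.
  exists d; split=> // u ud; have := Hd (cis (h *+ j) * u).
  by rewrite normcM normc_cis mul1r; exact.
have [d Hd] := choice H.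
exists (\big[Num.min/1]_(j < n.+1) d j).
  by apply/bigmin_gtP; split=> // j _; have [] := Hd j.
move=> u /bigmin_gtP[_ ud].
have -> : avg4 (rotsum U n) z u =
    (n.+1%:R)^-1 * \sum_(j < n.+1) avg4 U (cis (h *+ j) * z) (cis (h *+ j) * u).
  rewrite /avg4 /rotsum -!mulrDr -mulrA; congr (_ * _).
  rewrite -!big_split /= mulr_suml; apply: eq_bigr => j _.
  by rewrite -/h !mulrDr !mulrN ![_ * (imu * _)]mulrCA.
have -> : rotsum U n z - e * normc u ^+ 2 =
    (n.+1%:R)^-1 * \sum_(j < n.+1) (U (cis (h *+ j) * z) - e * normc u ^+ 2).
  rewrite sumrB mulrBr sumr_const card_ord; congr (_ - _).
  by rewrite -[X in _ = _ * X]mulr_natl mulKf ?pnatr_eq0.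
rewrite ler_pM2l ?invr_gt0 //; apply: ler_sum => j _.
by have [_] := Hd j; apply; exact: ud.
Qed.

Lemma rcont_sum n (F : 'I_n -> R[i] -> R) z : (forall j, rcont_at (F j) z) ->
  rcont_at (fun w => \sum_(j < n) F j w) z.
Proof.
elim: n F => [|n IH] F cF.
  have -> : (fun w => \sum_(j < 0) F j w) = (fun=> 0) by apply/funext => w; rewrite big_ord0.
  exact: rcont_cst.
have -> : (fun w => \sum_(j < n.+1) F j w) =
    (fun w => \sum_(j < n) F (widen_ord (leqnSn n) j) w + F ord_max w).
  by apply/funext => w; rewrite big_ord_recr.
by apply: rcont_add => //; exact: IH.
Qed.

(** Averaging a subharmonic function over the rotations by roots of unity gives
    a subharmonic function whose values on a circle are Riemann sums: the
    maximum principle for the average becomes monotonicity of the means. *)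
Lemma circ_mean_mono U r s : 0 <= r -> r <= s ->
  (forall z, normc z <= s -> rcont_at U z) -> (forall z, normc z < s -> sub4 U z) ->
  circ_mean U 0 r <= circ_mean U 0 s.
Proof.
move=> r0 rs cU sU; have s0 := le_trans r0 rs.
apply/ler_addgt0Pr => e e0; have e2 : 0 < e / 2 by rewrite divr_gt0.
have [|n1 H1] := @rotsum_cvg U r r0 _ _ e2.
  by move=> t; apply: cU; rewrite normc_circle0.
have [|n2 H2] := @rotsum_cvg U s s0 _ _ e2.
  by move=> t; apply: cU; rewrite normc_circle0.
pose n := maxn n1 n2; have p0 := pi2_gt0 R.
set h : R := 2 * pi / n.+1%:R.
have h0 : 0 < h by rewrite divr_gt0.
have A := H1 n (leq_maxl _ _) 0; have {}A := A ltac:(by rewrite lexx ltW).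
have B t : 0 <= t -> rotsum U n (circle 0 s t) <= circ_mean U 0 s + e / 2.
  move=> t0; pose m := Num.truncn (t / h).
  have m1 : m%:R <= t / h by rewrite truncn_le ?divr_ge0 // ltW.
  have m2 : t / h < m.+1%:R by exact: truncnS_gt.
  pose t' := t - h *+ m.
  have t'I : 0 <= t' <= h.
    rewrite ler_pdivlMr // mulr_natl in m1; rewrite ltr_pdivrMr // mulr_natl mulrSr in m2.
    by rewrite /t'; apply/andP; split; lra.
  have E : rotsum U n (circle 0 s t) = rotsum U n (circle 0 s t').
    have -> : t = t' + h *+ m by rewrite subrK.
    elim: (m) => [|k IH]; first by rewrite mulr0n addr0.
    rewrite -IH; have -> : circle 0 s (t' + h *+ k.+1) = cis h * circle 0 s (t' + h *+ k).
      by rewrite mulrSr addrA /circle !add0r [cis (_ + h)]cisD; ring.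
    exact: rotsum_period.
  by have := H2 n (leq_maxr _ _) _ t'I; rewrite -E ler_norml; lra.
have C : rotsum U n (circle 0 r 0) <= circ_mean U 0 s + e / 2.
  apply: (@max_principle (rotsum U n) s).
  - exact: s0.
  - move=> z zs; apply: rcont_mul; first exact: rcont_cst.
    apply: rcont_sum => j.
    set c := cis _; have cc : rcont_at U (c * z) by apply: cU; rewrite normcM normc_cis mul1r.
    move=> ee /cc [d d0 Hd]; exists d => // w wd; apply: Hd.
    by rewrite -mulrBr normcM normc_cis mul1r.
  - exact: sub4_rotsum.
  - move=> z zs; have [t tI zE] := polarE z.
    have -> : z = circle 0 s (t + 2 * pi) by rewrite circle2pi /circle add0r zE zs.
    by apply: B; have := pi_ge0 R; lra.
  by rewrite normc_circle0.
by move: A; rewrite ler_norml; lra.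
Qed.

(** The Laplacian of [|phi|^2] is [4 |phi'|^2]. The factorization
    [phi (z + u) = phi z + u * D (z + u)] with [D] the difference quotient replaces
    a second order expansion of [phi]. *)
Lemma avg4_sqr_normc phi z : hol phi -> normc z < 1 -> forall eps : R, 0 < eps ->
  exists2 del : R, 0 < del & forall u, normc u < del ->
  `|avg4 (fun w => normc (phi w) ^+ 2) z u - normc (phi z) ^+ 2 -
    normc (dv phi z) ^+ 2 * normc u ^+ 2| <= eps * normc u ^+ 2.
Proof.
move=> h z1 eps eps0.
pose D := ddiff phi z; have hD : hol D by exact: hol_ddiff.
pose D2 := ddiff D z; have hD2 : hol D2 by exact: hol_ddiff.
have Dz : D z = dv phi z by rewrite /D /ddiff eqxx.
set b := D2 z; set c := dv phi z; set p := phi z.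
have E u : phi (z + u) = (p + c * u + b * u ^+ 2) + (D2 (z + u) - b) * u ^+ 2.
  rewrite (ddiffE phi z (z + u)) -/D (ddiffE D z (z + u)) -/D2 Dz [z + u]addrC addrK -/p -/c.
  by ring.
pose B := normc p + normc c + normc b.
have B0 : 0 <= B by rewrite !addr_ge0 ?normc_ge0.
pose k := Num.min 1 (eps / (2 * (2 * B + 1))).
have k0 : 0 < k by rewrite lt_min ltr01 divr_gt0 // mulr_gt0 // ltr_wpDl // mulr_ge0.
have [d d0 Hd] := hol_cont hD2 z1 k0.
pose m := Num.min (Num.min d 1) (eps / (2 * (normc b ^+ 2 + 1))).
have b20 : 0 < normc b ^+ 2 + 1 by rewrite ltr_wpDl // sqr_ge0.
exists m; first by rewrite !lt_min d0 ltr01 /= divr_gt0 // mulr_gt0.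
move=> u; rewrite !lt_min => /andP[/andP[ud u1] ub].
pose P v := p + c * v + b * v ^+ 2.
have PB v : normc v = normc u -> normc (P v) <= B.
  move=> vu; apply: le_trans (le_normcD _ _) _; apply: lerD.
    apply: le_trans (le_normcD _ _) _; rewrite lerD2l normcM vu.
    by rewrite ler_piMr ?normc_ge0 // ltW.
  by rewrite normcM normcX vu ler_piMr ?normc_ge0 // expr_le1 ?normc_ge0 // ltW.
have step v : normc v = normc u ->
    `|normc (phi (z + v)) ^+ 2 - normc (P v) ^+ 2| <= eps / 2 * normc u ^+ 2.
  move=> vu; rewrite E; apply: le_trans (sqr_normcD_dist _ _) _.
  rewrite normcM normcX vu; set q := normc (D2 _ - _).
  have qk : q <= k by apply/ltW/Hd; rewrite addrC addKr vu.
  have q0 : 0 <= q by exact: normc_ge0.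
  have u20 : 0 <= normc u ^+ 2 by rewrite sqr_ge0.
  have u21 : normc u ^+ 2 <= 1 by rewrite expr_le1 ?normc_ge0 // ltW.
  rewrite mulrAC ler_wpM2r //.
  apply: le_trans (_ : k * (2 * B + 1) <= _); last first.
    rewrite -ler_pdivlMr; last by rewrite ltr_wpDl // mulr_ge0.
    rewrite ge_min; apply/orP; right; rewrite invfM mulrA //.
  apply: ler_pM => //; first by rewrite addr_ge0 ?mulr_ge0 ?normc_ge0.
  apply: lerD; first by rewrite ler_pM2l // PB.
  have k1 : k <= 1 by rewrite ge_min lexx.
  by rewrite -[leRHS]mulr1 ler_pM // (le_trans qk).
have exact4 : (normc (P u) ^+ 2 + normc (P (- u)) ^+ 2 + normc (P (imu * u)) ^+ 2 +
    normc (P (- (imu * u))) ^+ 2) / 4 =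
    normc p ^+ 2 + normc c ^+ 2 * normc u ^+ 2 + normc b ^+ 2 * normc u ^+ 4.
  have E1 : P u = (p + b * u ^+ 2) + c * u by rewrite /P; ring.
  have E2 : P (- u) = (p + b * u ^+ 2) - c * u by rewrite /P; ring.
  have E3 : P (imu * u) = (p - b * u ^+ 2) + imu * (c * u).
    by rewrite /P exprMn [imu ^+ 2]imu2; ring.
  have E4 : P (- (imu * u)) = (p - b * u ^+ 2) - imu * (c * u).
    by rewrite /P sqrrN exprMn [imu ^+ 2]imu2; ring.
  rewrite E1 E2 E3 E4 parallelogram -addrA parallelogram !normcM normc_imu mul1r.
  have := parallelogram p (b * u ^+ 2); rewrite normcM normcX; lra.
have S1 := step u erefl; have S2 := step (- u) (normcN _).
have S3 := step (imu * u); have S4 := step (- (imu * u)).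
rewrite normcN in S4; rewrite normcM normc_imu mul1r in S3 S4.
have {}S3 := S3 erefl; have {}S4 := S4 erefl.
have bu : normc b ^+ 2 * normc u ^+ 4 <= eps / 2 * normc u ^+ 2.
  have -> : normc u ^+ 4 = normc u ^+ 2 * normc u ^+ 2 by ring.
  rewrite mulrA ler_wpM2r ?sqr_ge0 //.
  have A : normc u * (2 * (normc b ^+ 2 + 1)) < eps by rewrite -ltr_pdivlMr // mulr_gt0.
  have n0 := normc_ge0 u; have n1 := sqr_ge0 (normc b).
  have : normc b ^+ 2 * normc u ^+ 2 <= normc b ^+ 2 * normc u.
    by rewrite ler_wpM2l // expr2 ler_piMl // ltW.
  lra.
have bu0 : 0 <= normc b ^+ 2 * normc u ^+ 4.
  by rewrite mulr_ge0 ?sqr_ge0 // exprn_ge0 // normc_ge0.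
rewrite /avg4; move: S1 S2 S3 S4 exact4 bu bu0.
set x1 := normc (phi _) ^+ 2; set x2 := normc (phi (z - u)) ^+ 2.
set x3 := normc (phi (z + imu * u)) ^+ 2; set x4 := normc (phi (z - imu * u)) ^+ 2.
set y1 := normc (P u) ^+ 2; set y2 := normc (P (- u)) ^+ 2.
set y3 := normc (P (imu * u)) ^+ 2; set y4 := normc (P (- (imu * u))) ^+ 2.
clear; rewrite !ler_norml; lra.
Qed.

End Subharmonic.


(** * Univalent functions have no critical points *)

Section Univalent.
Variable R : realType.
Implicit Types (a z w u : R[i]) (r s t M : R) (U V : R[i] -> R) (phi psi : R[i] -> R[i]).

Lemma sub4_sqr_normc phi z : hol phi -> normc z < 1 -> sub4 (fun w => normc (phi w) ^+ 2) z.
Proof.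
move=> h z1 e e0; have [d d0 Hd] := avg4_sqr_normc h z1 e0.
exists d => // u /Hd; have : 0 <= normc (dv phi z) ^+ 2 * normc u ^+ 2.
  by rewrite mulr_ge0 ?sqr_ge0.
rewrite ler_norml; lra.
Qed.

Lemma hol_rcont_sqr phi z : hol phi -> normc z < 1 -> rcont_at (fun w => normc (phi w) ^+ 2) z.
Proof. by move=> h z1; apply: rcont_exp; apply: rcont_normc; exact: hol_cont. Qed.

Lemma max_modulus phi s M : hol phi -> 0 <= s -> s < 1 ->
  (forall z, normc z = s -> normc (phi z) <= M) ->
  forall z, normc z <= s -> normc (phi z) <= M.
Proof.
move=> h s0 s1 hM z zs.
have M0 : 0 <= M.
  by apply: le_trans (normc_ge0 _) (hM s%:C _); rewrite normc_real ger0_norm.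
rewrite -(@ler_pXn2r _ 2) ?nnegrE ?normc_ge0 //.
apply: (@max_principle _ (fun w => normc (phi w) ^+ 2) s) => //.
- by move=> w ws; apply: hol_rcont_sqr => //; exact: le_lt_trans ws s1.
- by move=> w ws; apply: sub4_sqr_normc => //; exact: lt_trans ws s1.
by move=> w /hM; rewrite ler_pXn2r ?nnegrE ?normc_ge0.
Qed.

Lemma hol_poly_sub a : hol (fun z => z - a).
Proof. by apply: hol_sub; [exact: hol_id|exact: hol_cst]. Qed.

(** A zero of infinite order would make the function arbitrarily small near it,
    by the maximum principle applied to the quotients by high powers. *)
Lemma zero_order phi a : hol phi -> normc a < 1 ->
  (forall z, normc z < 1 -> z != a -> phi z != phi a) ->
  exists m Y, [/\ hol Y, (0 < m)%N, forall z, phi z = phi a + (z - a) ^+ m * Y z & Y a != 0].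
Proof.
move=> h a1 nz; apply: contrapT => H.
have all_k k : exists2 Y, hol Y & forall z, phi z = phi a + (z - a) ^+ k * Y z.
  elim: k => [|k [Y hY EY]].
    exists (fun z => phi z - phi a); first by apply: hol_sub => //; exact: hol_cst.
    by move=> z; rewrite expr0 mul1r addrC subrK.
  case: k => [|k] in hY EY *.
    by exists (ddiff phi a); [exact: hol_ddiff|move=> z; rewrite expr1; exact: ddiffE].
  have Ya : Y a = 0.
    by apply/eqP/negPn/negP => Ya; apply: H; exists k.+1, Y; split.
  exists (ddiff Y a); first exact: hol_ddiff.
  by move=> z; rewrite EY [Y z](ddiffE Y a) Ya add0r mulrA -exprSr.
pose s := (1 + normc a) / 2; pose d := s - normc a.
have a0 := normc_ge0 a.
have s1 : s < 1 by rewrite /s; lra.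
have s0 : 0 <= s by rewrite /s; lra.
have d0 : 0 < d by rewrite /d /s; lra.
have [|M M0 HM] := @closed_disc_bounded _ (fun z => phi z - phi a) 0 s s0.
  move=> z; rewrite subr0 => zs; apply: cont_sub; last exact: cont_cst.
  by apply: hol_cont => //; lra.
pose z1 := a + (d / 2)%:C.
have z1a : normc (z1 - a) = d / 2.
  by rewrite /z1 addrC addKr normc_real gtr0_norm // divr_gt0.
have z1s : normc z1 <= s.
  by have := lerB_normc z1 a; have := d0; rewrite z1a /d; lra.
have z1n : phi z1 - phi a != 0.
  rewrite subr_eq0; apply: nz; first lra.
  by rewrite -subr_eq0 -normc_gt0 z1a divr_gt0.
have bound k : normc (phi z1 - phi a) <= M / 2 ^+ k.
  have [Y hY EY] := all_k k.
  have YM : normc (Y z1) <= M / d ^+ k.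
    apply: (@max_modulus Y s) => // z zs.
    have za : d <= normc (z - a) by have := lerB_normc z a; rewrite zs.
    rewrite ler_pdivlMr ?exprn_gt0 //.
    apply: le_trans (HM z _); last by rewrite subr0 zs.
    rewrite EY [phi a + _]addrC addrK normcM normcX mulrC ler_wpM2r ?normc_ge0 //.
    by rewrite lerXn2r // nnegrE ?normc_ge0 // ltW.
  rewrite EY [phi a + _]addrC addrK normcM normcX z1a.
  apply: le_trans (ler_wpM2l _ YM) _; first by rewrite exprn_ge0 // divr_ge0 // ltW.
  rewrite expr_div_n; have dk : d ^+ k != 0 by rewrite expf_neq0 // gt_eqF.
  have k2 : 2 ^+ k != 0 :> R by rewrite expf_neq0.
  by rewrite le_eqVlt; apply/orP; left; apply/eqP; field; rewrite dk k2.
have n0 : 0 < normc (phi z1 - phi a) by rewrite normc_gt0.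
have [k hk] : exists k, M / normc (phi z1 - phi a) < k%:R.
  by exists (Num.truncn (M / normc (phi z1 - phi a))).+1; rewrite truncnS_gt.
have := bound k; rewrite ler_pdivlMr ?exprn_gt0 // => A.
rewrite ltr_pdivrMr // in hk.
have : k%:R <= 2 ^+ k :> R by rewrite -natrX ler_nat; exact: ltnW (ltn_expl _ _).
move=> B; have : k%:R * normc (phi z1 - phi a) <= 2 ^+ k * normc (phi z1 - phi a).
  by rewrite ler_wpM2r // ltW.
rewrite mulrC in A; lra.
Qed.

(** Openness at a simple zero: if a small value [t] were omitted, the reciprocal
    of [kappa - t] would violate the maximum principle. *)
Lemma simple_zero_open E a : hol E -> (forall z, normc z < 1 -> E z != 0) -> normc a < 1 ->
  exists2 mu : R, 0 < mu & forall t : R[i], normc t < mu ->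
    exists2 z, normc z < 1 & (z - a) * E z = t.
Proof.
move=> hE nz a1; pose s := (1 + normc a) / 2; pose d := s - normc a.
have a0 := normc_ge0 a.
have s1 : s < 1 by rewrite /s; lra.
have s0 : 0 <= s by rewrite /s; lra.
have d0 : 0 < d by rewrite /d /s; lra.
have [|M M0 HM] := @closed_disc_bounded _ (fun z => (E z)^-1) 0 s s0.
  by move=> z; rewrite subr0 => zs; apply: hol_cont; [exact: hol_inv|lra].
exists (d / M / 2); first by rewrite !divr_gt0.
move=> t tmu; apply: contrapT => H.
have omit z : normc z < 1 -> (z - a) * E z - t != 0.
  by move=> z1; apply/negP; rewrite subr_eq0 => /eqP Et; apply: H; exists z.
have t0 : 0 < normc t.
  have := omit a a1; rewrite subrr mul0r sub0r oppr_eq0 => t0.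
  by rewrite normc_gt0.
have dM : 0 < d / M by rewrite divr_gt0.
have hq : hol (fun z => ((z - a) * E z - t)^-1).
  apply: hol_inv => //; apply: hol_sub; last exact: hol_cst.
  by apply: hol_mul => //; exact: hol_poly_sub.
have := @max_modulus _ s (2 / (d / M)) hq s0 s1.
have as_ : normc a <= s by rewrite /s; lra.
move=> /(_ _ a as_); rewrite subrr mul0r sub0r normcV normcN => A.
have : (normc t)^-1 <= 2 / (d / M).
  apply: A => z zs; rewrite normcV -[2 / _]invrK lef_pV2 ?posrE ?invr_gt0 ?divr_gt0 //; last first.
    by rewrite normc_gt0 omit // zs.
  have za : d <= normc (z - a) by have := lerB_normc z a; rewrite zs.
  have Ez : M^-1 <= normc (E z).
    have := HM z; rewrite subr0 zs normcV => /(_ (lexx _)) EM.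
    by rewrite -[normc _]invrK lef_pV2 ?posrE // invr_gt0 normc_gt0 nz // zs.
  have B : d / M <= normc ((z - a) * E z).
    by rewrite normcM ler_pM // ?invr_ge0 // ltW.
  have := lerB_normc ((z - a) * E z) t; rewrite invf_div; lra.
rewrite -[leLHS]div1r ler_pdivrMr // mulrAC ler_pdivlMr //; lra.
Qed.

Definition inj_disc phi := forall z w, normc z < 1 -> normc w < 1 -> phi z = phi w -> z = w.

Lemma cis_root_neq1 m : (1 < m)%N -> cis (2 * pi / m%:R) != 1 :> R[i].
Proof.
move=> m1; apply/negP => /eqP/(congr1 (@complex.Re R)) /= ce.
have pi0 := pi_gt0 R; have m0 : 0 < m%:R :> R by rewrite ltr0n ltnW.
have mpi : 2 * pi / m%:R <= pi :> R.
  by rewrite ler_pdivrMr // mulrC ler_pM2l // ler_nat.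
have p0 : 0 < 2 * pi / m%:R :> R by rewrite divr_gt0 // mulr_gt0.
have E : 2 * pi / m%:R = 0 :> R.
  apply: cos_inj; last by rewrite cos0.
    by rewrite in_itv /= (ltW p0).
  by rewrite in_itv /= lexx (ltW pi0).
by move: p0; rewrite E ltxx.
Qed.

Lemma cis_root m : (0 < m)%N -> cis (2 * pi / m%:R) ^+ m = 1 :> R[i].
Proof.
move=> m0; rewrite -cexp_imag -cexpMn.
have -> : (0 +i* (2 * pi / m%:R)) *+ m = 0 +i* (2 * pi) :> R[i].
  have H n (x : R) : (0 +i* x) *+ n = 0 +i* (x *+ n).
    by elim: n => [|n IH]; rewrite ?mulr0n // mulrS IH mulrS; apply: complex_ext;
       rewrite !ReImE /= ?addr0.
  by rewrite H -[_ *+ m]mulr_natr divfK // pnatr_eq0 -lt0n.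
by rewrite cexp_imag cis2pi.
Qed.

(** A zero of order [m] is locally the [m]-th power of a coordinate, hence takes
    small values [m] times. *)
Lemma univalent_dv_neq0 psi a : hol psi -> inj_disc psi -> normc a < 1 -> dv psi a != 0.
Proof.
move=> h inj a1.
have nz z : normc z < 1 -> z != a -> psi z != psi a.
  by move=> z1 za; apply/negP => /eqP /inj E; move: za; rewrite E ?eqxx.
have [m [Y [hY m0 EY Ya]]] := zero_order h a1 nz.
have [m1|m1] := leqP m 1.
  have {m0 m1} mE : m = 1%N by apply/eqP; rewrite eqn_leq m1.
  rewrite (@dvE _ psi a (Y a)) //.
  have hs : hasd (fun w => w - a) a 1.
    by have := hasd_sub (hasd_id a) (hasd_cst a a); rewrite subr0.
  have := hasd_add (hasd_cst (psi a) a) (hasd_mul hs (hol_dv hY a1)).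
  rewrite subrr mul0r addr0 mul1r add0r; apply: (@hasd_local _ _ _ _ _ 1) => // w _.
  by rewrite [psi w]EY mE expr1.
exfalso; have Ynz z : normc z < 1 -> Y z != 0.
  move=> z1; have [->//|za] := eqVneq z a.
  by apply/negP => /eqP Yz; have := nz z z1 za; rewrite EY Yz mulr0 addr0 eqxx.
have [L hL YL] := hol_log hY Ynz.
pose E z := cexp ((m%:R)^-1 * L z).
have hE : hol E by apply: hol_cexp; exact: hol_scale.
have mnz : m%:R != 0 :> R[i] by rewrite pnatr_eq0 -lt0n.
have EmY z : normc z < 1 -> E z ^+ m = Y z.
  move=> z1; rewrite YL // /E -cexpMn; congr cexp.
  have key (x : R[i]) : x *+ m = x * m%:R by rewrite mulr_natr.
  by rewrite key mulrAC mulVf // mul1r.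
have [mu mu0 Hmu] := simple_zero_open hE (fun z _ => cexp_neq0 _) a1.
set om := cis (2 * pi / m%:R) : R[i].
have nt : normc ((mu / 2)%:C : R[i]) < mu.
  by rewrite normc_real gtr0_norm ?divr_gt0 //; lra.
have [z1 z11 E1] := Hmu _ nt.
have [z2 z21 E2] : exists2 z, normc z < 1 & (z - a) * E z = om * (mu / 2)%:C.
  by apply: Hmu; rewrite normcM normc_cis mul1r.
have X1 : psi z1 = psi a + (mu / 2)%:C ^+ m by rewrite EY -EmY // -exprMn E1.
have X2 : psi z2 = psi a + (mu / 2)%:C ^+ m.
  by rewrite EY -EmY // -exprMn E2 exprMn cis_root ?mul1r.
have zz : z1 = z2 by apply: inj => //; rewrite X1 X2.
move: E2; rewrite -zz E1 => /eqP; rewrite -subr_eq0 -{1}[(mu / 2)%:C]mul1r -mulrBl.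
rewrite mulf_eq0 subr_eq0 eq_sym (negbTE (cis_root_neq1 m1)) /= -normc_eq0P.
by rewrite normc_real normr_eq0 gt_eqF // divr_gt0.
Qed.

Lemma ddiff_neq0 psi a z : hol psi -> inj_disc psi -> normc a < 1 -> normc z < 1 ->
  ddiff psi a z != 0.
Proof.
move=> h inj a1 z1; rewrite /ddiff; case: (eqVneq z a) => [_|za].
  exact: univalent_dv_neq0.
rewrite mulf_neq0 ?invr_eq0 ?subr_eq0 //.
by apply/negP => /eqP /inj E; move: za; rewrite E ?eqxx.
Qed.

End Univalent.


(** * The logarithmic kernel *)

Section LogKernel.
Variable R : realType.
Implicit Types (a z w x c : R[i]) (r s t B d : R) (U V : R[i] -> R) (N Y : R[i] -> R[i]).
Notation mu := (@lebesgue_measure R).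

Definition cint (f : R -> \bar R) : \bar R := (\int[mu]_(t in `[0%R, (2 * pi)%R]) f t)%E.

(** The value [+oo] at [d = 0] makes the kernel monotone in [d], and [B] makes it
    nonnegative for [d <= B], so that Tonelli's theorem applies to it. *)
Definition lnk B d : \bar R := if d == 0 then +oo%E else (ln B - ln d)%:E.

Lemma lnkE B d : 0 < d -> lnk B d = (ln B - ln d)%:E.
Proof. by move=> d0; rewrite /lnk gt_eqF. Qed.

Lemma lnk_ge0 B d : 0 <= d -> d <= B -> (0 <= lnk B d)%E.
Proof.
rewrite le_eqVlt => /predU1P[<- _|d0 dB]; first by rewrite /lnk eqxx.
by rewrite lnkE // lee_fin subr_ge0 ler_ln ?posrE // (lt_le_trans d0).
Qed.

Lemma lnk_anti B d (e : R) : 0 <= d -> d <= e -> (lnk B e <= lnk B d)%E.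
Proof.
rewrite le_eqVlt => /predU1P[<- _|d0 de]; first by rewrite {2}/lnk eqxx leey.
have e0 := lt_le_trans d0 de; rewrite !lnkE // lee_fin.
by rewrite lerB // ler_ln ?posrE.
Qed.

Lemma measurable_lnk B : measurable_fun setT (lnk B).
Proof.
apply: measurable_fun_ifT => //.
  by apply: measurable_fun_eqr.
apply/measurable_EFinP; exact: measurable_funB.
Qed.

Lemma tonelli_circle (f : R * R -> \bar R) : measurable_fun setT f ->
  (forall p, (0 <= f p)%E) ->
  cint (fun t => cint (fun u => f (t, u))) = cint (fun u => cint (fun t => f (t, u))).
Proof.
move=> mf f0; pose D := `[0, 2 * pi]%classic : set R.
have mD : measurable (D `*` D) by apply: measurableX; exact: measurable_itv.
pose g := f \_ (D `*` D).
have mg : measurable_fun setT g.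
  by apply/(measurable_restrictT _ mD); exact: measurable_funTS.
have g0 p : (0 <= g p)%E by rewrite /g patchE; case: ifP.
have := @fubini_tonelli _ _ _ _ R mu mu g mg g0.
have gE t u : g (t, u) = if t \in D then (if u \in D then f (t, u) else 0%E) else 0%E.
  rewrite /g patchE; case: ifPn => [/set_mem[/= t1 u1]|].
    by rewrite (mem_set t1) (mem_set u1).
  case: ifPn => // t1; case: ifPn => // u1.
  by rewrite (_ : (t, u) \in D `*` D) // inE; split; exact: set_mem.
have E1 : cint (fun t => cint (fun u => f (t, u))) = (\int[mu]_t \int[mu]_u g (t, u))%E.
  rewrite /cint integral_mkcond; apply: eq_integral => t _; rewrite patchE -/D.
  case: ifPn => tD.
    by rewrite integral_mkcond; apply: eq_integral => u _; rewrite patchE gE tD.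
  by rewrite integral0_eq // => u _; rewrite gE (negbTE tD).
have E2 : cint (fun u => cint (fun t => f (t, u))) = (\int[mu]_u \int[mu]_t g (t, u))%E.
  rewrite /cint integral_mkcond; apply: eq_integral => u _; rewrite patchE -/D.
  case: ifPn => uD.
    rewrite integral_mkcond; apply: eq_integral => t _; rewrite patchE gE uD.
    by case: ifP.
  by rewrite integral0_eq // => t _; rewrite gE (negbTE uD); case: ifP.
by rewrite E1 E2.
Qed.

Lemma cint_circ_mean U r : (forall t, rcont_at U (circle 0 r t)) ->
  cint (fun t => (U (circle 0 r t))%:E) = (2 * pi * circ_mean U 0 r)%:E.
Proof.
move=> cU; rewrite /circ_mean mulVKf ?gt_eqF ?pi2_gt0 // /segint /Rintegral fineK //.
by apply: integrable_fin_num => //; apply: cont_seg_integrable; exact: rcont_circle_seg.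
Qed.

Lemma eq_cint (f g : R -> \bar R) : (forall t, f t = g t) -> cint f = cint g.
Proof. by move=> E; apply: eq_integral => t _; rewrite E. Qed.

Lemma cint_ge0 (f : R -> \bar R) : (forall t, (0 <= f t)%E) -> (0 <= cint f)%E.
Proof. by move=> f0; apply: integral_ge0. Qed.

Lemma le_cint (f g : R -> \bar R) : (forall t, (0 <= f t)%E) ->
  measurable_fun setT f -> measurable_fun setT g ->
  (forall t, (f t <= g t)%E) -> (cint f <= cint g)%E.
Proof.
move=> f0 mf mg fg; apply: ge0_le_integral => //.
- exact: measurable_funTS.
- exact: measurable_funTS.
Qed.

Lemma cint_cst r : cint (fun=> r%:E) = (2 * pi * r)%:E.
Proof.
rewrite -[in RHS](circ_mean_cst r (0 : R[i]) 1) -cint_circ_mean // => t.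
exact: rcont_cst.
Qed.

Lemma measurable_circle U r : (forall t, rcont_at U (circle 0 r t)) ->
  measurable_fun setT (fun t => U (circle 0 r t)).
Proof.
by move=> cU; apply: continuous_measurable_fun => t; exact: rcont_circle.
Qed.

(** On the disc [1 - c z] has no zero, and its value at [0] is [1]. *)
Lemma mean_ln_unit_factor c r : normc c = 1 -> 0 <= r -> r < 1 ->
  circ_mean (fun z => ln (normc (1 - c * z))) 0 r = 0.
Proof.
move=> c1; rewrite le_eqVlt => /predU1P[<- _|r0 r1].
  rewrite (eq_circ_mean (V := fun=> 0)) ?circ_mean_cst // => t.
  by rewrite /circle mul0r addr0 mulr0 subr0 normc1 ln1.
rewrite circ_mean_ln // ?mulr0 ?subr0 ?normc1 ?ln1 //.
  by apply: hol_sub; [exact: hol_cst|apply: hol_scale; exact: hol_id].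
move=> z z1; rewrite subr_eq0; apply/negP => /eqP E.
by have := congr1 (@normc R) E; rewrite normc1 normcM c1 mul1r => E'; rewrite -E' ltxx in z1.
Qed.

Lemma rcont_ln_normc N z : cont_at N z -> N z != 0 -> rcont_at (fun z => ln (normc (N z))) z.
Proof.
move=> cN Nz; apply: rcont_ln; first by rewrite normc_gt0.
exact: rcont_normc.
Qed.

Lemma cint_lnk_scale k c r B : 0 < k -> normc c = 1 -> 0 <= r -> r < 1 ->
  cint (fun t => lnk B (k * normc (1 - c * circle 0 r t))) = (2 * pi * (ln B - ln k))%:E.
Proof.
move=> k0 c1 r0 r1.
have nz t : 1 - c * circle 0 r t != 0.
  rewrite subr_eq0; apply/negP => /eqP E.
  have := congr1 (@normc R) E; rewrite normc1 normcM c1 mul1r normc_circle0 // => E'.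
  by rewrite -E' ltxx in r1.
have cN t : rcont_at (fun z => ln (normc (1 - c * z))) (circle 0 r t).
  apply: rcont_ln_normc => //; apply: cont_sub; first exact: cont_cst.
  by apply: cont_mul; [exact: cont_cst|exact: cont_id].
rewrite (@eq_cint _ (fun t => ((ln B - ln k) + -1 * ln (normc (1 - c * circle 0 r t)))%:E)).
  rewrite (@cint_circ_mean (fun z => (ln B - ln k) + -1 * ln (normc (1 - c * z))) r).
    rewrite circ_meanD; first last.
    - by move=> t; apply: rcont_mul => //; exact: rcont_cst.
    - by move=> t; exact: rcont_cst.
    by rewrite circ_mean_cst circ_meanZ // mean_ln_unit_factor // mulr0 addr0.
  move=> t; apply: rcont_add; first exact: rcont_cst.
  by apply: rcont_mul => //; exact: rcont_cst.
move=> t; have n0 : 0 < normc (1 - c * circle 0 r t) by rewrite normc_gt0.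
by rewrite lnkE ?mulr_gt0 // lnM ?posrE // mulN1r opprD addrA.
Qed.

Lemma lnk_circle_neq x s B : 0 < s -> normc x != s ->
  cint (fun t => lnk B (normc (x - circle 0 s t))) =
  (2 * pi * (ln B - ln (Num.max (normc x) s)))%:E.
Proof.
move=> s0 xs.
have [xltS|sltx|E] := ltgtP (normc x) s; last by rewrite E eqxx in xs.
- pose c := if x == 0 then 1 else x^* / (normc x)%:C.
  have c1 : normc c = 1.
    rewrite /c; case: eqVneq => [_|x0]; first exact: normc1.
    have nx : 0 < normc x by rewrite normc_gt0.
    by rewrite normcM normcV normc_conj normc_real gtr0_norm // divff // gt_eqF.
  have q1 : normc x / s < 1 by rewrite ltr_pdivrMr // mul1r.
  have q0 : 0 <= normc x / s by rewrite divr_ge0 ?normc_ge0 // ltW.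
  rewrite -(cint_lnk_scale B s0 c1 q0 q1); apply: eq_cint => t; congr (lnk B _).
  have sC : s%:C != 0 :> R[i] by rewrite -normc_gt0 normc_real gtr0_norm.
  have -> : c * circle 0 (normc x / s) t = x^* / s%:C * cis t.
    rewrite /circle add0r rmorphM fmorphV /= /c; case: eqVneq => [->|x0].
      by rewrite normc0 !mul0r mulr0 rmorph0 !mul0r.
    have nx : (normc x)%:C != 0 :> R[i] by rewrite -normc_gt0 normc_real gtr0_norm normc_gt0.
    by field; rewrite nx sC.
  have E : (1 - x^* / s%:C * cis t)^* = 1 - x / s%:C * cis (- t).
    by rewrite -fmorphV -conjc_cis; apply: complex_ext; rewrite !ReImE /=; ring.
  have sX (v : R[i]) : s * normc v = normc (cis t * (s%:C * v)).
    by rewrite !normcM normc_cis mul1r normc_real gtr0_norm.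
  rewrite -[in RHS]normc_conj E sX normc_sub cisN /circle add0r; congr (normc _).
  by field; rewrite sC cis_neq0.
- have x0 : 0 < normc x := lt_trans s0 sltx.
  have xn : x != 0 by rewrite -normc_gt0.
  have nxC : (normc x)%:C != 0 :> R[i] by rewrite -normc_gt0 normc_real gtr0_norm.
  pose c := (normc x)%:C / x.
  have c1 : normc c = 1 by rewrite normcM normcV normc_real gtr0_norm // divff // gt_eqF.
  have q1 : s / normc x < 1 by rewrite ltr_pdivrMr // mul1r.
  have q0 : 0 <= s / normc x by rewrite divr_ge0 ?normc_ge0 // ltW.
  rewrite -(cint_lnk_scale B x0 c1 q0 q1); apply: eq_cint => t; congr (lnk B _).
  rewrite -normcM /circle !add0r rmorphM fmorphV /= /c; congr (normc _).
  by field; rewrite xn nxC.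
Qed.


(** The kernel is continuous up to its singularity, which is what passing to the
    limit from inside the circle requires. *)
Lemma cvg_lnk B (d : R) (u : nat -> R) : 0 < B -> 0 <= d -> (forall n, 0 < u n) ->
  (u n @[n --> \oo] --> d) -> (lnk B (u n) @[n --> \oo] --> lnk B d)%E.
Proof.
move=> B0 d0 u0 ud.
have -> : (fun n => lnk B (u n)) = (fun n => (ln B - ln (u n))%:E).
  by apply/funext => n; rewrite lnkE.
move: d0; rewrite le_eqVlt => /predU1P[d0|d0]; last first.
  rewrite lnkE //; apply: cvg_EFin; first by apply: nearW.
  apply: cvgB; first exact: cvg_cst.
  by apply: continuous_cvg => //; exact: continuous_ln.
rewrite -d0 in ud *; rewrite /lnk eqxx; apply/cvgeryP/cvgryPge => M.
have e0 : 0 < B * expR (- M) by rewrite mulr_gt0 ?expR_gt0.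
move/cvgrPdist_lt: ud => /(_ _ e0); apply: filterS => n.
rewrite sub0r normrN gtr0_norm // => un.
have : ln (u n) <= ln (B * expR (- M)) by rewrite ler_ln ?posrE // ltW.
rewrite lnM ?posrE ?expR_gt0 // expRK; lra.
Qed.

Lemma measurable_normc_circle x s : measurable_fun setT (fun t => normc (x - circle 0 s t)).
Proof.
apply: (@measurable_circle (fun z => normc (x - z)) s) => t; apply: rcont_normc.
by apply: cont_sub; [exact: cont_cst|exact: cont_id].
Qed.

Lemma measurable_lnk_circle B x s :
  measurable_fun setT (fun t => lnk B (normc (x - circle 0 s t))).
Proof.
by apply: measurableT_comp; [exact: measurable_lnk|exact: measurable_normc_circle].
Qed.

(** For [|x| = s] the kernel is singular on the circle, and [x] is approached by
    [rho x] with [rho < 1]: one inequality is Fatou's lemma, the other follows from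
    [|rho x - w|^2 >= rho |x - w|^2] for [|w| = s]. *)
Lemma lnk_circle x s B : 0 < s -> normc x + s <= B ->
  cint (fun t => lnk B (normc (x - circle 0 s t))) =
  (2 * pi * (ln B - ln (Num.max (normc x) s)))%:E.
Proof.
move=> s0 xsB; have [xs|xs] := eqVneq (normc x) s; last exact: lnk_circle_neq.
have B0 : 0 < B by apply: lt_le_trans xsB; rewrite ltr_wpDl ?normc_ge0.
pose rho n : R := 1 - (n.+2%:R)^-1.
have rho0 n : 0 < rho n by rewrite subr_gt0 invf_lt1 // ltr1n.
have rho1 n : rho n < 1 by rewrite ltrBlDr ltrDl invr_gt0.
have rhocvg : rho n @[n --> \oo] --> (1 : R).
  rewrite -[X in _ --> X]subr0; apply: cvgB; first exact: cvg_cst.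
  apply/cvgrPdist_lt => e e0; near=> n.
  rewrite sub0r normrN gtr0_norm ?invr_gt0 // invf_plt ?posrE //.
  apply: lt_le_trans (_ : n%:R <= _); last by rewrite ler_nat; do 2 apply: leqW.
  near: n; exact: nbhs_infty_gtr.
pose xn n := (rho n)%:C * x.
have nxn n : normc (xn n) = rho n * s by rewrite normcM normc_real gtr0_norm // xs.
have nxns n : normc (xn n) < s by rewrite nxn gtr_pMl.
have vn n : cint (fun t => lnk B (normc (xn n - circle 0 s t))) = (2 * pi * (ln B - ln s))%:E.
  by rewrite lnk_circle_neq // ?lt_eqF // max_r // ltW.
have dn0 n t : 0 < normc (xn n - circle 0 s t).
  have := lerB_normc (circle 0 s t) (xn n); rewrite normc_circle0 ?(ltW s0) // normc_sub.
  have := nxns n; lra.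
have dsq n t : normc (xn n - circle 0 s t) ^+ 2 =
    (1 - rho n) ^+ 2 * s ^+ 2 + rho n * normc (x - circle 0 s t) ^+ 2.
  set w := circle 0 s t; have nw : normc w ^+ 2 = s ^+ 2 by rewrite normc_circle0 // ltW.
  rewrite !sqr_normcD !normcN nw nxn xs.
  have -> : complex.Re (xn n * (- w)^*) = rho n * complex.Re (x * (- w)^*).
    by rewrite /xn !ReImE /=; ring.
  ring.
pose D n t := normc (xn n - circle 0 s t); pose d t := normc (x - circle 0 s t).
have d0 t : 0 <= d t by exact: normc_ge0.
have dB t : d t <= B.
  by apply: le_trans (normcB _ _) _; rewrite normc_circle0 ?(ltW s0).
have DB n t : D n t <= B.
  apply: le_trans (normcB _ _) _; rewrite normc_circle0 ?(ltW s0) //.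
  by apply: le_trans xsB; rewrite xs lerD2r ltW.
have mD n : measurable_fun setT (fun t => lnk B (D n t)) by exact: measurable_lnk_circle.
have md : measurable_fun setT (fun t => lnk B (d t)) by exact: measurable_lnk_circle.
rewrite xs maxxx -/(d _); apply/eqP; rewrite eq_le; apply/andP; split.
- have lim t : (lnk B (D n t) @[n --> \oo] --> lnk B (d t))%E.
    apply: cvg_lnk => // [n|]; first exact: dn0.
    apply/cvgrPdist_le => e e0; near=> n.
    apply: le_trans (normc_dist _ _) _.
    have -> : x - circle 0 s t - (xn n - circle 0 s t) = (1 - rho n)%:C * x.
      have key (q : R) w : x - w - (q%:C * x - w) = (1 - q)%:C * x.
        by rewrite rmorphB rmorph1; ring.
      exact: key.
    rewrite normcM normc_real xs -ler_pdivlMr //.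
    near: n; move/cvgrPdist_le: rhocvg; apply; exact: divr_gt0.
  have := @fatou _ _ R mu `[0, 2 * pi] (measurable_itv _) (fun n t => lnk B (D n t))
    (fun n => measurable_funTS (mD n))
    (fun n t _ => lnk_ge0 (normc_ge0 _) (DB n t)).
  have -> : limn_einf (fun n => \int[mu]_(t in `[0%R, (2 * pi)%R]) lnk B (D n t))%E =
      (2 * pi * (ln B - ln s))%:E.
    have -> : (fun n => \int[mu]_(t in `[0%R, (2 * pi)%R]) lnk B (D n t))%E =
        (fun=> (2 * pi * (ln B - ln s))%:E) by apply/funext => n; exact: vn.
    by have [] := cvg_limn_einf_sup (cvg_cst (2 * pi * (ln B - ln s))%:E).
  by under eq_integral do rewrite (cvg_limn_einf_sup (lim _)).1.
- apply/lee_addgt0Pr => e e0.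
  have p0 := pi2_gt0 R.
  have [n hn] : exists n, - (ln (rho n) / 2) <= e / (2 * pi).
    have : ln (rho n) @[n --> \oo] --> ln (1 : R).
      by apply: continuous_cvg => //; exact: continuous_ln.
    rewrite ln1 => /cvgrPdist_le/(_ (e / (2 * pi)) (divr_gt0 e0 p0)) [n _ /(_ n (leqnn _))].
    rewrite sub0r normrN ler_norml => /andP[h _]; exists n; have := divr_gt0 e0 p0; rewrite /= in h; lra.
  rewrite -(vn n) -/(D n _).
  have e20 : (0 <= (e / (2 * pi))%:E)%E by rewrite lee_fin divr_ge0 // ltW.
  have -> : (cint (fun t => lnk B (d t)) + e%:E =
      cint (fun t => lnk B (d t) + (e / (2 * pi))%:E))%E.
    rewrite /cint ge0_integralD //=; last exact: measurable_funTS.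
      congr (_ + _)%E; rewrite -[RHS]/(cint (fun=> (e / (2 * pi))%:E)) cint_cst.
      by rewrite [2 * pi * _]mulrC divfK ?gt_eqF.
    by move=> t _; exact: lnk_ge0.
  apply: le_cint => //.
  - by move=> t; apply: lnk_ge0; [exact: normc_ge0|exact: DB].
  - exact: measurable_lnk_circle.
  - exact: (emeasurable_funD md (@measurable_cst _ _ _ _ setT (e / (2 * pi))%:E)).
  move=> t; move: (d0 t); rewrite le_eqVlt => /predU1P[dt0|dt0].
    by rewrite -dt0 {2}/lnk eqxx addye // leey.
  have Dt0 : 0 < D n t by exact: dn0.
  rewrite -/(D n t) !lnkE // -EFinD lee_fin.
  have : ln (rho n * d t ^+ 2) <= ln (D n t ^+ 2).
    rewrite ler_ln ?posrE ?mulr_gt0 ?exprn_gt0 // /D dsq lerDr mulr_ge0 ?sqr_ge0 //.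
  set E := e / (2 * pi) in hn *.
  rewrite lnM ?posrE ?exprn_gt0 // !lnXn // !mulr2n; lra.
Unshelve. all: end_near. Qed.

End LogKernel.


(** * Jensen's formula *)

Section Jensen.
Variable R : realType.
Implicit Types (a z w x c zeta : R[i]) (r s t B d : R) (U V : R[i] -> R) (N X Y : R[i] -> R[i]).
Notation mu := (@lebesgue_measure R).

Lemma rcont_max U z s : rcont_at U z -> rcont_at (fun z => Num.max (U z) s) z.
Proof.
move=> cU e /cU [d d0 Hd]; exists d => // w /Hd; apply: le_lt_trans.
have n0 := normr_ge0 (U w - U z).
by case: (leP (U w) s) => ?; case: (leP (U z) s) => ?; move: n0;
   (case: (ler0P (U w - U z)) => ? ?; rewrite ?subrr ?normr0 // ?ler_norml; lra).
Qed.

Lemma measurable_fun_normc dd (T : measurableType dd) (f g : T -> R) :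
  measurable_fun setT f -> measurable_fun setT g ->
  measurable_fun setT (fun u => normc (f u +i* g u)).
Proof.
move=> mf mg; rewrite /=.
apply: (@measurableT_comp _ _ _ _ _ _ (@Num.sqrt R)).
  by apply: continuous_measurable_fun; exact: sqrt_continuous.
by apply: measurable_funD; apply: measurable_funX.
Qed.

Lemma measurable_lnk2 X B r s : (forall t, cont_at X (circle 0 r t)) ->
  measurable_fun setT
    (fun p : R * R => lnk B (normc (X (circle 0 r p.2) - circle 0 s p.1))).
Proof.
move=> cX; apply: (measurableT_comp (measurable_lnk B)).
have mR U : (forall t, rcont_at U (circle 0 r t)) ->
    measurable_fun setT (fun p : R * R => U (circle 0 r p.2)).
  move=> cU; apply: (measurableT_comp (f := fun t => U (circle 0 r t))) => //.
  exact: measurable_circle.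
have mS U : (forall t, rcont_at U (circle 0 s t)) ->
    measurable_fun setT (fun p : R * R => U (circle 0 s p.1)).
  move=> cU; apply: (measurableT_comp (f := fun t => U (circle 0 s t))) => //.
  exact: measurable_circle.
pose f (p : R * R) := complex.Re (X (circle 0 r p.2)) - complex.Re (circle 0 s p.1 : R[i]).
pose g (p : R * R) := complex.Im (X (circle 0 r p.2)) - complex.Im (circle 0 s p.1 : R[i]).
have -> : (fun p : R * R => normc (X (circle 0 r p.2) - circle 0 s p.1)) =
    (fun p => normc (f p +i* g p)).
  by apply/funext => p; congr (normc _); apply: complex_ext; rewrite !ReImE.
apply: measurable_fun_normc; apply: measurable_funB.
- by apply: (mR (fun z => complex.Re (X z))) => t; exact: rcont_Re.
- by apply: (mS (fun z => complex.Re z)) => t; apply: rcont_Re; exact: cont_id.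
- by apply: (mR (fun z => complex.Im (X z))) => t; exact: rcont_Im.
- by apply: (mS (fun z => complex.Im z)) => t; apply: rcont_Im; exact: cont_id.
Qed.

(** Averaging Jensen's formula over a circle of values [w] turns
    [ln |X - w|] into [ln (max |X| s)]. *)
Lemma lnk_swap X B r s : 0 < s -> (forall t, cont_at X (circle 0 r t)) ->
  (forall t, normc (X (circle 0 r t)) + s <= B) ->
  cint (fun u => cint (fun t => lnk B (normc (X (circle 0 r t) - circle 0 s u)))) =
  (2 * pi * (2 * pi * (ln B - circ_mean (fun z => ln (Num.max (normc (X z)) s)) 0 r)))%:E.
Proof.
move=> s0 cX XB.
pose f (p : R * R) := lnk B (normc (X (circle 0 r p.2) - circle 0 s p.1)).
have f0 p : (0 <= f p)%E.
  apply: lnk_ge0; first exact: normc_ge0.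
  by apply: le_trans (normcB _ _) _; rewrite normc_circle0 ?(ltW s0).
rewrite (tonelli_circle (measurable_lnk2 B s cX) f0).
have cl t : rcont_at (fun z => ln (Num.max (normc (X z)) s)) (circle 0 r t).
  apply: rcont_ln; first by rewrite lt_max s0 orbT.
  by apply: rcont_max; exact: rcont_normc.
rewrite (@eq_cint _ _ (fun t => (2 * pi * (ln B + -1 *
    ln (Num.max (normc (X (circle 0 r t))) s)))%:E)); last first.
  by move=> t; rewrite /f /= lnk_circle // mulN1r.
have cl' t : rcont_at (fun z => -1 * ln (Num.max (normc (X z)) s)) (circle 0 r t).
  by apply: rcont_mul => //; exact: rcont_cst.
rewrite (@cint_circ_mean _ (fun z => 2 * pi * (ln B + -1 * ln (Num.max (normc (X z)) s))) r).
  rewrite circ_meanZ ?circ_meanD ?circ_mean_cst ?circ_meanZ ?mulN1r //.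
    by move=> t; exact: rcont_cst.
  by move=> t; apply: rcont_add => //; exact: rcont_cst.
move=> t; apply: rcont_mul; first exact: rcont_cst.
by apply: rcont_add => //; exact: rcont_cst.
Qed.

Lemma lnk_mul B B' d (e : R) : 0 <= d -> 0 < e ->
  lnk B (d * e) = (lnk B' d + (ln B - ln B' - ln e)%:E)%E.
Proof.
rewrite le_eqVlt => /predU1P[<- e0|d0 e0]; first by rewrite mul0r /lnk eqxx addye.
rewrite !lnkE ?mulr_gt0 // lnM ?posrE // -EFinD; congr (_%:E); ring.
Qed.

(** Here [ln |N|] is the real part of an analytic function. *)
Lemma jensen_nonzero N B r : hol N -> (forall z, normc z < 1 -> N z != 0) ->
  0 < r -> r < 1 ->
  cint (fun t => lnk B (normc (N (circle 0 r t)))) = (2 * pi * (ln B - ln (normc (N 0))))%:E.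
Proof.
move=> hN nz r0 r1; have inD t : normc (circle 0 r t) < 1 by apply: circle_in_disc => //; exact: ltW.
have cl t : rcont_at (fun z => ln (normc (N z))) (circle 0 r t).
  by apply: rcont_ln_normc; [exact: hol_cont|exact: nz].
have cl' t : rcont_at (fun z => -1 * ln (normc (N z))) (circle 0 r t).
  by apply: rcont_mul => //; exact: rcont_cst.
rewrite (@eq_cint _ _ (fun t => (ln B + -1 * ln (normc (N (circle 0 r t))))%:E)).
  rewrite (@cint_circ_mean _ (fun z => ln B + -1 * ln (normc (N z))) r).
    rewrite circ_meanD // ?circ_mean_cst ?circ_meanZ ?circ_mean_ln // ?mulN1r //.
    by move=> t; exact: rcont_cst.
  by move=> t; apply: rcont_add => //; exact: rcont_cst.
by move=> t; rewrite lnkE ?normc_gt0 ?nz // mulN1r.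
Qed.

(** The zero contributes [ln |circle 0 r t - zeta|], whose mean is
    [ln (max |zeta| r)] by [lnk_circle]. *)
Lemma jensen_zero Y zeta B r : hol Y -> (forall z, normc z < 1 -> Y z != 0) ->
  0 < r -> r < 1 ->
  cint (fun t => lnk B (normc ((circle 0 r t - zeta) * Y (circle 0 r t)))) =
  (2 * pi * (ln B - ln (normc (Y 0)) - ln (Num.max (normc zeta) r)))%:E.
Proof.
move=> hY nz r0 r1; set B1 := normc zeta + r.
have inD t : normc (circle 0 r t) < 1 by apply: circle_in_disc => //; exact: ltW.
have cl t : rcont_at (fun z => ln (normc (Y z))) (circle 0 r t).
  by apply: rcont_ln_normc; [exact: hol_cont|exact: nz].
have cl' t : rcont_at (fun z => -1 * ln (normc (Y z))) (circle 0 r t).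
  by apply: rcont_mul => //; exact: rcont_cst.
have cl2 t : rcont_at (fun z => (ln B - ln B1) + -1 * ln (normc (Y z))) (circle 0 r t).
  by apply: rcont_add => //; exact: rcont_cst.
pose e t := normc (zeta - circle 0 r t).
rewrite (@eq_cint _ _ (fun t => lnk B1 (e t) +
    ((ln B - ln B1) + -1 * ln (normc (Y (circle 0 r t))))%:E)%E); last first.
  move=> t; rewrite normcM (lnk_mul B B1) ?normc_ge0 ?normc_gt0 ?nz //.
  by rewrite normc_sub mulN1r.
have v1 := lnk_circle (r0 : 0 < r) (lexx (normc zeta + r)); rewrite -/B1 in v1.
have v2 := cint_circ_mean cl2.
rewrite /cint integralD //=.
- rewrite -/(cint _) [X in (X + _)%E]v1 -/(cint _) [X in (_ + X)%E]v2 -EFinD; congr (_%:E).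
  rewrite circ_meanD // ?circ_mean_cst ?circ_meanZ ?circ_mean_ln //; last first.
    by move=> t; exact: rcont_cst.
  ring.
- apply/integrableP; split; first by apply: measurable_funTS; exact: measurable_lnk_circle.
  rewrite (@eq_integral _ _ _ mu _ (fun t => lnk B1 (normc (zeta - circle 0 r t)))).
    by rewrite -/(cint _) v1 ltry.
  move=> t _; rewrite gee0_abs //; apply: lnk_ge0; first exact: normc_ge0.
  by apply: le_trans (normcB _ _) _; rewrite normc_circle0 ?(ltW r0).
by apply: cont_seg_integrable; exact: rcont_circle_seg cl2.
Qed.

End Jensen.


(** * Functions omitting a value *)

Section Koebe.
Variable R : realType.
Implicit Types (a z w c zeta : R[i]) (r s t v h B d : R) (U V : R[i] -> R)
  (psi N X Y : R[i] -> R[i]).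
Notation mu := (@lebesgue_measure R).

Lemma measurable_cint (f : R * R -> \bar R) : measurable_fun setT f ->
  (forall p, (0 <= f p)%E) -> measurable_fun setT (fun u => cint (fun t => f (u, t))).
Proof.
move=> mf f0; pose D := `[0, 2 * pi]%classic : set R.
have mD : measurable ([set: R] `*` D) by apply: measurableX => //; exact: measurable_itv.
pose g := f \_ ([set: R] `*` D).
have mg : measurable_fun setT g.
  by apply/(measurable_restrictT _ mD); exact: measurable_funTS.
have g0 p : (0 <= g p)%E by rewrite /g patchE; case: ifP.
have := @measurable_fun_fubini_tonelli_F _ _ _ _ R mu g mg g0.
congr (measurable_fun _ _); apply/funext => u; rewrite /fubini_F /cint [RHS]integral_mkcond.
apply: eq_integral => t _; rewrite /g !patchE -/D.
have -> : ((u, t) \in [set: R] `*` D) = (t \in D).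
  by apply/idP/idP => [/set_mem[_ tD]|/set_mem tD]; apply: mem_set; [exact: tD|split].
by [].
Qed.

Lemma lnk_add B r d (e : R) : 0 < B -> 0 < r -> 0 <= d -> 0 <= e ->
  (lnk B d + lnk B e)%E = lnk (B * B * r) (d * e * r).
Proof.
move=> B0 r0; rewrite le_eqVlt => /predU1P[<- _|d0].
  by rewrite !mul0r {1 3}/lnk eqxx addye //; rewrite /lnk; case: ifP.
rewrite le_eqVlt => /predU1P[<-|e0].
  by rewrite mulr0 mul0r {2 3}/lnk eqxx addey // lnkE.
rewrite !lnkE ?mulr_gt0 // -EFinD !lnM ?posrE ?mulr_gt0 //; congr (_%:E); ring.
Qed.

(** If the product of [X - w] and [X' - w] has at most one zero for each [w] on a
    circle, its logarithmic means are controlled by Jensen's formula; averaging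
    over [w] transfers the monotonicity to truncated logarithms. *)
Lemma trunc_ln_mono (X X' : R[i] -> R[i]) r1 r2 s B (F : R -> R -> R) : 0 < s -> 0 < r1 -> 0 < r2 -> 0 < B ->
  (forall r, r \in [:: r1; r2] -> forall t, [/\ cont_at X (circle 0 r t),
     cont_at X' (circle 0 r t), normc (X (circle 0 r t)) + s <= B &
     normc (X' (circle 0 r t)) + s <= B]) ->
  (forall r, r \in [:: r1; r2] -> forall u,
     cint (fun t => lnk (B * B * r) (normc (X (circle 0 r t) - circle 0 s u) *
       normc (X' (circle 0 r t) - circle 0 s u) * r)) = (F r u)%:E) ->
  (forall u, F r1 u <= F r2 u) ->
  circ_mean (fun z => ln (Num.max (normc (X z)) s)) 0 r2 +
  circ_mean (fun z => ln (Num.max (normc (X' z)) s)) 0 r2 <=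
  circ_mean (fun z => ln (Num.max (normc (X z)) s)) 0 r1 +
  circ_mean (fun z => ln (Num.max (normc (X' z)) s)) 0 r1.
Proof.
move=> s0 r10 r20 B0 HX HF F12.
pose G Z r u := cint (fun t => lnk B (normc (Z (circle 0 r t) - circle 0 s u))).
have G0 Z r u : (forall t, normc (Z (circle 0 r t)) + s <= B) -> (0 <= G Z r u)%E.
  move=> ZB; apply: cint_ge0 => t; apply: lnk_ge0; first exact: normc_ge0.
  by apply: le_trans (normcB _ _) _; rewrite normc_circle0 ?(ltW s0).
have mG Z r : (forall t, cont_at Z (circle 0 r t)) ->
    (forall t, normc (Z (circle 0 r t)) + s <= B) -> measurable_fun setT (G Z r).
  move=> cZ ZB; apply: (measurable_cint (measurable_lnk2 B s cZ)) => p.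
  apply: lnk_ge0; first exact: normc_ge0.
  by apply: le_trans (normcB _ _) _; rewrite normc_circle0 ?(ltW s0).
have sumG r u : r \in [:: r1; r2] -> 0 < r -> (G X r u + G X' r u = (F r u)%:E)%E.
  move=> rr r0; rewrite -HF // /G /cint -ge0_integralD //=.
  - apply: eq_integral => t _; rewrite (lnk_add B0 r0) ?normc_ge0 //.
  - move=> t _; apply: lnk_ge0; first exact: normc_ge0.
    by apply: le_trans (normcB _ _) _; rewrite normc_circle0 ?(ltW s0) //; have [] := HX r rr t.
  - apply: measurable_funTS; apply: measurableT_comp; first exact: measurable_lnk.
    apply: (@measurable_circle _ (fun z => normc (X z - circle 0 s u))) => t.
    apply: rcont_normc; apply: cont_sub; last exact: cont_cst.
    by have [] := HX r rr t.
  - move=> t _; apply: lnk_ge0; first exact: normc_ge0.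
    by apply: le_trans (normcB _ _) _; rewrite normc_circle0 ?(ltW s0) //; have [] := HX r rr t.
  - apply: measurable_funTS; apply: measurableT_comp; first exact: measurable_lnk.
    apply: (@measurable_circle _ (fun z => normc (X' z - circle 0 s u))) => t.
    apply: rcont_normc; apply: cont_sub; last exact: cont_cst.
    by have [] := HX r rr t.
pose mX Z r := circ_mean (fun z => ln (Num.max (normc (Z z)) s)) 0 r.
have total r : r \in [:: r1; r2] -> 0 < r ->
    cint (fun u => G X r u + G X' r u)%E =
    (2 * pi * (2 * pi * (ln B - mX X r)) + 2 * pi * (2 * pi * (ln B - mX X' r)))%:E.
  move=> rr r0; have H t := HX r rr t.
  rewrite /cint ge0_integralD //=.
  - rewrite EFinD -(lnk_swap s0) => [|t|t]; try by have [] := H t.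
    by rewrite -(lnk_swap s0) => [//|t|t]; have [] := H t.
  - by move=> u _; apply: G0 => t; have [] := H t.
  - by apply: measurable_funTS; apply: mG => t; have [] := H t.
  - by move=> u _; apply: G0 => t; have [] := H t.
  - by apply: measurable_funTS; apply: mG => t; have [] := H t.
have i1 : r1 \in [:: r1; r2] by rewrite inE eqxx.
have i2 : r2 \in [:: r1; r2] by rewrite !inE eqxx orbT.
have : (cint (fun u => G X r1 u + G X' r1 u) <= cint (fun u => G X r2 u + G X' r2 u))%E.
  apply: le_cint.
  - move=> u; apply: adde_ge0; apply: G0 => t; by have [] := HX r1 i1 t.
  - by apply: emeasurable_funD; apply: mG => t; have [] := HX r1 i1 t.
  - by apply: emeasurable_funD; apply: mG => t; have [] := HX r2 i2 t.
  by move=> u; rewrite !sumG // lee_fin.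
rewrite (total _ i1 r10) (total _ i2 r20) lee_fin.
have key (p x1 x2 y1 y2 : R) : 0 < p ->
    p * (p * x1) + p * (p * x2) <= p * (p * y1) + p * (p * y2) -> x1 + x2 <= y1 + y2.
  by move=> p0; rewrite -!mulrDr !ler_pM2l.
move=> /(key _ _ _ _ _ (pi2_gt0 R)); rewrite -!/(mX _ _).
by move: (mX X r1) (mX X r2) (mX X' r1) (mX X' r2) (ln B); clear; move=> *; lra.
Qed.

Lemma one_zero psi q : hol psi -> inj_disc psi ->
  (forall z, normc z < 1 -> psi z - q != 0) \/
  exists zeta, [/\ normc zeta < 1, psi zeta = q &
    forall z, psi z - q = (z - zeta) * ddiff psi zeta z].
Proof.
move=> h inj; have [[zeta z1 E]|H] := pselect (exists2 zeta, normc zeta < 1 & psi zeta = q).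
  right; exists zeta; split => // z; rewrite -E {1}(ddiffE psi zeta z).
  by rewrite addrC addKr.
by left => z z1; rewrite subr_eq0; apply/negP => /eqP E; apply: H; exists z.
Qed.

Lemma ln_max_mono (x y z : R) : 0 < y -> y <= z -> ln (Num.max x z) - ln (Num.max x y) <= ln z - ln y.
Proof.
move=> y0 yz; have z0 := lt_le_trans y0 yz.
have lyz : ln y <= ln z by rewrite ler_ln.
case: (leP x y) => xy; first by rewrite max_r ?(le_trans xy).
have x0 : 0 < x := lt_trans y0 xy.
have lyx : ln y <= ln x by rewrite ler_ln // ltW.
case: (leP x z) => xz; rewrite ?subrr ?subr_ge0 //; lra.
Qed.

Section Transform.
Variables (psi : R[i] -> R[i]) (c : R[i]).
Hypothesis hpsi : hol psi.
Hypothesis psi_inj : inj_disc psi.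
Hypothesis psi0 : psi 0 = 0.
Hypothesis omit : forall z, normc z < 1 -> psi z != c.

Let n0 : normc (0 : R[i]) < 1. Proof. by rewrite normc0. Qed.

Let c0 : c != 0. Proof. by rewrite -psi0 eq_sym omit. Qed.

Let Psi := ddiff psi 0.

Let hPsi : hol Psi. Proof. exact: hol_ddiff. Qed.

Let Psi_neq0 z : normc z < 1 -> Psi z != 0.
Proof. by move=> z1; exact: ddiff_neq0. Qed.

Let psiE z : psi z = z * Psi z.
Proof. by rewrite (ddiffE psi 0 z) psi0 add0r subr0. Qed.

Let psi_neq0 z : normc z < 1 -> z != 0 -> psi z != 0.
Proof. by move=> z1 z0; rewrite psiE mulf_neq0 // Psi_neq0. Qed.

(** With [sg] the square root of [1 - psi / c], the Cayley transform
    [tau = (1 - sg) / (1 + sg) = (psi / c) / (1 + sg)^2] satisfies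
    [tau + 1 / tau = 4 c / psi - 2]: [tau] and [1 / tau] together take each value as
    often as [psi] does. Here [tau1 z = tau z / z]. *)
Lemma bieberbach_eilenberg : exists tau1, [/\ hol tau1,
  forall z, normc z < 1 -> tau1 z != 0, tau1 0 = dv psi 0 / (4 * c) &
  forall z w, normc z < 1 -> z != 0 ->
    (z * tau1 z - w) * ((z * tau1 z)^-1 - w) * psi z = (1 + w) ^+ 2 * psi z - 4 * c * w].
Proof.
have [||L hL LE] := @hol_log _ (fun z => 1 - psi z / c).
- apply: hol_sub; first exact: hol_cst.
  by apply: hol_mul => //; exact: hol_cst.
- move=> z z1; rewrite subr_eq0; apply/negP => /eqP E.
  have := omit z1; rewrite -[psi z](divfK c0) -E mul1r eqxx //.
have two0 : 2 != 0 :> R[i] by rewrite pnatr_eq0.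
pose sg z := cexp ((L z - L 0) / 2).
have sg2 z : normc z < 1 -> sg z ^+ 2 = 1 - psi z / c.
  move=> z1; rewrite /sg -cexpMn -[_ *+ 2]mulr_natr divfK // cexpD cexpN -LE // -LE //.
  by rewrite psi0 mul0r subr0 divr1.
have sg0 : sg 0 = 1 by rewrite /sg subrr mul0r cexp0.
have hsg : hol sg.
  apply: hol_cexp; apply: hol_mul; last exact: hol_cst.
  by apply: hol_sub => //; exact: hol_cst.
have psic z : normc z < 1 -> psi z = c * (1 - sg z ^+ 2).
  by move=> z1; rewrite sg2 // opprB addrC subrK mulrC divfK.
have sg1 z : normc z < 1 -> 1 + sg z != 0.
  move=> z1; apply/negP => /eqP E.
  have sgz : sg z = -1 by apply/eqP; rewrite -addr_eq0 addrC E.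
  have pz : psi z = psi 0 by rewrite psi0 psic // sgz sqrrN expr1n subrr mulr0.
  by move: sgz; rewrite (psi_inj z1 n0 pz) sg0 => /eqP; rewrite -addr_eq0 (negbTE two0).
have four0 : 4 != 0 :> R[i] by rewrite pnatr_eq0.
exists (fun z => Psi z / (c * (1 + sg z) ^+ 2)); split.
- apply: hol_mul => //; apply: hol_inv; last first.
    by move=> z z1; rewrite mulf_neq0 // expf_neq0 // sg1.
  apply: hol_scale; apply: hol_exp; apply: hol_add; [exact: hol_cst|exact: hsg].
- by move=> z z1; rewrite mulf_neq0 ?Psi_neq0 // invr_eq0 mulf_neq0 // expf_neq0 // sg1.
- rewrite sg0 {1}/Psi /ddiff eqxx; congr (_ / _); ring.
move=> z w z1 z0; have P0 := psi_neq0 z1 z0; have s1 := sg1 _ z1; have p := psic _ z1.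
have tauE : z * (Psi z / (c * (1 + sg z) ^+ 2)) = (1 - sg z) / (1 + sg z).
  by rewrite mulrA -psiE p; field; rewrite c0 s1.
have s2 : 1 - sg z != 0.
  apply/negP => /eqP E; move: P0; rewrite p.
  have -> : 1 - sg z ^+ 2 = (1 - sg z) * (1 + sg z) by ring.
  by rewrite E mul0r mulr0 eqxx.
rewrite tauE p; field; rewrite s1 s2 //.
Qed.

(** As [psi] is injective, the numerator has at most one zero; the resulting term
    [ln (max |zeta| r)] of Jensen's formula grows at most like [ln r]. *)
Lemma koebe_jensen w : w != 0 -> exists F : R -> R,
  (forall r1 r2, 0 < r1 -> r1 <= r2 -> F r2 - F r1 <= ln r2 - ln r1) /\
  forall r B, 0 < r -> r < 1 ->
  cint (fun t => lnk B (normc (((1 + w) ^+ 2 * psi (circle 0 r t) - 4 * c * w) /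
     Psi (circle 0 r t)))) = (2 * pi * (ln B - F r))%:E.
Proof.
move=> w0; have four0 : 4 != 0 :> R[i] by rewrite pnatr_eq0.
have nonvan N : hol N -> (forall z, normc z < 1 -> N z != 0) ->
    (forall z, normc z < 1 -> ((1 + w) ^+ 2 * psi z - 4 * c * w) / Psi z = N z) ->
    exists F : R -> R,
  (forall r1 r2, 0 < r1 -> r1 <= r2 -> F r2 - F r1 <= ln r2 - ln r1) /\
  forall r B, 0 < r -> r < 1 ->
  cint (fun t => lnk B (normc (((1 + w) ^+ 2 * psi (circle 0 r t) - 4 * c * w) /
     Psi (circle 0 r t)))) = (2 * pi * (ln B - F r))%:E.
  move=> hN nz EN; exists (fun=> ln (normc (N 0))); split.
    by move=> r1 r2 r10 r12; rewrite subrr subr_ge0 ler_ln ?posrE // (lt_le_trans r10).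
  move=> r B r0 r1; rewrite -(jensen_nonzero B hN nz r0 r1); apply: eq_cint => t.
  by rewrite EN // circle_in_disc // ltW.
have [w1|w1] := eqVneq (1 + w) 0.
  apply: (nonvan (fun z => - (4 * c * w) / Psi z)).
  - by apply: hol_mul; [exact: hol_cst|exact: hol_inv].
  - move=> z z1; rewrite mulf_neq0 ?invr_eq0 ?Psi_neq0 // oppr_eq0.
    by rewrite !mulf_neq0.
  by move=> z _; rewrite w1 expr0n /= mul0r sub0r.
have w12 : (1 + w) ^+ 2 != 0 by rewrite expf_neq0.
pose q := 4 * c * w / (1 + w) ^+ 2.
have qE z : (1 + w) ^+ 2 * psi z - 4 * c * w = (1 + w) ^+ 2 * (psi z - q).
  by rewrite mulrBr; congr (_ - _); rewrite /q mulrCA divff // mulr1.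
have [nz|[zeta [zeta1 _ Ez]]] := one_zero q hpsi psi_inj.
  apply: (nonvan (fun z => (1 + w) ^+ 2 * (psi z - q) / Psi z)).
  - apply: hol_mul; last exact: hol_inv.
    by apply: hol_scale; apply: hol_sub => //; exact: hol_cst.
  - by move=> z z1; rewrite !mulf_neq0 ?invr_eq0 ?Psi_neq0 ?nz.
  by move=> z _; rewrite qE.
pose Y z := (1 + w) ^+ 2 * ddiff psi zeta z / Psi z.
have hY : hol Y.
  by apply: hol_mul; [apply: hol_scale; exact: hol_ddiff|exact: hol_inv].
have Ynz z : normc z < 1 -> Y z != 0.
  by move=> z1; rewrite !mulf_neq0 ?invr_eq0 ?Psi_neq0 // ddiff_neq0.
exists (fun r => ln (normc (Y 0)) + ln (Num.max (normc zeta) r)); split.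
  move=> r1 r2 r10 r12; have := ln_max_mono (normc zeta) r10 r12; lra.
move=> r B r0 r1; rewrite opprD addrA -(jensen_zero zeta B hY Ynz r0 r1).
apply: eq_cint => t; congr (lnk B (normc _)).
by rewrite qE Ez /Y; ring.
Qed.

End Transform.
End Koebe.


(** * Koebe's one-quarter theorem *)

Section KoebeQuarter.
Variable R : realType.
Implicit Types (a z w c zeta : R[i]) (r s t v h B d : R) (U V : R[i] -> R)
  (phi psi N X Y : R[i] -> R[i]).

(** A Riemann sum of the identity [t ^ 2 = int 2 (t - v)^+ dv]. *)
Definition layer h n t : R := \sum_(j < n) 2 * h * Num.max (t - h *+ j) 0.

Lemma layer_bounds h n t : 0 <= h -> 0 <= t -> t <= h *+ n ->
  t ^+ 2 <= layer h n t <= t ^+ 2 + 2 * h * t.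
Proof.
move=> h0; elim: n t => [|n IH] t t0 tn.
  have -> : t = 0 by apply/le_anti; rewrite t0 -[X in _ <= X](mulr0n h) tn.
  by rewrite /layer big_ord0 expr0n /= mulr0 addr0 lexx.
rewrite /layer big_ord_recl /= mulr0n subr0 max_l //.
have -> : \sum_(j < n) 2 * h * Num.max (t - h *+ bump 0 j) 0 = layer h n (t - h).
  apply: eq_bigr => j _; congr (_ * Num.max _ _).
  by rewrite /bump /= mulrS opprD addrA.
have [th|ht] := leP h t.
  have := IH (t - h); rewrite subr_ge0 => /(_ th) {}IH.
  have /IH : t - h <= h *+ n by rewrite mulrS in tn; lra.
  by rewrite !expr2 => /andP[? ?]; apply/andP; split; nra.
have -> : layer h n (t - h) = 0.
  rewrite /layer big1 // => j _; rewrite max_r ?mulr0 //.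
  have : 0 <= h *+ j by rewrite mulrn_wge0.
  lra.
by rewrite addr0 expr2; apply/andP; split; nra.
Qed.

(** Truncations at all levels control the mean of the square. *)
Lemma layer_circ_mean U h n r1 r2 : 0 <= h ->
  (forall t, rcont_at U (circle 0 r1 t)) -> (forall t, rcont_at U (circle 0 r2 t)) ->
  (forall v, 0 <= v -> circ_mean (fun z => Num.max (U z - v) 0) 0 r2 <=
                       circ_mean (fun z => Num.max (U z - v) 0) 0 r1) ->
  circ_mean (fun z => layer h n (U z)) 0 r2 <= circ_mean (fun z => layer h n (U z)) 0 r1.
Proof.
move=> h0 c1 c2 H; have cl v k r : (forall t, rcont_at U (circle 0 r t)) ->
    forall t, rcont_at (fun z => k * Num.max (U z - v) 0) (circle 0 r t).
  move=> cU t; apply: rcont_mul; first exact: rcont_cst.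
  by apply: rcont_max; apply: rcont_add => //; exact: rcont_cst.
have cm v r : (forall t, rcont_at U (circle 0 r t)) ->
    forall t, rcont_at (fun z => Num.max (U z - v) 0) (circle 0 r t).
  by move=> cU t; apply: rcont_max; apply: rcont_add => //; exact: rcont_cst.
have cs r m : (forall t, rcont_at U (circle 0 r t)) ->
    forall t, rcont_at (fun z => layer h m (U z)) (circle 0 r t).
  by move=> cU t; apply: rcont_sum => j; exact: cl.
elim: n => [|n IH].
  have E0 r : circ_mean (fun z => layer h 0 (U z)) 0 r = circ_mean (fun=> 0) 0 r.
    by apply: eq_circ_mean => t; rewrite /layer big_ord0.
  by rewrite !E0 !circ_mean_cst.
have E z : layer h n.+1 (U z) = layer h n (U z) + 2 * h * Num.max (U z - h *+ n) 0.
  by rewrite /layer big_ord_recr.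
have EE r : circ_mean (fun z => layer h n.+1 (U z)) 0 r =
    circ_mean (fun z => layer h n (U z) + 2 * h * Num.max (U z - h *+ n) 0) 0 r.
  by apply: eq_circ_mean => t; exact: E.
rewrite !EE !circ_meanD; try by move=> t; first [exact: cs|exact: cl].
apply: lerD => //; rewrite !circ_meanZ; try exact: cm.
by rewrite ler_wpM2l ?mulr_ge0 // H // mulrn_wge0.
Qed.

(** As [ln (max x s) + ln (max (1 / x) s) = 2 v + (|ln x| - v)^+] for [s = e^v], this is
    the monotonicity of truncated logarithms for [tau] and [1 / tau] on the circle
    [|w| = s]. The factor [r] there compensates the growth of the zero term. *)
Lemma koebe_mono psi c (T : R[i] -> R[i]) r1 r2 v : hol psi -> inj_disc psi -> psi 0 = 0 ->
  (forall z, normc z < 1 -> psi z != c) ->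
  hol T -> (forall z, normc z < 1 -> T z != 0) ->
  (forall z w, normc z < 1 -> z != 0 -> (z * T z - w) * ((z * T z)^-1 - w) * psi z =
     (1 + w) ^+ 2 * psi z - 4 * c * w) ->
  0 < r1 -> r1 < r2 -> r2 < 1 -> 0 <= v ->
  circ_mean (fun z => Num.max (`|ln (normc (z * T z))| - v) 0) 0 r2 <=
  circ_mean (fun z => Num.max (`|ln (normc (z * T z))| - v) 0) 0 r1.
Proof.
move=> hpsi inj psi0 omit hT nzT HT r10 r12 r21 v0; set s := expR v.
have s0 : 0 < s by exact: expR_gt0.
pose X z := z * T z; pose X' z := (z * T z)^-1.
have r20 := lt_trans r10 r12.
have hX : hol X by apply: hol_mul => //; exact: hol_id.
have Xnz z : normc z < 1 -> z != 0 -> X z != 0 by move=> z1 z0; rewrite mulf_neq0 // nzT.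
have cX z : normc z < 1 -> cont_at X z by exact: hol_cont.
have cX' z : normc z < 1 -> z != 0 -> cont_at X' z.
  by move=> z1 z0; apply: cont_inv; [exact: cX|exact: Xnz].
have [|M M0 HM] := @closed_disc_bounded _ X 0 r2 (ltW r20).
  by move=> z; rewrite subr0 => zr; apply: cX; lra.
have [|M' M'0 HM'] := @closed_disc_bounded _ (fun z => (T z)^-1) 0 r2 (ltW r20).
  by move=> z; rewrite subr0 => zr; apply: hol_cont; [exact: hol_inv|lra].
pose B := M + M' / r1 + s.
have B0 : 0 < B by rewrite !addr_gt0 // divr_gt0.
have inr r : r \in [:: r1; r2] -> [/\ 0 < r, r < 1, r1 <= r & r <= r2].
  by rewrite !inE => /orP[] /eqP ->; split => //; lra.
have circ r t : 0 < r -> r < 1 -> [/\ normc (circle 0 r t) < 1, circle 0 r t != 0 & normc (circle 0 r t) = r].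
  move=> r0 r1'; rewrite normc_circle0 ?(ltW r0) //; split => //; exact: circle_neq0.
have psiE z : psi z = z * ddiff psi 0 z by rewrite (ddiffE psi 0 z) psi0 add0r subr0.
have D0 z : normc z < 1 -> ddiff psi 0 z != 0.
  by move=> z1; apply: ddiff_neq0 => //; rewrite normc0.
have HF u : exists F : R -> R,
  (forall r1 r2, 0 < r1 -> r1 <= r2 -> F r2 - F r1 <= ln r2 - ln r1) /\
  forall r B, 0 < r -> r < 1 ->
  cint (fun t => lnk B (normc (((1 + circle 0 s u) ^+ 2 * psi (circle 0 r t) -
    4 * c * circle 0 s u) / ddiff psi 0 (circle 0 r t)))) = (2 * pi * (ln B - F r))%:E.
  by apply: (koebe_jensen hpsi inj psi0 omit); exact: circle_neq0.
have [F HFF] := choice HF.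
have := @trunc_ln_mono _ X X' r1 r2 s B (fun r u => 2 * pi * (ln (B * B * r) - F u r))
  s0 r10 r20 B0.
have H1 r : r \in [:: r1; r2] -> forall t, [/\ cont_at X (circle 0 r t),
     cont_at X' (circle 0 r t), normc (X (circle 0 r t)) + s <= B &
     normc (X' (circle 0 r t)) + s <= B].
  move=> /inr[r0 r1' rl rg] t; have [z1 z0 zr] := circ r t r0 r1'; split.
  - exact: cX.
  - exact: cX'.
  - have := HM (circle 0 r t); rewrite subr0 zr => /(_ rg).
    have : 0 <= M' / r1 by rewrite divr_ge0 // ltW.
    rewrite /B; lra.
  have := HM' (circle 0 r t); rewrite subr0 zr => /(_ rg) A.
  have : normc (X' (circle 0 r t)) <= M' / r1.
    rewrite /X' invfM normcM normcV zr mulrC ler_pM ?invr_ge0 ?normc_ge0 ?(ltW r0) //.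
    by rewrite lef_pV2 // posrE.
  rewrite /B; lra.
have H2 r : r \in [:: r1; r2] -> forall u,
     cint (fun t => lnk (B * B * r) (normc (X (circle 0 r t) - circle 0 s u) *
       normc (X' (circle 0 r t) - circle 0 s u) * r)) = (2 * pi * (ln (B * B * r) - F u r))%:E.
  move=> /inr[r0 r1' rl rg] u; have [_ HFu] := HFF u; rewrite -HFu //.
  apply: eq_cint => t; congr (lnk _ _); have [z1 z0 zr] := circ r t r0 r1'.
  rewrite -HT // -/(X _) -/(X' _); have := D0 _ z1; move: zr; rewrite [psi _]psiE.
  set z := circle 0 r t => <- Dz; rewrite -!normcM; congr (normc _).
  by rewrite mulrA mulfK.
have H3 u : 2 * pi * (ln (B * B * r1) - F u r1) <= 2 * pi * (ln (B * B * r2) - F u r2).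
  rewrite ler_pM2l ?pi2_gt0 //; have [/(_ _ _ r10 (ltW r12))] := HFF u.
  by rewrite !lnM ?posrE ?mulr_gt0 //; lra.
move=> /(_ H1 H2 H3).
have E r : 0 < r -> r < 1 ->
    circ_mean (fun z => ln (Num.max (normc (X z)) s)) 0 r +
    circ_mean (fun z => ln (Num.max (normc (X' z)) s)) 0 r =
    2 * v + circ_mean (fun z => Num.max (`|ln (normc (z * T z))| - v) 0) 0 r.
  move=> r0 r1'; have C t := circ r t r0 r1'.
  have c1 t : rcont_at (fun z => ln (Num.max (normc (X z)) s)) (circle 0 r t).
    have [z1 z0 zr] := C t; apply: rcont_ln; first by rewrite lt_max s0 orbT.
    by apply: rcont_max; apply: rcont_normc; exact: cX.
  have c2 t : rcont_at (fun z => ln (Num.max (normc (X' z)) s)) (circle 0 r t).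
    have [z1 z0 zr] := C t; apply: rcont_ln; first by rewrite lt_max s0 orbT.
    by apply: rcont_max; apply: rcont_normc; exact: cX'.
  have c3 t : rcont_at (fun z => Num.max (`|ln (normc (z * T z))| - v) 0) (circle 0 r t).
    have [z1 z0 zr] := C t; apply: rcont_max; apply: rcont_add; last exact: rcont_cst.
    apply: (@rcont_comp _ (@Num.norm _ R^o)); last exact: norm_continuous.
    by apply: rcont_ln_normc; [exact: cX|exact: Xnz].
  rewrite -circ_meanD // -[2 * v](@circ_mean_cst _ _ 0 r) -circ_meanD //; last first.
    by move=> t; exact: rcont_cst.
  apply: eq_circ_mean => t; have [z1 z0 zr] := C t.
  have x0 : 0 < normc (X (circle 0 r t)) by rewrite normc_gt0 Xnz.
  rewrite /X' -/(X _) normcV; set x := normc _ in x0 *.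
  have lnmax y : 0 < y -> ln (Num.max y s) = Num.max (ln y) v.
    move=> y0; case: (leP y s) => ys.
      by rewrite max_r /s ?expRK // -[v]expRK ler_ln ?posrE.
    by rewrite max_l // -[v]expRK ler_ln ?posrE // ltW.
  rewrite !lnmax ?invr_gt0 // lnV ?posrE //.
  set y := ln x; clear -v0 y.
  have [? ?] : y <= `|y| /\ - y <= `|y| by split; [exact: ler_norm|rewrite -normrN ler_norm].
  have [?|?] : `|y| = y \/ `|y| = - y by case: (ler0P y); [right|left].
    case: (leP y v) => ?; case: (leP (- y) v) => ?; case: (leP (`|y| - v) 0) => ?; lra.
  case: (leP y v) => ?; case: (leP (- y) v) => ?; case: (leP (`|y| - v) 0) => ?; lra.
by rewrite !E ?lerD2l // ?(lt_trans r12) // (lt_trans r10).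
Qed.

(** Write [ln |tau z| = ln |z| + Re (L z)]. The means of [ln^2 |tau|] decrease with the
    radius [r] while those of [(Re L)^2] increase, so [t^2 + 2 t Re (L 0)] is
    nonincreasing in [t = ln r < 0]; near [t = 0] this forces [Re (L 0) <= 0], that is
    [|tau1 0| <= 1]. *)
Lemma koebe_quarter psi c : hol psi -> inj_disc psi -> psi 0 = 0 ->
  (forall z, normc z < 1 -> psi z != c) -> normc (dv psi 0) <= 4 * normc c.
Proof.
move=> hpsi inj psi0 omit.
have n0 : normc (0 : R[i]) < 1 by rewrite normc0.
have [T [hT nzT T0 HT]] := bieberbach_eilenberg hpsi inj psi0 omit.
have c0 : c != 0 by rewrite -psi0 eq_sym omit.
have [L hL LE] := hol_log hT nzT.
set u0 := complex.Re (L 0).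
pose U z := `|ln (normc (z * T z))|.
have cU z : normc z < 1 -> z != 0 -> rcont_at U z.
  move=> z1 z0; apply: (@rcont_comp _ (@Num.norm _ R^o)); last exact: norm_continuous.
  apply: rcont_ln_normc; last by rewrite mulf_neq0 // nzT.
  by apply: cont_mul; [exact: cont_id|exact: hol_cont].
have circ r t : 0 < r -> r < 1 -> [/\ normc (circle 0 r t) < 1, circle 0 r t != 0 & normc (circle 0 r t) = r].
  move=> r0 r1'; rewrite normc_circle0 ?(ltW r0) //; split => //; exact: circle_neq0.
have mono2 r1 r2 : 0 < r1 -> r1 < r2 -> r2 < 1 ->
    circ_mean (fun z => U z ^+ 2) 0 r2 <= circ_mean (fun z => U z ^+ 2) 0 r1.
  move=> r10 r12 r21; have r20 := lt_trans r10 r12; have r11 := lt_trans r12 r21.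
  have c1 t : rcont_at U (circle 0 r1 t) by have [? ? _] := circ r1 t r10 r11; exact: cU.
  have c2 t : rcont_at U (circle 0 r2 t) by have [? ? _] := circ r2 t r20 r21; exact: cU.
  have [M HM] : exists M, forall r t, r \in [:: r1; r2] -> U (circle 0 r t) <= M.
    have bd r : (forall t, rcont_at U (circle 0 r t)) -> exists M, forall t, U (circle 0 r t) <= M.
      move=> cr; have [||m _ Hm] := @EVT_max R (fun t => U (circle 0 r t)) (- pi) pi.
      - by have := pi_ge0 R; lra.
      - by apply: continuous_in_subspaceT => x _; exact: rcont_circle.
      exists (U (circle 0 r m)) => t.
      have [t' t'pi E] := polarE (cis t); rewrite normc_cis mul1r in E.
      by rewrite /circle E; apply: Hm; rewrite in_itv.
    have [M1 H1] := bd _ c1; have [M2 H2] := bd _ c2.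
    exists (Num.max M1 M2) => r t; rewrite !inE => /orP[] /eqP ->.
      by rewrite le_max H1.
    by rewrite le_max H2 orbT.
  apply/ler_addgt0Pr => e e0.
  pose K := circ_mean U 0 r1; have K0 : 0 <= K.
    by rewrite /K -(circ_mean_cst 0 (0 : R[i]) r1); apply: le_circ_mean => // t; [exact: rcont_cst|exact: normr_ge0].
  pose h := e / (2 * (K + 1)).
  have h0 : 0 < h by rewrite divr_gt0 // mulr_gt0 // ltr_wpDl.
  pose n := (Num.truncn (M / h)).+1.
  have Mn : M <= h *+ n.
    by rewrite -[h *+ n]mulr_natl -ler_pdivrMr // ltW // truncnS_gt.
  have i1 : r1 \in [:: r1; r2] by rewrite inE eqxx.
  have i2 : r2 \in [:: r1; r2] by rewrite !inE eqxx orbT.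
  have lb r t : r \in [:: r1; r2] -> U (circle 0 r t) ^+ 2 <= layer h n (U (circle 0 r t)) <=
      U (circle 0 r t) ^+ 2 + 2 * h * U (circle 0 r t).
    by move=> ri; apply: layer_bounds; [exact: ltW|exact: normr_ge0|apply: le_trans Mn; exact: HM].
  have clay r : (forall t, rcont_at U (circle 0 r t)) ->
      forall t, rcont_at (fun z => layer h n (U z)) (circle 0 r t).
    move=> cr t; apply: rcont_sum => j; apply: rcont_mul; first exact: rcont_cst.
    by apply: rcont_max; apply: rcont_add => //; exact: rcont_cst.
  have csq r : (forall t, rcont_at U (circle 0 r t)) ->
      forall t, rcont_at (fun z => U z ^+ 2) (circle 0 r t) by move=> cr t; exact: rcont_exp.
  have chU t : rcont_at (fun z => 2 * h * U z) (circle 0 r1 t).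
    by apply: rcont_mul => //; exact: rcont_cst.
  apply: (@le_trans _ _ (circ_mean (fun z => layer h n (U z)) 0 r2)).
    by apply: le_circ_mean => [||t]; [exact: csq|exact: clay|have /andP[] := lb r2 t i2].
  apply: (@le_trans _ _ (circ_mean (fun z => layer h n (U z)) 0 r1)).
    apply: layer_circ_mean; [exact: ltW|exact: c1|exact: c2|].
    by move=> v v0; apply: (koebe_mono hpsi inj psi0 omit).
  apply: (@le_trans _ _ (circ_mean (fun z => U z ^+ 2 + 2 * h * U z) 0 r1)).
    apply: le_circ_mean => [||t]; [exact: clay| |by have /andP[] := lb r1 t i1].
    by move=> t; apply: rcont_add => //; exact: csq.
  rewrite circ_meanD //; last exact: csq.
  rewrite circ_meanZ // lerD2l -/K.
  have -> : 2 * h * K = e * (K / (K + 1)).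
    by rewrite /h; field; rewrite gt_eqF // ltr_wpDl.
  by rewrite ler_piMr ?(ltW e0) // ler_pdivrMr ?mul1r ?lerDl // ltr_wpDl.
pose A r := circ_mean (fun z => complex.Re (L z) ^+ 2) 0 r.
have sqE r : 0 < r -> r < 1 ->
    circ_mean (fun z => U z ^+ 2) 0 r = ln r ^+ 2 + 2 * ln r * u0 + A r.
  move=> r0 r1.
  have cL t : rcont_at (fun z => complex.Re (L z)) (circle 0 r t).
    by have [z1 _ _] := circ r t r0 r1; apply: rcont_Re; exact: hol_cont.
  have cL2 t : rcont_at (fun z => complex.Re (L z) ^+ 2) (circle 0 r t) by exact: rcont_exp.
  have cL1 t : rcont_at (fun z => 2 * ln r * complex.Re (L z)) (circle 0 r t).
    by apply: rcont_mul => //; exact: rcont_cst.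
  have cc t : rcont_at (fun z => ln r ^+ 2) (circle 0 r t) by exact: rcont_cst.
  rewrite /u0 -(hol_circ_mean_Re hL r0 r1) -circ_meanZ //.
  rewrite -[ln r ^+ 2](@circ_mean_cst _ _ (0 : R[i]) r) -circ_meanD // -circ_meanD //; last first.
    by move=> t; apply: rcont_add.
  apply: eq_circ_mean => t; have [z1 z0 zr] := circ r t r0 r1.
  rewrite /U real_normK ?num_real // normcM zr LE // normc_cexp lnM ?posrE ?expR_gt0 //.
  by rewrite expRK; ring.
have Amono r1 r2 : 0 < r1 -> r1 < r2 -> r2 < 1 -> A r1 <= A r2.
  move=> r10 r12 r21; have r20 := lt_trans r10 r12; have r11 := lt_trans r12 r21.
  have hL2 : hol (fun z => L z * L z) by exact: hol_mul.
  have AE r : 0 < r -> r < 1 -> A r = circ_mean (fun z => normc (L z) ^+ 2) 0 r / 2 +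
      complex.Re (L 0 * L 0) / 2.
    move=> r0 r1'.
    have cn t : rcont_at (fun z => normc (L z) ^+ 2) (circle 0 r t).
      by have [z1 _ _] := circ r t r0 r1'; exact: hol_rcont_sqr.
    have cR t : rcont_at (fun z => complex.Re (L z * L z)) (circle 0 r t).
      by have [z1 _ _] := circ r t r0 r1'; apply: rcont_Re; exact: hol_cont.
    rewrite -(hol_circ_mean_Re hL2 r0 r1') -mulrDl -circ_meanD // mulrC -circ_meanZ //.
      by apply: eq_circ_mean => t; rewrite sqr_normcE ReM; lra.
    by move=> t; apply: rcont_add.
  rewrite !AE // lerD2r ler_pM2r ?invr_gt0 //; apply: circ_mean_mono; [exact: ltW|exact: ltW| |].
    by move=> z zr; apply: hol_rcont_sqr => //; exact: le_lt_trans zr r21.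
  by move=> z zr; apply: sub4_sqr_normc => //; exact: lt_trans zr r21.
have u00 : u0 <= 0.
  rewrite leNgt; apply/negP => u0p.
  pose r1 := expR (- (u0 / 2)); pose r2 := expR (- (u0 / 4)).
  have r10 : 0 < r1 by exact: expR_gt0.
  have r12 : r1 < r2 by rewrite ltr_expR; lra.
  have r21 : r2 < 1 by rewrite expR_lt1; lra.
  have aux (a1 a2 x : R) : a1 <= a2 ->
      (- (x / 4)) ^+ 2 + 2 * - (x / 4) * x + a2 <= (- (x / 2)) ^+ 2 + 2 * - (x / 2) * x + a1 ->
      0 < x * x -> False by rewrite !expr2; lra.
  have := mono2 _ _ r10 r12 r21; have H1 := Amono _ _ r10 r12 r21.
  rewrite !sqE // ?(lt_trans r10 r12) ?(lt_trans r12 r21) // /r1 /r2 !expRK => H2.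
  exact: aux H1 H2 (mulr_gt0 u0p u0p).
have : normc (T 0) <= 1 by rewrite LE // normc_cexp -/u0 -expR0 ler_expR.
have nc : 0 < normc c by rewrite normc_gt0.
have n4 : normc (4 : R[i]) = 4 by rewrite -[4 : R[i]](rmorph_nat (@real_complex R)) normc_real ger0_norm.
by rewrite T0 normcM normcV normcM n4 ler_pdivrMr ?mul1r // mulr_gt0.
Qed.

End KoebeQuarter.


(** * Growth of univalent functions *)

Section Growth.
Variable R : realType.
Implicit Types (a z w c zeta : R[i]) (r s t : R) (phi psi chi N L : R[i] -> R[i]).

Lemma mobius_normE a z : normc (1 + a^* * z) ^+ 2 - normc (z + a) ^+ 2 =
  (1 - normc a ^+ 2) * (1 - normc z ^+ 2).
Proof. by rewrite !sqr_normcE !ReImE /=; ring. Qed.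

Lemma sqr_normc_lt1 z : normc z < 1 -> 0 < 1 - normc z ^+ 2.
Proof. by move=> z1; rewrite subr_gt0 expr_lt1 ?normc_ge0. Qed.

Lemma mobius_den_neq0 a z : normc a < 1 -> normc z < 1 -> 1 + a^* * z != 0.
Proof.
move=> a1 z1; apply/eqP => E; have := mobius_normE a z.
rewrite E normc0 expr0n /= sub0r.
have := mulr_gt0 (sqr_normc_lt1 a1) (sqr_normc_lt1 z1); have := sqr_ge0 (normc (z + a)); lra.
Qed.

Definition mobius a z := (z + a) / (1 + a^* * z).

Lemma mobius0 a : mobius a 0 = a.
Proof. by rewrite /mobius add0r mulr0 addr0 divr1. Qed.

Lemma mobius_disc a z : normc a < 1 -> normc z < 1 -> normc (mobius a z) < 1.
Proof.
move=> a1 z1; have nz := mobius_den_neq0 a1 z1.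
rewrite normcM normcV ltr_pdivrMr ?normc_gt0 // mul1r.
rewrite -(@ltr_pXn2r _ 2) ?nnegrE ?normc_ge0 // -subr_gt0 mobius_normE.
by rewrite mulr_gt0 ?sqr_normc_lt1.
Qed.

Lemma mobius_hasd0 a : hasd (mobius a) 0 (1 - normc a ^+ 2)%:C.
Proof.
have h1 := hasd_add (hasd_id 0) (hasd_cst a 0).
have h2 := hasd_add (hasd_cst 1 0) (hasd_scale a^* (hasd_id 0)).
have n1 : 1 + a^* * 0 != 0 :> R[i] by rewrite mulr0 addr0 oner_neq0.
have := hasd_mul h1 (hasd_inv h2 n1); congr (hasd _ _ _).
rewrite mulr0 !add0r !addr0 expr1n divr1 invr1 !mulr1 mulrN mul_conjc.
by rewrite rmorphB rmorph1.
Qed.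

Lemma hol_mobius a : normc a < 1 -> hol (mobius a).
Proof.
move=> a1; apply: (@hol_mul _ (fun z => z + a) (fun z => (1 + a^* * z)^-1)).
  exact: (hol_add (@hol_id R) (hol_cst a)).
apply: hol_inv; first exact: (hol_add (hol_cst 1) (hol_scale a^* (@hol_id R))).
by move=> z; exact: mobius_den_neq0.
Qed.

Lemma mobius_inj a : normc a < 1 -> inj_disc (mobius a).
Proof.
move=> a1 z w z1 w1 /eqP; rewrite eqr_div ?mobius_den_neq0 // => /eqP E.
have : (z - w) * (1 - normc a ^+ 2)%:C = 0.
  have -> : (1 - normc a ^+ 2)%:C = 1 - a * a^* by rewrite mul_conjc rmorphB rmorph1.
  transitivity ((z + a) * (1 + a^* * w) - (w + a) * (1 + a^* * z)); first by ring.
  by rewrite E subrr.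
move/eqP; rewrite mulf_eq0 => /orP[/eqP/subr0_eq //|/eqP/(congr1 (@complex.Re R)) /=].
by move=> E'; have := sqr_normc_lt1 a1; rewrite E' ltxx.
Qed.

(** Koebe's one-quarter theorem moved to another base point by a disc automorphism. *)
Lemma koebe_at chi c a : hol chi -> inj_disc chi -> (forall z, normc z < 1 -> chi z != c) ->
  normc a < 1 -> (1 - normc a ^+ 2) * normc (dv chi a) <= 4 * normc (chi a - c).
Proof.
move=> h inj omit a1; pose X z := chi (mobius a z) - chi a.
have Td z : normc z < 1 -> normc (mobius a z) < 1 by exact: mobius_disc.
have hX : hol X by apply: hol_sub; [apply: hol_comp => //; exact: hol_mobius|exact: hol_cst].
have iX : inj_disc X.
  move=> z w z1 w1 /addIr /inj E; apply: (mobius_inj a1) => //; apply: E; exact: Td.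
have X0 : X 0 = 0 by rewrite /X mobius0 subrr.
have oX z : normc z < 1 -> X z != c - chi a.
  by move=> z1; rewrite /X (inj_eq (addIr _)) omit // Td.
have := koebe_quarter hX iX X0 oX.
have -> : dv X 0 = dv chi a * (1 - normc a ^+ 2)%:C.
  apply: dvE; rewrite -[_ * _]subr0; apply: hasd_sub; last exact: hasd_cst.
  by apply: hasd_comp; [exact: mobius_hasd0|rewrite mobius0; exact: hol_dv].
by rewrite normcM normc_real ger0_norm ?(ltW (sqr_normc_lt1 a1)) // mulrC (normc_sub c).
Qed.

Lemma unit_of z : exists2 u, normc u = 1 & u * z = (normc z)%:C.
Proof.
have [t _ E] := polarE z; exists (cis (- t)); first exact: normc_cis.
by rewrite [in LHS]E mulrCA -cisD addNr cis0 mulr1.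
Qed.

(** Integration of a bound of the derivative along a radius. *)
Lemma ray_bound phi (b B : R -> R) z : hol phi ->
  (forall s, 0 <= s < 1 -> is_derive s 1 B (b s)) ->
  (forall w, normc w < 1 -> normc (dv phi w) <= b (normc w)) ->
  normc z < 1 -> normc (phi z - phi 0) <= B (normc z) - B 0.
Proof.
move=> h hB hb z1; have [->|z0] := eqVneq z 0.
  by rewrite subrr normc0 subrr.
have [c c1 cE] := unit_of (phi z - phi 0).
have [u u1 uE] := unit_of z.
have u0 : u != 0 by rewrite -normc_gt0 u1.
pose y := u^-1; have y1 : normc y = 1 by rewrite normcV u1 invr1.
have zE : z = (normc z)%:C * y by rewrite -uE mulrAC divff // mul1r.
have nz : 0 < normc z by rewrite normc_gt0.
pose V s := complex.Re (c * phi (0 + s%:C * y)).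
pose f s := B s - V s.
have nsy s : 0 <= s -> normc (0 + s%:C * y) = s.
  by move=> s0; rewrite add0r normcM y1 mulr1 normc_real ger0_norm.
have hf s : 0 <= s < 1 -> is_derive s 1 f (b s - complex.Re (c * dv phi (0 + s%:C * y) * y)).
  move=> s01; have /andP[s0 s1] := s01.
  apply: (@is_deriveB R R^o R^o B V); first exact: hB.
  by apply: (@hasd_ray_Re R (fun w => c * phi w)); apply: hasd_scale; apply: hol_dv => //; rewrite nsy.
have [||s ss E] := @MVT R f (fun s => b s - complex.Re (c * dv phi (0 + s%:C * y) * y)) 0 (normc z) nz.
- by move=> s; rewrite in_itv /= => /andP[s0 sz]; apply: hf; lra.
- apply: derivable_within_continuous => s; rewrite in_itv /= => /andP[s0 sz].
  by have [] := hf s; [lra|].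
have : 0 <= f (normc z) - f 0.
  move: ss; rewrite in_itv /= => /andP[s0 sz]; rewrite E subr0 mulr_ge0 ?normc_ge0 // subr_ge0.
  apply: le_trans (Re_le_normc _) _; rewrite !normcM c1 y1 mul1r mulr1.
  by apply: le_trans (hb _ _) _; rewrite nsy //; lra.
rewrite /f /V. rewrite rmorph0 mul0r addr0 add0r -zE.
have := congr1 (@complex.Re R) cE; rewrite mulrBr ReD ReN /= => <-; lra.
Qed.

(** By [koebe_at], a logarithm of [chi - c] has derivative at most
    [4 / (1 - r^2) <= 2 / (1 - r) + 2] at distance [r] from [0]. *)
Lemma growth_omit chi c z : hol chi -> inj_disc chi -> chi 0 = 0 ->
  (forall z, normc z < 1 -> chi z != c) -> normc z < 1 ->
  normc (chi z) <= normc c * (1 + expR 2) / (1 - normc z) ^+ 2.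
Proof.
move=> h inj chi0 omit z1; pose N w := chi w - c.
have hN : hol N by apply: hol_sub => //; exact: hol_cst.
have nzN w : normc w < 1 -> N w != 0 by move=> w1; rewrite subr_eq0 omit.
have [L hL LE] := hol_log hN nzN.
have dL w : normc w < 1 -> normc (dv L w) <= 2 / (1 - normc w) + 2.
  move=> w1; have := koebe_at h inj omit w1; rewrite -/(N w).
  have -> : dv chi w = cexp (L w) * dv L w.
    apply: hasd_unique (hol_dv h w1) _.
    have E := hasd_comp (hol_dv hL w1) (hasd_cexp (L w)).
    have {}E : hasd N w (cexp (L w) * dv L w).
      apply: (@hasd_local _ _ _ _ _ (1 - normc w)) E; first by rewrite subr_gt0.
      by move=> v /in_disc_sub /LE.
    have := hasd_add E (hasd_cst c w); rewrite addr0.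
    by congr (hasd _ _ _); apply/funext => v; rewrite subrK.
  rewrite normcM -LE // mulrCA (mulrC 4) ler_pM2l ?normc_gt0 ?nzN //.
  set x := normc w in w1 *; have x0 : 0 <= x := normc_ge0 w.
  set d := normc _ => H.
  have H2 : (1 - x) * (1 + x) * d <= 4 by move: H; congr (_ * _ <= _); ring.
  have x1 : 0 < 1 - x by lra.
  have -> : 2 / (1 - x) + 2 = (4 - 2 * x) / (1 - x) by field; rewrite gt_eqF.
  rewrite ler_pdivlMr // mulrC -(@ler_pM2r _ (1 + x)); last lra.
  rewrite mulrAC; apply: le_trans H2 _; nra.
have n0 : normc (0 : R[i]) < 1 by rewrite normc0.
have hB s : 0 <= s < 1 -> is_derive s 1 (fun s => - (2 * ln (1 - s)) + 2 * s) (2 / (1 - s) + 2).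
  move=> /andP[s0 s1].
  have s1' : 0 < 1 - s by lra.
  have d1 : is_derive s 1 (fun s => 1 - s) (0 - 1 : R).
    exact: (@is_deriveB R R^o R^o (cst 1) id).
  have d2 := @is_derive1_comp R (@ln R) (fun s => 1 - s) s _ _ (is_derive1_ln s1') d1.
  have d3 := @is_deriveZ R R^o R^o _ (-2) s 1 _ d2.
  have d4 := @is_deriveZ R R^o R^o id 2 s 1 1 (is_derive_id _ _).
  have := @is_deriveD R R^o R^o _ _ s 1 _ _ d3 d4.
  have -> : (-2 : R) \*: (@ln R \o (fun s => 1 - s)) + 2 \*: id =
     (fun s => - (2 * ln (1 - s)) + 2 * s) :> (R -> R).
    by apply/funext => x; rewrite -mulNr.
  congr (is_derive _ _ _ _); rewrite /GRing.scale /= sub0r; ring.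
have := ray_bound hL hB dL z1.
rewrite subr0 ln1 !mulr0 oppr0 add0r subr0; set r := normc z in z1 *.
have r0 : 0 <= r := normc_ge0 z; move=> H.
have r1 : 0 < 1 - r by rewrite subr_gt0.
have HN : normc (N z) <= normc (N 0) * (expR 2 / (1 - r) ^+ 2).
  rewrite !LE ?normc0 // !normc_cexp.
  rewrite -[(1 - r) ^+ 2]lnK ?posrE ?exprn_gt0 // -expRN -!expRD ler_expR lnXn //.
  have := le_trans (Re_le_normc _) H; rewrite ReD ReN -mulr_natl.
  by lra.
have -> : chi z = N z + c by rewrite subrK.
apply: le_trans (le_normcD _ _) _; rewrite mulrDr mulr1 mulrDl addrC lerD //.
  by rewrite ler_pdivlMr ?exprn_gt0 // ler_piMr ?normc_ge0 // exprn_ile1 ?(ltW r1) // lerBlDr lerDl.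
by move: HN; rewrite /N chi0 sub0r normcN mulrA.
Qed.

(** The maximum principle for [z / psi z] provides, on the circle of radius [rho],
    a value [c] of [psi] with [|c| <= 2 rho]; it is omitted by [psi (rho v)] on the
    disc. With [rho = (1 + |z|) / 2] and [v = z / rho], the inequality
    [1 - |v| >= (1 - |z|) / 2] makes the constant [2 * 4 = 8]. *)
Lemma growth psi z : hol psi -> inj_disc psi -> psi 0 = 0 -> dv psi 0 = 1 ->
  normc z < 1 -> normc (psi z) <= 8 * (1 + expR 2) / (1 - normc z) ^+ 2.
Proof.
move=> h inj psi0 d1 z1; have n0 : normc (0 : R[i]) < 1 by rewrite normc0.
have z0 := normc_ge0 z.
pose rho := (1 + normc z) / 2; have rho0 : 0 < rho by rewrite /rho; lra.
have rho1 : rho < 1 by rewrite /rho; lra.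
have zr : normc z < rho by rewrite /rho; lra.
have nzP w : normc w < 1 -> ddiff psi 0 w != 0 by move=> w1; exact: ddiff_neq0.
have hI : hol (fun w => (ddiff psi 0 w)^-1) by apply: hol_inv => //; exact: hol_ddiff.
(* Otherwise [|z / psi z| < 1 / 2] on the circle, against the value [1] at [0]. *)
have [w wr wP] : exists2 w, normc w = rho & normc (ddiff psi 0 w) <= 2.
  apply: contrapT => H.
  have := @max_modulus _ _ rho (1 / 2) hI (ltW rho0) rho1 _ 0.
  rewrite normc0 (ltW rho0) => /(_ _ isT).
  have -> : ddiff psi 0 0 = 1 by rewrite /ddiff eqxx.
  rewrite invr1 normc1; suff : 1 <= 1 / 2 :> R -> False by move=> A B; apply: A; apply: B => v vr;
    rewrite normcV mul1r lef_pV2 ?posrE ?normc_gt0 ?nzP ?vr // leNgt; apply/negP => v2; apply: H;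
    exists v => //; exact: ltW.
  lra.
pose chi v := psi (rho%:C * v); pose c := psi w.
have nrv v : normc (rho%:C * v) = rho * normc v by rewrite normcM normc_real gtr0_norm.
have rv v : normc v < 1 -> normc (rho%:C * v) < rho by move=> v1; rewrite nrv gtr_pMr.
have rv1 v : normc v < 1 -> normc (rho%:C * v) < 1 by move=> /rv /lt_trans; apply.
have hchi : hol chi by apply: hol_comp => //; apply: (hol_scale _ (@hol_id R)).
have ichi : inj_disc chi.
  move=> u v u1 v1 /inj E; apply: (@mulfI _ rho%:C); first by rewrite -normc_gt0 normc_real normr_gt0 gt_eqF.
  by apply: E; exact: rv1.
have chi0 : chi 0 = 0 by rewrite /chi mulr0.
have omit v : normc v < 1 -> chi v != c.
  move=> v1; apply/eqP => /inj E; have := rv _ v1; rewrite E ?wr ?ltxx ?rv1 //.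
have c2 : normc c <= 2.
  rewrite /c (ddiffE psi 0 w) psi0 add0r subr0 normcM wr.
  by apply: le_trans (ler_piMl (normc_ge0 _) (ltW rho1)) _.
pose v := rho^-1%:C * z.
have nv : normc v = normc z / rho by rewrite normcM normc_real gtr0_norm ?invr_gt0 // mulrC.
have v1 : normc v < 1 by rewrite nv ltr_pdivrMr ?mul1r.
have := growth_omit hchi ichi chi0 omit v1.
have -> : chi v = psi z.
  rewrite /chi /v mulrA -rmorphM /= divff ?gt_eqF // ?rmorph1 ?mul1r //.
move/le_trans; apply.
have e0 : 0 < 1 + expR 2 :> R by rewrite addr_gt0 // expR_gt0.
have dz : 0 < 1 - normc z by rewrite subr_gt0.
have dv' : (1 - normc z) / 2 <= 1 - normc v.
  rewrite nv -subr_ge0.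
  have -> : 1 - normc z / rho - (1 - normc z) / 2 = (1 - normc z) ^+ 2 / 2 / (1 + normc z).
    by rewrite /rho; field; rewrite gt_eqF // ltr_pwDl.
  by rewrite !divr_ge0 ?sqr_ge0 //; lra.
have -> : 8 * (1 + expR 2) / (1 - normc z) ^+ 2 = 2 * (1 + expR 2) / ((1 - normc z) / 2) ^+ 2.
  by field; rewrite gt_eqF.
rewrite ler_pM ?mulr_ge0 ?invr_ge0 ?exprn_ge0 ?normc_ge0 ?(ltW e0) //; try lra.
  by rewrite ler_pM2r.
by rewrite lef_pV2 ?posrE ?exprn_gt0 //; [rewrite lerXn2r ?nnegrE //; lra|lra|lra].
Qed.

End Growth.


(** * Means of functions subordinate to a univalent function *)

Section Subordination.
Variable R : realType.
Implicit Types (a z w c zeta : R[i]) (r s t q : R) (phi psi eta X N : R[i] -> R[i]) (U : R[i] -> R).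

(** Nonnegativity everywhere is needed at the zeros of [U], because [x `^ q = 1] for
    [x < 0]. *)
Lemma rcont_powR U z q : 0 < q -> (forall w, 0 <= U w) -> rcont_at U z ->
  rcont_at (fun w => U w `^ q) z.
Proof.
move=> q0 U0 cU; have := U0 z; rewrite le_eqVlt => /predU1P[Uz|Uz]; last first.
  have c : rcont_at (fun w => expR (q * ln (U w))) z.
    apply: rcont_comp; last exact: continuous_expR.
    by apply: rcont_mul; [exact: rcont_cst|exact: rcont_ln].
  move=> e e0; have [d1 d10 H1] := c e e0; have [d2 d20 H2] := cU _ Uz.
  exists (Num.min d1 d2) => [|w]; first by rewrite lt_min d10.
  rewrite lt_min => /andP[w1 w2]; have Uw : 0 < U w.
    by have := H2 _ w2; rewrite ltr_norml => /andP[]; lra.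
  by rewrite /powR !gt_eqF //; exact: H1.
move=> e e0; rewrite -Uz powR0 ?gt_eqF //.
have e1 : 0 < e `^ q^-1 by exact: powR_gt0.
have [d d0 H] := cU _ e1; exists d => // w /H; rewrite -Uz !subr0 !ger0_norm ?powR_ge0 // => Hw.
have := gt0_ltr_powR q0 (U0 w : U w \in Num.nneg) (powR_ge0 _ _ : _ \in Num.nneg) Hw.
by rewrite -powRrM mulVf ?gt_eqF // powRr1 // ltW.
Qed.

Lemma lnk_shift B B' (d : R -> R) : 0 < B -> B <= B' -> measurable_fun setT d ->
  (forall t, 0 <= d t <= B) ->
  cint (fun t => lnk B' (d t)) = (cint (fun t => lnk B (d t)) + (2 * pi * (ln B' - ln B))%:E)%E.
Proof.
move=> B0 BB md dB; pose c : R := ln B' - ln B.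
have c0 : 0 <= c by rewrite subr_ge0 ler_ln ?posrE // (lt_le_trans B0).
rewrite (@eq_cint _ _ (fun t => lnk B (d t) + c%:E)%E); last first.
  by move=> t; have /andP[d0 _] := dB t; rewrite -[d t]mulr1 (lnk_mul _ B) // ln1 subr0 mulr1.
rewrite -cint_cst -/c /cint ge0_integralD //.
- by move=> t _; have /andP[? ?] := dB t; exact: lnk_ge0.
- by apply: measurable_funTS; apply: measurableT_comp md; exact: measurable_lnk.
Qed.

(** If [psi] takes the value [w] at [zeta], then
    [(1 - zeta^* v) (psi v - w) / (v - zeta)] has no zero, and it dominates
    [psi - w] because [|v - zeta| <= |1 - zeta^* v|]. *)
Lemma zero_free_majorant psi w : hol psi -> inj_disc psi -> psi 0 = 0 -> w != 0 ->
  exists N, [/\ hol N, forall v, normc v < 1 -> N v != 0,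
    forall v, normc v < 1 -> normc (psi v - w) <= normc (N v) &
    normc (N 0) = normc w \/ exists2 zeta, normc zeta < 1 /\ psi zeta = w &
      zeta != 0 /\ normc (N 0) = normc w / normc zeta].
Proof.
move=> h inj psi0 w0; have n0 : normc (0 : R[i]) < 1 by rewrite normc0.
have [nz|[zeta [z1 zw E]]] := one_zero w h inj.
  exists (fun v => psi v - w); split => //; first by apply: hol_sub => //; exact: hol_cst.
  by left; rewrite psi0 sub0r normcN.
have zeta0 : zeta != 0 by apply: contra_neq w0 => z0; rewrite -zw z0.
exists (fun v => (1 + (- zeta)^* * v) * ddiff psi zeta v); split.
- apply: hol_mul; last exact: hol_ddiff.
  exact: (hol_add (hol_cst 1) (hol_scale _ (@hol_id R))).
- move=> v v1; rewrite mulf_neq0 ?ddiff_neq0 // mobius_den_neq0 // normcN //.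
- move=> v v1; rewrite E !normcM ler_wpM2r ?normc_ge0 //.
  rewrite -(@ler_pXn2r _ 2) ?nnegrE ?normc_ge0 // -subr_ge0 mobius_normE normcN.
  by rewrite mulr_ge0 // ltW // sqr_normc_lt1.
right; exists zeta => //; split => //; rewrite mulr0 addr0 mul1r /ddiff.
by rewrite eq_sym (negPf zeta0) psi0 zw !sub0r mulNr invrN mulrN opprK normcM normcV.
Qed.

(** For each [w] with [|w| = s], the majorant [N] of [zero_free_majorant] has
    [|N 0| = s / |zeta|] or [s], so Jensen's formula for [N \o eta] bounds the mean of
    [ln (1 / |psi (eta) - w|)] from below; averaging over [w] gives the claim. *)
Lemma mean_ln_max psi eta r s lam : hol psi -> inj_disc psi -> psi 0 = 0 ->
  hol eta -> (forall z, normc z < 1 -> normc (eta z) < 1) -> eta 0 = 0 ->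
  0 < r -> r < 1 -> 0 < s -> 0 <= lam ->
  (forall zeta, normc zeta < 1 -> zeta != 0 -> normc (psi zeta) = s -> - ln (normc zeta) <= lam) ->
  circ_mean (fun z => ln (Num.max (normc (psi (eta z))) s)) 0 r <= ln s + lam.
Proof.
move=> h inj psi0 he e1 eta0 r0 r1 s0 lam0 Hlam.
pose X z := psi (eta z); have hX : hol X by exact: hol_comp.
have inD t : normc (circle 0 r t) < 1 by apply: circle_in_disc => //; exact: ltW.
have cX t : cont_at X (circle 0 r t) by exact: hol_cont.
have [|M M0 HM] := @closed_disc_bounded _ X 0 r (ltW r0).
  by move=> z; rewrite subr0 => zr; apply: hol_cont => //; exact: le_lt_trans zr r1.
pose B := M + s * expR lam.
have sB : s <= s * expR lam by rewrite ler_peMr ?(ltW s0) // -expR0 ler_expR.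
have B0 : 0 < B by rewrite /B; lra.
have XB t : normc (X (circle 0 r t)) + s <= B.
  by rewrite /B lerD // HM // subr0 normc_circle0 // ltW.
have ns u : normc (circle 0 s u : R[i]) = s by rewrite normc_circle0 // ltW.
have dB u t : 0 <= normc (X (circle 0 r t) - circle 0 s u) <= B.
  by rewrite normc_ge0 (le_trans (normcB _ _)) // ns XB.
have key u : ((2 * pi * (ln B - ln s - lam))%:E <=
    cint (fun t => lnk B (normc (X (circle 0 r t) - circle 0 s u))%R))%E.
  set w := circle 0 s u; have w0 : w != 0 by apply: circle_neq0.
  have [N [hN nzN NX N0]] := zero_free_majorant h inj psi0 w0.
  pose Y z := N (eta z); have hY : hol Y by exact: hol_comp.
  have nzY z : normc z < 1 -> Y z != 0 by move=> /e1 /nzN.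
  have [|M' M'0 HM'] := @closed_disc_bounded _ Y 0 r (ltW r0).
    by move=> z; rewrite subr0 => zr; apply: hol_cont => //; exact: le_lt_trans zr r1.
  pose B' := M' + B; have B'0 : 0 < B' by rewrite addr_gt0.
  have BB' : B <= B' by rewrite lerDr ltW.
  have YB t : normc (Y (circle 0 r t)) <= B'.
    by rewrite /B' (le_trans (HM' _ _)) ?subr0 ?normc_circle0 ?(ltW r0) // lerDl ltW.
  have mY (Z : R[i] -> R[i]) : (forall t, cont_at Z (circle 0 r t)) ->
      measurable_fun setT (fun t => normc (Z (circle 0 r t))).
    by move=> cZ; apply: (@measurable_circle _ (fun z => normc (Z z))) => t; exact: rcont_normc.
  have mXw : measurable_fun setT (fun t => normc (X (circle 0 r t) - w)).
    by apply: (mY (fun z => X z - w)) => t; apply: cont_sub => //; exact: cont_cst.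
  have mYc : measurable_fun setT (fun t => normc (Y (circle 0 r t))).
    by apply: mY => t; exact: hol_cont.
  have := @jensen_nonzero _ Y B' r hY nzY r0 r1 => J.
  have A : (cint (fun t => lnk B' (normc (Y (circle 0 r t)))%R) <=
            cint (fun t => lnk B' (normc (X (circle 0 r t) - w))%R))%E.
    apply: le_cint => [t|||t].
    - by apply: lnk_ge0; [exact: normc_ge0|exact: YB].
    - by apply: measurableT_comp mYc; exact: measurable_lnk.
    - by apply: measurableT_comp mXw; exact: measurable_lnk.
    - by apply: lnk_anti; [exact: normc_ge0|apply: NX; exact: e1].
  move: A; rewrite J (lnk_shift B0 BB' mXw (dB u)) -leeBlDr // -EFinB.
  apply: le_trans; rewrite lee_fin -mulrBr ler_pM2l ?pi2_gt0 // /Y eta0.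
  suff : ln (normc (N 0)) <= ln s + lam by lra.
  case: N0 => [->|[zeta [z1 zw] [z0 ->]]]; rewrite /w ns; first by rewrite lerDl.
  by rewrite ln_div ?posrE ?normc_gt0 // lerD2l Hlam // zw /w ns.
have mf : measurable_fun setT (fun u => cint (fun t => lnk B (normc (X (circle 0 r t) - circle 0 s u)))).
  apply: (@measurable_cint _ (fun p : R * R => lnk B (normc (X (circle 0 r p.2) - circle 0 s p.1)))).
    exact: measurable_lnk2.
  by move=> p; have /andP[? ?] := dB p.1 p.2; exact: lnk_ge0.
have := lnk_swap s0 cX XB => E.
have : (cint (fun=> (2 * pi * (ln B - ln s - lam))%:E) <=
   (2 * pi * (2 * pi * (ln B - circ_mean (fun z => ln (Num.max (normc (X z)) s)) 0 r))%R)%:E)%E.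
  rewrite -E; apply: le_cint => // _; rewrite lee_fin mulr_ge0 ?(ltW (pi2_gt0 R)) //.
  have : ln (s * expR lam) <= ln B by rewrite ler_ln ?posrE ?mulr_gt0 ?expR_gt0 // /B lerDr ltW.
  by rewrite lnM ?posrE ?expR_gt0 // expRK; lra.
rewrite cint_cst lee_fin !ler_pM2l ?pi2_gt0 //; rewrite /X; lra.
Qed.

(** A layer-cake majorant of [x ^ q] by truncated logarithms. *)
Lemma powR_layers q (l0 : R) (N : nat) (x : R) : 0 < q -> 0 <= x -> x <= expR (l0 + N%:R + 1) ->
  x `^ q <= expR (q * (l0 + 1)) +
    \sum_(n < N) expR (q * (l0 + n%:R + 2)) * (ln (Num.max x (expR (l0 + n%:R))) - (l0 + n%:R)).
Proof.
move=> q0 x0; have tge n : 0 <= expR (q * (l0 + n%:R + 2)) *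
    (ln (Num.max x (expR (l0 + n%:R))) - (l0 + n%:R)).
  rewrite mulr_ge0 ?expR_ge0 // subr_ge0 -[leLHS]expRK ler_ln ?posrE ?expR_gt0 //.
    by rewrite le_max lexx orbT.
  by rewrite lt_max expR_gt0 orbT.
have powE l : x <= expR l -> x `^ q <= expR (q * l).
  move=> xl; have := ge0_ler_powR (ltW q0) (x0 : x \in Num.nneg) (expR_ge0 l : _ \in Num.nneg) xl.
  by rewrite {2}/powR gt_eqF ?expR_gt0 // expRK.
elim: N => [|N IH] xN; first by rewrite big_ord0 !addr0 in xN *; exact: powE.
rewrite big_ord_recr /= addrA; have [xs|xs] := leP x (expR (l0 + N%:R + 1)).
  by apply: le_trans (IH xs) _; rewrite lerDl.
have : x `^ q <= expR (q * (l0 + N%:R + 2)).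
  by apply: powE; apply: le_trans xN _; rewrite ler_expR -natr1; lra.
move/le_trans; apply; rewrite -[leLHS]add0r lerD //.
  by rewrite addr_ge0 ?expR_ge0 // sumr_ge0.
rewrite ler_peMr ?expR_ge0 // lerBrDr addrC -[leLHS]expRK ler_ln ?posrE ?expR_gt0 //.
  by rewrite le_max (ltW xs).
by rewrite lt_max expR_gt0 orbT.
Qed.

Lemma geo_sum (rho : R) n : 0 <= rho -> rho < 1 -> \sum_(i < n) rho ^+ i <= (1 - rho)^-1.
Proof.
move=> r0 r1; have d0 : 0 < 1 - rho by rewrite subr_gt0.
rewrite -[leRHS]mul1r ler_pdivlMr //.
have : 1 - rho ^+ n = (1 - rho) * \sum_(i < n) rho ^+ i.
  rewrite -[X in X - _ = _](expr1n _ n) subrXX; congr (_ * _); apply: eq_bigr => i _.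
  by rewrite expr1n mul1r.
by rewrite [X in X <= _]mulrC => <-; rewrite lerBlDr lerDl exprn_ge0.
Qed.

(** The levels are [e^(l0 + n)]. If [|psi zeta| = e^(l0 + n)] then the growth theorem
    gives [2 (1 - |zeta|) <= e^(-n/2)], so the [n]-th layer contributes
    [e^(q n) e^(-n/2)] up to a constant: a geometric series for [q < 1/2]. *)
Lemma mean_subordinate psi q : hol psi -> inj_disc psi -> psi 0 = 0 -> dv psi 0 = 1 ->
  0 < q -> q < 1 / 2 -> exists2 M : R, 0 <= M &
  forall eta, hol eta -> (forall z, normc z < 1 -> normc (eta z) < 1) -> eta 0 = 0 ->
  forall r, 0 < r -> r < 1 ->
  circ_mean (fun z => normc (psi (eta z)) `^ q) 0 r <= M.
Proof.
move=> h inj psi0 d1 q0 q2; pose C : R := 8 * (1 + expR 2).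
have C0 : 0 < C by rewrite mulr_gt0 // addr_gt0 // expR_gt0.
(* At the level [4 C] the growth theorem already gives [|zeta| >= 1 / 2]. *)
pose l0 : R := ln (4 * C).
have El0 : expR l0 = 4 * C by rewrite lnK // posrE mulr_gt0.
have lamP n zeta : normc zeta < 1 -> zeta != 0 -> normc (psi zeta) = expR (l0 + n%:R) ->
    - ln (normc zeta) <= expR (- (n%:R / 2)).
  move=> z1 z0 zs; have := growth h inj psi0 d1 z1; rewrite zs -/C.
  set x := normc zeta in z1 *; have x0 : 0 < x by rewrite normc_gt0.
  set e := expR (- (n%:R / 2)).
  have e0 : 0 < e by exact: expR_gt0.
  have e1 : e <= 1 by rewrite expR_le1 oppr_le0 divr_ge0.
  have -> : expR (l0 + n%:R) = 4 * C / e ^+ 2.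
    rewrite expRD El0 -expRM_natl -expRN; congr (_ * expR _).
    by rewrite mulrN opprK mulrC divfK.
  have y0 : 0 < 1 - x by rewrite subr_gt0.
  rewrite ler_pdivrMr ?exprn_gt0 // mulrAC ler_pdivlMr ?exprn_gt0 // => H.
  have {}H : (2 * (1 - x)) ^+ 2 <= e ^+ 2.
    rewrite -(ler_pM2l C0); move: H; congr (_ <= _); rewrite !expr2; ring.
  have {}H : 2 * (1 - x) <= e.
    by rewrite -(@ler_pXn2r _ 2) ?nnegrE ?(ltW e0) // mulr_ge0 // ltW.
  have x2 : 1 / 2 <= x by lra.
  have : ln (x^-1) <= x^-1 - 1.
    rewrite -[X in ln X](addrNK 1) addrC le_ln1Dx // ltrBrDl subrr invr_gt0 //.
  rewrite lnV ?posrE // => /le_trans; apply; apply: le_trans H.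
  by rewrite lerBlDr -[x^-1]mul1r ler_pdivrMr //; nra.
pose rho := expR (q - 1 / 2); have rho0 : 0 <= rho by exact: expR_ge0.
have rho1 : rho < 1 by rewrite expR_lt1; lra.
exists (expR (q * (l0 + 1)) + expR (q * (l0 + 2)) * (1 - rho)^-1).
  by rewrite addr_ge0 ?expR_ge0 // mulr_ge0 ?expR_ge0 // invr_ge0; lra.
move=> eta he e1 eta0 r r0 r1.
pose X z := psi (eta z); have hX : hol X by exact: hol_comp.
have inD t : normc (circle 0 r t) < 1 by apply: circle_in_disc => //; exact: ltW.
have [|M M0 HM] := @closed_disc_bounded _ X 0 r (ltW r0).
  by move=> z; rewrite subr0 => zr; apply: hol_cont => //; exact: le_lt_trans zr r1.
pose N := (Num.truncn `|ln M - l0|).+1.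
have MN : M <= expR (l0 + N%:R + 1).
  rewrite -[M]lnK ?posrE // ler_expR.
  have := truncnS_gt `|ln M - l0|; rewrite -/N; have := ler_norm (ln M - l0); lra.
have cX t : rcont_at (fun z => normc (X z)) (circle 0 r t).
  by apply: rcont_normc; apply: hol_cont.
have cq t : rcont_at (fun z => normc (X z) `^ q) (circle 0 r t).
  by apply: rcont_powR => // w; exact: normc_ge0.
pose T n z := expR (q * (l0 + n%:R + 2)) *
  (ln (Num.max (normc (X z)) (expR (l0 + n%:R))) - (l0 + n%:R)).
have cl n t : rcont_at (fun z => ln (Num.max (normc (X z)) (expR (l0 + n%:R)))) (circle 0 r t).
  by apply: rcont_ln; [rewrite lt_max expR_gt0 orbT|exact: rcont_max].
have cT' n t : rcont_at (fun z => ln (Num.max (normc (X z)) (expR (l0 + n%:R))) - (l0 + n%:R)) (circle 0 r t).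
  by apply: rcont_add => //; exact: rcont_cst.
have cT n t : rcont_at (T n) (circle 0 r t) by apply: rcont_mul => //; exact: rcont_cst.
have cS m t : rcont_at (fun z => \sum_(n < m) T n z) (circle 0 r t).
  by apply: rcont_sum => j; exact: cT.
have cc (c : R) t : rcont_at (fun=> c) (circle 0 r t) by exact: rcont_cst.
apply: (@le_trans _ _ (circ_mean (fun z => expR (q * (l0 + 1)) + \sum_(n < N) T n z) 0 r)).
  apply: le_circ_mean => // t; first by apply: rcont_add.
  apply: powR_layers => //; first exact: normc_ge0.
  by apply: le_trans MN; apply: HM; rewrite subr0 normc_circle0 // ltW.
rewrite circ_meanD // circ_mean_cst lerD2l.
have TE n : circ_mean (T n) 0 r <= expR (q * (l0 + 2)) * rho ^+ n.
  rewrite /T circ_meanZ //.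
  have -> : circ_mean (fun z => ln (Num.max (normc (X z)) (expR (l0 + n%:R))) - (l0 + n%:R)) 0 r =
     circ_mean (fun z => ln (Num.max (normc (X z)) (expR (l0 + n%:R)))) 0 r - (l0 + n%:R).
    by rewrite (circ_meanD (cl n) (cc _)) circ_mean_cst.
  apply: (@le_trans _ _ (expR (q * (l0 + n%:R + 2)) * expR (- (n%:R / 2)))).
    rewrite ler_pM2l ?expR_gt0 // lerBlDl.
    have := mean_ln_max h inj psi0 he e1 eta0 r0 r1 (expR_gt0 (l0 + n%:R))
      (expR_ge0 (- (n%:R / 2))) (@lamP n).
    by rewrite expRK.
  by rewrite /rho -expRM_natl -!expRD ler_expR; lra.
have -> : circ_mean (fun z => \sum_(n < N) T n z) 0 r = \sum_(n < N) circ_mean (T n) 0 r.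
  elim: N {MN} => [|N IH].
    have -> : circ_mean (fun z => \sum_(n < 0) T n z) 0 r = circ_mean (fun=> 0) 0 r.
      by apply: eq_circ_mean => t; rewrite big_ord0.
    by rewrite circ_mean_cst big_ord0.
  have -> : circ_mean (fun z => \sum_(n < N.+1) T n z) 0 r =
     circ_mean (fun z => \sum_(n < N) T n z + T N z) 0 r.
    by apply: eq_circ_mean => t; rewrite big_ord_recr.
  by rewrite circ_meanD // IH big_ord_recr.
apply: (@le_trans _ _ (\sum_(n < N) expR (q * (l0 + 2)) * rho ^+ n)).
  by apply: ler_sum => n _; exact: TE.
by rewrite -mulr_sumr ler_pM2l ?expR_gt0 // geo_sum.
Qed.

End Subordination.


(** * Comparison of a harmonic function with an analytic one *)

Section Comparison.
Variable R : realType.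
Implicit Types (z w u c : R[i]) (r s t q : R) (U : R[i] -> R).

(** Bernoulli's inequality: the tangent line of [x ^ al] lies above the graph. *)
Lemma powR_tangent (al x y : R) : 0 < al -> al < 1 -> 0 < x -> 0 <= y ->
  y `^ al <= x `^ al + al * (x `^ al / x) * (y - x).
Proof.
move=> a0 a1 x0 y0; have a1' : 0 < 1 - al by rewrite subr_gt0.
pose t := y / x; have t0 : 0 <= t by rewrite divr_ge0 // ltW.
have := @conjugate_powR R (t `^ al) 1 al^-1 (1 - al)^-1 (powR_ge0 _ _) ler01.
rewrite !invr_gt0 !invrK [al + _]addrC subrK => /(_ a0 a1' erefl).
rewrite mulr1 powR1 mul1r -powRrM divff ?gt_eqF // powRr1 // => H.
have yE : y = t * x by rewrite /t divfK // gt_eqF.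
rewrite yE powRM ?(ltW x0) //.
have -> : x `^ al + al * (x `^ al / x) * (t * x - x) = (t * al + (1 - al)) * x `^ al.
  by field; rewrite gt_eqF.
by rewrite ler_wpM2r ?powR_ge0.
Qed.

Lemma sqr_normcD_le z w : normc (z + w) ^+ 2 <= 2 * (normc z ^+ 2 + normc w ^+ 2).
Proof. by have := parallelogram z w; have := sqr_ge0 (normc (z - w)); lra. Qed.

Let sum_le_double (A x1 x2 x3 : R) : x1 <= A / 2 * x3 -> x2 <= x1 -> x1 + x2 <= A * x3.
Proof. lra. Qed.

Let collect_majorant (a A x x1 x2 e : R) : a * A * x <= a * A * (2 * (x1 + x2)) ->
  a * A * x + e * x2 <= 2 * a * A * x1 + (2 * a * A + e) * x2.
Proof. lra. Qed.

Let collect_averages (a1 a2 a3 h g G h' g' G' e n : R) : a1 - h - h' * n <= e * n ->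
  a2 - g - g' * n <= e * n -> a3 - G - G' * n <= e * n ->
  a1 + a2 + a3 <= h + g + G + (h' + g' + G' + 3 * e) * n.
Proof. lra. Qed.

Let avg_affine_bound (v1 v2 v3 v4 w1 w2 w3 w4 w v D : R) : v4 <= v + D * (w4 - w) ->
  v3 <= v + D * (w3 - w) -> v2 <= v + D * (w2 - w) -> v1 <= v + D * (w1 - w) ->
  (v1 + v2 + v3 + v4) / 4 <= v + D * ((w1 + w2 + w3 + w4) / 4 - w).
Proof. lra. Qed.

Let collect_comparison (D S b q a1 a2 aw av B Q W V C1 C2 e n : R) :
  D * S * n <= (C1 * b + C2 * q) * n -> D * aw <= D * (W + (S + 3 * e) * n) ->
  C1 * - (e * n) <= C1 * (a1 - B - b * n) -> C2 * - (e * n) <= C2 * (a2 - Q - q * n) ->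
  av <= V + D * (aw - W) ->
  C1 * B + C2 * Q - V - (C1 + C2 + 3 * D) * e * n <= C1 * a1 + C2 * a2 - av.
Proof. lra. Qed.

Let collect_means (u0 mu w0 mw x : R) : u0 <= mu -> - w0 <= u0 -> mu + mw <= x -> mw <= w0 + x.
Proof. lra. Qed.

Section Compare.
Variables (h g G b L : R[i] -> R[i]) (c : R[i]) (k al : R).
Hypotheses (hh : hol h) (hg : hol g) (hG : hol G) (hb : hol b) (hL : hol L).
Hypotheses (k1 : k < 1) (c1 : normc c = 1) (al0 : 0 < al) (al1 : al < 1).
Hypothesis gk : forall z, normc z < 1 -> normc (dv g z) <= k * normc (dv h z).
Hypothesis b1 : forall z, normc z < 1 -> normc (b z) <= 1.
Hypothesis GE : forall z, normc z < 1 -> G z = cexp (L z).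
Hypothesis FE : forall z, normc z < 1 -> h z + c * g z = b z * G z.

(** An analytic [al]-th power of [G]: [|Q|^2 = |G|^(2 al)]. *)
Let Q z := cexp (al%:C * L z).
Let W z := normc (h z) ^+ 2 + normc (g z) ^+ 2 + normc (G z) ^+ 2.
Let A : R := 4 / (1 - k) ^+ 2.
Let C1 := 2 * al * A.
Let C2 := 2 * al * A + (A + 1) / al.
Let U z := C1 * normc (b z * Q z) ^+ 2 + C2 * normc (Q z) ^+ 2 - W z `^ al.

Let W0 z : 0 <= W z.
Proof. by rewrite !addr_ge0 ?sqr_ge0. Qed.

Let hQ : hol Q.
Proof. by apply: hol_cexp; exact: hol_scale. Qed.

Let hbQ : hol (fun z => b z * Q z).
Proof. exact: hol_mul. Qed.

Let sqrQ z : normc z < 1 -> normc (Q z) ^+ 2 = (normc (G z) ^+ 2) `^ al.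
Proof.
move=> z1; rewrite GE // !normc_cexp -!expRM_natl /powR gt_eqF ?expR_gt0 // expRK.
by congr expR; rewrite ReM /=; ring.
Qed.

Let Gpos z : normc z < 1 -> 0 < normc (G z) ^+ 2.
Proof. by move=> z1; rewrite exprn_gt0 // GE // normc_cexp expR_gt0. Qed.

Let A0 : 0 < A.
Proof. by rewrite divr_gt0 // exprn_gt0 // subr_gt0. Qed.

Let C10 : 0 < C1.
Proof. by apply: mulr_gt0 => //; exact: mulr_gt0. Qed.

Let C20 : 0 < C2.
Proof. by apply: addr_gt0; [exact: C10|apply: divr_gt0 => //; exact: addr_gt0]. Qed.

(** Quasiconformality bounds the derivatives of [h] and [g] by that of [h + c g],
    and [W >= |G|^2] turns the factor [W ^ (al - 1)] into [|Q|^2 / |G|^2]. *)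
Lemma derivative_domination z : normc z < 1 ->
  al * (W z `^ al / W z) * (normc (dv h z) ^+ 2 + normc (dv g z) ^+ 2 + normc (dv G z) ^+ 2) <=
  C1 * normc (dv (fun z => b z * Q z) z) ^+ 2 + C2 * normc (dv Q z) ^+ 2.
Proof.
move=> z1; have G0 := Gpos z1.
pose y := normc (Q z) ^+ 2; pose l := normc (dv L z) ^+ 2; pose n := normc (dv b z) ^+ 2.
pose gg := normc (G z) ^+ 2.
have gg0 : 0 < gg := G0.
have y0 : 0 < y by rewrite exprn_gt0 // /Q normc_cexp expR_gt0.
have l0 : 0 <= l by exact: sqr_ge0.
have n0 : 0 <= n by exact: sqr_ge0.
have dQ : dv Q z = Q z * (al%:C * dv L z).
  by apply: dvE; exact: (hasd_comp (hasd_scale _ (hol_dv hL z1)) (hasd_cexp _)).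
have dG : dv G z = G z * dv L z.
  apply: hasd_unique (hol_dv hG z1) _; rewrite GE //.
  apply: (@hasd_local _ _ _ _ _ (1 - normc z)) (hasd_comp (hol_dv hL z1) (hasd_cexp _)).
    by rewrite subr_gt0.
  by move=> v /in_disc_sub /GE.
have B2 : normc (dv Q z) ^+ 2 = al ^+ 2 * l * y.
  by rewrite dQ normcM (normcM al%:C) normc_real (gtr0_norm al0) /l /y; ring.
have nG : normc (dv G z) ^+ 2 = gg * l by rewrite dG normcM exprMn.
have B1 : n * y <= 2 * (normc (dv (fun z => b z * Q z) z) ^+ 2 + normc (dv Q z) ^+ 2).
  have E : dv b z * Q z = dv (fun z => b z * Q z) z + (- (b z * dv Q z)).
    rewrite (dvE (hasd_mul (hol_dv hb z1) (hol_dv hQ z1))); ring.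
  have -> : n * y = normc (dv b z * Q z) ^+ 2 by rewrite normcM exprMn.
  rewrite E; apply: le_trans (sqr_normcD_le _ _) _; rewrite ler_pM2l // lerD2l normcN normcM.
  by rewrite exprMn ler_piMl ?sqr_ge0 // exprn_ile1 ?normc_ge0 // b1.
have dF : dv h z + c * dv g z = dv b z * G z + b z * dv G z.
  have H1 := hasd_add (hol_dv hh z1) (hasd_scale c (hol_dv hg z1)).
  apply: (hasd_unique (phi := fun z => h z + c * g z) H1).
  apply: (@hasd_local _ _ _ _ _ (1 - normc z)) (hasd_mul (hol_dv hb z1) (hol_dv hG z1)).
    by rewrite subr_gt0.
  by move=> v /in_disc_sub /FE ->.
have hF : (1 - k) * normc (dv h z) <= normc (dv b z * G z + b z * dv G z).
  rewrite -dF; have := lerB_normc (dv h z) (- (c * dv g z)); rewrite opprK normcN normcM c1 mul1r.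
  have := gk z1; lra.
have F2 : normc (dv b z * G z + b z * dv G z) ^+ 2 <= 2 * (n * gg + gg * l).
  apply: le_trans (sqr_normcD_le _ _) _; rewrite ler_pM2l // !normcM !exprMn lerD2l -nG.
  by rewrite ler_piMl ?sqr_ge0 // exprn_ile1 ?normc_ge0 // b1.
have h2 : normc (dv h z) ^+ 2 <= A / 2 * (n * gg + gg * l).
  have K0 : 0 < (1 - k) ^+ 2 by rewrite exprn_gt0 // subr_gt0.
  rewrite -(ler_pM2l K0).
  have -> : (1 - k) ^+ 2 * (A / 2 * (n * gg + gg * l)) = 2 * (n * gg + gg * l).
    rewrite /A; field; rewrite subr_eq0 gt_eqF //.
  apply: le_trans F2; rewrite -exprMn ler_pXn2r ?nnegrE ?normc_ge0 // mulr_ge0 ?normc_ge0 //.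
  by rewrite subr_ge0 ltW.
have g2 : normc (dv g z) ^+ 2 <= normc (dv h z) ^+ 2.
  rewrite ler_pXn2r ?nnegrE ?normc_ge0 //; apply: le_trans (gk z1) _.
  by rewrite ler_piMl ?normc_ge0 // ltW.
have Wg : gg <= W z by rewrite lerDr addr_ge0 ?sqr_ge0.
have Wp : 0 < W z by exact: lt_le_trans Wg.
have Wy : W z `^ al / W z <= y / gg.
  rewrite /y sqrQ // -/gg.
  have E x : 0 < x -> x `^ al / x = expR (- ((1 - al) * ln x)).
    move=> x0; rewrite /powR gt_eqF // -{2}[x]lnK ?posrE // -expRN -expRD; congr expR; ring.
  rewrite !E // ler_expR lerN2 ler_pM2l ?subr_gt0 // ler_ln ?posrE //.
have S0 : 0 <= normc (dv h z) ^+ 2 + normc (dv g z) ^+ 2 + normc (dv G z) ^+ 2.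
  by rewrite !addr_ge0 ?sqr_ge0.
apply: (@le_trans _ _ (al * (y / gg) *
    (normc (dv h z) ^+ 2 + normc (dv g z) ^+ 2 + normc (dv G z) ^+ 2))).
  by rewrite ler_wpM2r // ler_pM2l.
apply: (@le_trans _ _ (al * (y / gg) * (A * (n * gg + gg * l) + gg * l))).
  rewrite ler_pM2l; last by apply: mulr_gt0 => //; exact: divr_gt0.
  by rewrite nG lerD2r; exact: sum_le_double.
have -> : al * (y / gg) * (A * (n * gg + gg * l) + gg * l) =
    al * A * (n * y) + (A + 1) / al * (al ^+ 2 * l * y).
  by field; rewrite !gt_eqF.
rewrite -B2 /C1 /C2.
have := ler_wpM2l (ltW (mulr_gt0 al0 A0)) B1.
exact: collect_majorant.
Qed.

(** Each summand of [W] is the square of the modulus of an analytic function. *)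
Lemma avg4W_bound z eps : normc z < 1 -> 0 < eps -> exists2 del : R, 0 < del &
  forall u, normc u < del -> avg4 W z u <= W z +
    (normc (dv h z) ^+ 2 + normc (dv g z) ^+ 2 + normc (dv G z) ^+ 2 + 3 * eps) * normc u ^+ 2.
Proof.
move=> z1 e0; have [d1 d10 H1] := avg4_sqr_normc hh z1 e0.
have [d2 d20 H2] := avg4_sqr_normc hg z1 e0; have [d3 d30 H3] := avg4_sqr_normc hG z1 e0.
exists (Num.min d1 (Num.min d2 d3)) => [|u]; first by rewrite !lt_min d10 d20.
rewrite !lt_min => /and3P[/H1 {}H1 /H2 {}H2 /H3 {}H3].
have -> : avg4 W z u = avg4 (fun w => normc (h w) ^+ 2) z u +
    avg4 (fun w => normc (g w) ^+ 2) z u + avg4 (fun w => normc (G w) ^+ 2) z u.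
  by rewrite /avg4 /W; field.
move: H1 H2 H3; rewrite !ler_norml => /andP[_ H1] /andP[_ H2] /andP[_ H3].
exact: (collect_averages H1 H2 H3).
Qed.

(** The tangent line of [x ^ al] at [W z] bounds the average of [W ^ al] by that of
    [W], to which [derivative_domination] applies. *)
Lemma sub4_compare z : normc z < 1 -> sub4 U z.
Proof.
move=> z1 eps eps0; pose D := al * (W z `^ al / W z).
have Wp : 0 < W z by apply: lt_le_trans (Gpos z1) _; rewrite lerDr addr_ge0 ?sqr_ge0.
have D0 : 0 < D by rewrite !mulr_gt0 ?invr_gt0 ?powR_gt0.
pose K := C1 + C2 + 3 * D; have K0 : 0 < K.
  by apply: addr_gt0; [exact: addr_gt0|exact: mulr_gt0].
have e0 : 0 < eps / K by rewrite divr_gt0.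
have [d1 d10 H1] := avg4W_bound z1 e0.
have [d2 d20 H2] := avg4_sqr_normc hbQ z1 e0; have [d3 d30 H3] := avg4_sqr_normc hQ z1 e0.
exists (Num.min d1 (Num.min d2 d3)) => [|u]; first by rewrite !lt_min d10 d20.
rewrite !lt_min => /and3P[/H1 {}H1 /H2 {}H2 /H3 {}H3].
have UE : avg4 U z u = C1 * avg4 (fun w => normc (b w * Q w) ^+ 2) z u +
    C2 * avg4 (fun w => normc (Q w) ^+ 2) z u - avg4 (fun w => W w `^ al) z u.
  by rewrite /avg4 /U; field.
have T w : W w `^ al <= W z `^ al + D * (W w - W z) by exact: powR_tangent.
have TA : avg4 (fun w => W w `^ al) z u <= W z `^ al + D * (avg4 W z u - W z).
  have := T (z + u); have := T (z - u); have := T (z + imu R * u); have := T (z - imu R * u).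
  exact: avg_affine_bound.
have DD := derivative_domination z1; rewrite -/D in DD.
have {}H1 := ler_wpM2l (ltW D0) H1.
move: H2 H3; rewrite !ler_norml => /andP[H2 _] /andP[H3 _].
have {}H2 := ler_wpM2l (ltW C10) H2; have {}H3 := ler_wpM2l (ltW C20) H3.
have eK : K * (eps / K) = eps by rewrite mulrC divfK // gt_eqF.
have {}DD := ler_wpM2r (sqr_ge0 (normc u)) DD.
rewrite UE /U -eK /K; exact: (collect_comparison DD H1 H2 H3 TA).
Qed.

Lemma compare_mean r : 0 < r -> r < 1 ->
  circ_mean (fun z => W z `^ al) 0 r <= W 0 `^ al +
    (C1 + C2) * circ_mean (fun z => (normc (G z) ^+ 2) `^ al) 0 r.
Proof.
move=> r0 r1; have inD t : normc (circle 0 r t) < 1 by apply: circle_in_disc => //; exact: ltW.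
have cW z : normc z < 1 -> rcont_at (fun z => W z `^ al) z.
  by move=> z1; apply: rcont_powR => //; do 2?apply: rcont_add; exact: hol_rcont_sqr.
have cG z : normc z < 1 -> rcont_at (fun z => (normc (G z) ^+ 2) `^ al) z.
  by move=> z1; apply: rcont_powR => [//|w|]; [exact: sqr_ge0|exact: hol_rcont_sqr].
have cU z : normc z < 1 -> rcont_at U z.
  move=> z1; apply: rcont_add; last by apply: rcont_opp; exact: cW.
  by apply: rcont_add; (apply: rcont_mul; [exact: rcont_cst|exact: hol_rcont_sqr]).
have M : circ_mean U 0 0 <= circ_mean U 0 r.
  apply: circ_mean_mono; [exact: lexx|exact: ltW| |].
    by move=> z zr; apply: cU; exact: le_lt_trans zr r1.
  by move=> z zr; apply: sub4_compare; exact: lt_trans zr r1.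
have U0 : circ_mean U 0 0 = U 0.
  rewrite -[RHS](@circ_mean_cst _ _ (0 : R[i]) 0); apply: eq_circ_mean => t.
  by rewrite /circle rmorph0 mul0r addr0.
have UW : - W 0 `^ al <= U 0.
  by rewrite /U lerDr addr_ge0 // mulr_ge0 ?sqr_ge0 // ltW.
have cS t : rcont_at (fun z => (C1 + C2) * (normc (G z) ^+ 2) `^ al) (circle 0 r t).
  by apply: rcont_mul; [exact: rcont_cst|exact: cG].
have : circ_mean (fun z => U z + W z `^ al) 0 r <=
    circ_mean (fun z => (C1 + C2) * (normc (G z) ^+ 2) `^ al) 0 r.
  apply: le_circ_mean => // t; first by apply: rcont_add; [exact: cU|exact: cW].
  rewrite /U subrK [in leRHS]mulrDl -!sqrQ // lerD2r ler_pM2l // normcM exprMn.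
  by rewrite ler_piMl ?sqr_ge0 // exprn_ile1 ?normc_ge0 // b1.
rewrite circ_meanD ?circ_meanZ; try by move=> t; first [exact: cU|exact: cW|exact: cG].
by rewrite U0 in M; exact: collect_means M UW.
Qed.

End Compare.

(** For [|v| <= 1 / 2] continuity gives a bound, and for [|v| >= 1 / 2] one has
    [|psi v / v| <= 2 |psi v|]. *)
Lemma ddiff0_powR_bound psi p : hol psi -> psi 0 = 0 -> 0 < p -> p <= 1 -> exists2 C : R, 0 <= C &
  forall v, normc v < 1 -> normc (ddiff psi 0 v) `^ p <= C + 2 * normc (psi v) `^ p.
Proof.
move=> h psi0 p0 p1; have n0 : normc (0 : R[i]) < 1 by rewrite normc0.
have [||M M0 HM] := @closed_disc_bounded _ (ddiff psi 0) 0 (1 / 2); first by [].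
  move=> z; rewrite subr0 => zr; apply: hol_cont; first exact: hol_ddiff.
  by apply: le_lt_trans zr _; lra.
exists (M `^ p) => [|v v1]; first exact: powR_ge0.
have [v2|v2] := leP (normc v) (1 / 2).
  apply: (@le_trans _ _ (M `^ p)); last by rewrite lerDl mulr_ge0 ?powR_ge0.
  by rewrite ge0_ler_powR ?nnegrE ?(ltW p0) ?normc_ge0 ?(ltW M0) // HM // subr0.
apply: (@le_trans _ _ ((2 * normc (psi v)) `^ p)).
  rewrite ge0_ler_powR ?nnegrE ?(ltW p0) ?mulr_ge0 ?normc_ge0 //.
  rewrite (ddiffE psi 0 v) psi0 add0r subr0 normcM mulrA ler_peMl ?normc_ge0 //; lra.
rewrite powRM ?normc_ge0 // -[leLHS]add0r lerD ?powR_ge0 // ler_wpM2r ?powR_ge0 //.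
by apply: ler1_powR => //; rewrite ler1n.
Qed.

(** As [|f|^2 <= 2 W], the comparison with [b = xi * eta] and [G = psi (eta) / eta]
    reduces the claim to the means of [|G|^p], which [mean_subordinate] bounds away
    from the zeros of [eta]. *)
Lemma hardy_mean h g psi xi eta c k p :
  hol h -> hol g -> k < 1 ->
  (forall z, normc z < 1 -> normc (dv g z) <= k * normc (dv h z)) -> normc c = 1 ->
  hol psi -> inj_disc psi -> psi 0 = 0 -> dv psi 0 = 1 ->
  hol xi -> (forall z, normc z < 1 -> normc (xi z) <= 1) ->
  hol eta -> (forall z, normc z < 1 -> normc (eta z) < 1) -> eta 0 = 0 ->
  (forall z, normc z < 1 -> h z + c * g z = xi z * psi (eta z)) ->
  0 < p -> p < 1 / 2 -> exists2 M : R, 0 <= M & forall r, 0 < r -> r < 1 ->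
    circ_mean (fun z => normc (h z + (g z)^*) `^ p) 0 r <= M.
Proof.
move=> hh hg k1 gk c1 hpsi inj psi0 d1 hxi xi1 heta eta1 eta0 FE p0 p2.
have n0 : normc (0 : R[i]) < 1 by rewrite normc0.
pose al := p / 2; have al0 : 0 < al by rewrite divr_gt0.
have al1 : al < 1 by rewrite /al; lra.
pose G z := ddiff psi 0 (eta z).
have hG : hol G by apply: hol_comp => //; exact: hol_ddiff.
have nzG z : normc z < 1 -> G z != 0 by move=> /eta1 e1; exact: ddiff_neq0.
have [L hL LE] := hol_log hG nzG.
pose b z := xi z * eta z; have hb : hol b by exact: hol_mul.
have b1 z : normc z < 1 -> normc (b z) <= 1.
  move=> z1; rewrite normcM mulr_ile1 ?normc_ge0 ?xi1 //; exact: ltW (eta1 _ z1).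
have FE' z : normc z < 1 -> h z + c * g z = b z * G z.
  by move=> z1; rewrite FE // (ddiffE psi 0 (eta z)) psi0 add0r subr0 mulrA.
have [C C0 HC] := ddiff0_powR_bound hpsi psi0 p0 (ltac:(lra) : p <= 1).
have [M M0 HM] := mean_subordinate hpsi inj psi0 d1 p0 p2.
have CM := @compare_mean h g G b L c k al hh hg hG hb hL k1 c1 al0 al1 gk b1 LE FE'.
pose A : R := 4 / (1 - k) ^+ 2.
pose K : R := 2 * al * A + (2 * al * A + (A + 1) / al).
pose W z := normc (h z) ^+ 2 + normc (g z) ^+ 2 + normc (G z) ^+ 2.
have W0 z : 0 <= W z by rewrite !addr_ge0 ?sqr_ge0.
have A0 : 0 <= A by rewrite divr_ge0 // sqr_ge0.
have aA0 : 0 <= 2 * al * A by apply: mulr_ge0 => //; apply: mulr_ge0 => //; exact: ltW.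
have K0 : 0 <= K.
  apply: addr_ge0 => //; apply: addr_ge0 => //; apply: divr_ge0; last exact: ltW.
  exact: addr_ge0.
exists (2 * (W 0 `^ al + K * (C + 2 * M))).
  by rewrite mulr_ge0 // addr_ge0 ?powR_ge0 // mulr_ge0 // addr_ge0 // mulr_ge0.
move=> r r0 r1; have inD t : normc (circle 0 r t) < 1 by apply: circle_in_disc => //; exact: ltW.
have sqp x : 0 <= x -> (x ^+ 2) `^ al = x `^ p.
  by move=> x0; rewrite -powR_mulrn // -powRrM /al mulrC divfK.
have cW t : rcont_at (fun z => W z `^ al) (circle 0 r t).
  by apply: rcont_powR => //; do 2?apply: rcont_add; exact: hol_rcont_sqr.
have c2W t : rcont_at (fun z => 2 * W z `^ al) (circle 0 r t).
  by apply: rcont_mul => //; exact: rcont_cst.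
have cf t : rcont_at (fun z => normc (h z + (g z)^*) `^ p) (circle 0 r t).
  apply: rcont_powR => // [w|]; first exact: normc_ge0.
  by apply: rcont_normc; apply: cont_add; [|apply: cont_conj]; exact: hol_cont.
have cG t : rcont_at (fun z => (normc (G z) ^+ 2) `^ al) (circle 0 r t).
  by apply: rcont_powR => // [w|]; [exact: sqr_ge0|exact: hol_rcont_sqr].
have cpsi t : rcont_at (fun z => normc (psi (eta z)) `^ p) (circle 0 r t).
  apply: rcont_powR => // [w|]; first exact: normc_ge0.
  by apply: rcont_normc; apply: (@hol_cont _ (fun z => psi (eta z))) => //; exact: hol_comp.
have c2psi t : rcont_at (fun z => 2 * normc (psi (eta z)) `^ p) (circle 0 r t).
  by apply: rcont_mul => //; exact: rcont_cst.
have cc (x : R) t : rcont_at (fun=> x) (circle 0 r t) by exact: rcont_cst.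
apply: (@le_trans _ _ (circ_mean (fun z => 2 * W z `^ al) 0 r)).
  apply: le_circ_mean => // t; set z := circle 0 r t.
  have : normc (h z + (g z)^*) ^+ 2 <= 2 * W z.
    apply: le_trans (sqr_normcD_le _ _) _; rewrite normc_conj ler_pM2l // lerDl; exact: sqr_ge0.
  rewrite -sqp ?normc_ge0 // => H.
  apply: (@le_trans _ _ ((2 * W z) `^ al)).
    by rewrite ge0_ler_powR ?nnegrE ?(ltW al0) ?sqr_ge0 ?mulr_ge0.
  by rewrite powRM // ler_wpM2r ?powR_ge0 // ler1_powR ?(ltW al1) // ler1n.
rewrite circ_meanZ // ler_pM2l //; apply: le_trans (CM r r0 r1) _.
rewrite -/A -/K lerD2l ler_wpM2l //.
apply: (@le_trans _ _ (circ_mean (fun z => C + 2 * normc (psi (eta z)) `^ p) 0 r)).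
  apply: le_circ_mean => // t; first by apply: rcont_add.
  by rewrite sqp ?normc_ge0 //; apply: HC; exact: eta1.
by rewrite circ_meanD // circ_mean_cst circ_meanZ // lerD2l ler_pM2l // HM.
Qed.

End Comparison.


(** * Affine changes of variables in the plane *)

Section PlaneMeasure.
Variable R : realType.
Local Notation mu := (@lebesgue_measure R).
Implicit Types (f : R -> \bar R) (Phi : R * R -> \bar R) (a b s t : R).

(** The image of Lebesgue measure under [a x + b], multiplied by [a], gives each
    interval its length. *)
Lemma integral_affine f a b : 0 < a -> measurable_fun setT f -> (forall x, (0 <= f x)%E) ->
  (\int[mu]_x f x = a%:E * \int[mu]_x f (a * x + b)%R)%E.
Proof.
move=> a0 mf f0; pose phi : R -> measurableTypeR R := fun x => a * x + b.
have mphi : measurable_fun setT phi.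
  by apply: measurable_funD => //; exact: measurable_funM.
have aP : 0 <= a by exact: ltW.
pose nu := measure_function_pushforward__canonical__measure_function_Measure mu mphi.
have ME A : measurable A -> mscale (NngNum aP) nu A = mu A.
  move=> mA; apply/esym; apply: lebesgue_measure_unique => //= _ [[c d]] _ <-.
  rewrite /mscale /= /pushforward.
  have -> : phi @^-1` `]c, d]%classic = `](c - b) / a, (d - b) / a]%classic.
    apply/seteqP; split => x /=; rewrite !in_itv /= ltr_pdivrMr // ler_pdivlMr // /phi;
    by rewrite (mulrC x) ltrBlDr lerBrDr.
  rewrite !lebesgue_measure_itv /= !lte_fin ltr_pM2r ?invr_gt0 // ltrD2r.
  case: ifP => _; last by rewrite mule0.
  rewrite -EFinM; congr EFin; rewrite -mulrBl mulrC divfK ?gt_eqF //; ring.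
transitivity (\int[mscale (NngNum aP) nu]_x f x)%E.
  by apply: eq_measure_integral => A mA _; apply/esym; exact: ME.
rewrite ge0_integral_mscale //; congr (_ * _)%E.
by rewrite [LHS]ge0_integral_pushforward.
Qed.

Local Notation area := (mu \x mu)%E.

Lemma integral_shear_x Phi a : measurable_fun setT Phi -> (forall p, (0 <= Phi p)%E) ->
  (\int[area]_p Phi (p.1 + a * p.2, p.2)%R = \int[area]_p Phi p)%E.
Proof.
move=> mPhi Phi0.
have m1 : measurable_fun setT (fun p : R * R => Phi (p.1 + a * p.2, p.2)).
  apply: measurableT_comp => //; apply: measurable_fun_pair => //.
  by apply: measurable_funD => //; exact: measurable_funM.
apply: (etrans (@fubini_tonelli2 _ _ _ _ R mu mu _ m1 (fun p => Phi0 _))).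
apply: (etrans _ (esym (@fubini_tonelli2 _ _ _ _ R mu mu _ mPhi Phi0))).
apply: eq_integral => y _; rewrite /fubini_G /=.
rewrite (@integral_affine (fun x => Phi (x, y)) 1 (a * y)) // ?mul1e.
  by apply: eq_integral => x _; rewrite mul1r.
exact: measurableT_comp.
Qed.

Lemma integral_shear_y Phi a : measurable_fun setT Phi -> (forall p, (0 <= Phi p)%E) ->
  (\int[area]_p Phi (p.1, p.2 + a * p.1)%R = \int[area]_p Phi p)%E.
Proof.
move=> mPhi Phi0.
have m1 : measurable_fun setT (fun p : R * R => Phi (p.1, p.2 + a * p.1)).
  apply: measurableT_comp => //; apply: measurable_fun_pair => //.
  by apply: measurable_funD => //; exact: measurable_funM.
apply: (etrans (@fubini_tonelli1 _ _ _ _ R mu mu _ m1 (fun p => Phi0 _))).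
apply: (etrans _ (esym (@fubini_tonelli1 _ _ _ _ R mu mu _ mPhi Phi0))).
apply: eq_integral => x _; rewrite /fubini_F /=.
rewrite (@integral_affine (fun y => Phi (x, y)) 1 (a * x)) // ?mul1e.
  by apply: eq_integral => y _; rewrite mul1r.
exact: measurableT_comp.
Qed.

Lemma integral_dilation Phi s : 0 < s -> measurable_fun setT Phi -> (forall p, (0 <= Phi p)%E) ->
  (\int[area]_p Phi p = (s ^+ 2)%:E * \int[area]_p Phi (s * p.1, s * p.2)%R)%E.
Proof.
move=> s0 mPhi Phi0.
have m1 : measurable_fun setT (fun p : R * R => Phi (s * p.1, s * p.2)).
  apply: measurableT_comp => //; apply: measurable_fun_pair => //; exact: measurable_funM.
have m2 : measurable_fun setT (fun p : R * R => Phi (p.1, s * p.2)).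
  apply: measurableT_comp => //; apply: measurable_fun_pair => //; exact: measurable_funM.
transitivity (s%:E * \int[area]_p Phi (p.1, s * p.2)%R)%E.
  rewrite (@fubini_tonelli1 _ _ _ _ R mu mu _ mPhi Phi0) (@fubini_tonelli1 _ _ _ _ R mu mu (fun p : R * R => Phi (p.1, s * p.2)) m2 (fun p => Phi0 _)) -ge0_integralZl_EFin //; last 3 first.
  - by move=> x _; apply: integral_ge0.
  - exact: (@measurable_fun_fubini_tonelli_F _ _ _ _ R mu (fun p : R * R => Phi (p.1, s * p.2)) m2).
  - exact: ltW.
  apply: eq_integral => x _; rewrite /fubini_F.
  rewrite (@integral_affine (fun y => Phi (x, y)) s 0) //; last exact: measurableT_comp.
  by congr (_ * _)%E; apply: eq_integral => y _; rewrite addr0.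
rewrite expr2 EFinM -muleA; congr (_ * _)%E.
rewrite (@fubini_tonelli2 _ _ _ _ R mu mu (fun p : R * R => Phi (p.1, s * p.2)) m2 (fun p => Phi0 _)) (@fubini_tonelli2 _ _ _ _ R mu mu (fun p : R * R => Phi (s * p.1, s * p.2)) m1 (fun p => Phi0 _)) -ge0_integralZl_EFin //; last 3 first.
- by move=> x _; apply: integral_ge0.
- exact: (@measurable_fun_fubini_tonelli_G _ _ _ _ R mu (fun p : R * R => Phi (s * p.1, s * p.2)) m1).
- exact: ltW.
apply: eq_integral => y _; rewrite /fubini_G.
rewrite (@integral_affine (fun x => Phi (x, s * y)) s 0) //; last exact: measurableT_comp.
by congr (_ * _)%E; apply: eq_integral => x _; rewrite addr0.
Qed.

Definition rot t (p : R * R) : R * R := (cos t * p.1 - sin t * p.2, sin t * p.1 + cos t * p.2).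

Lemma rotD s t p : rot s (rot t p) = rot (s + t) p.
Proof. by rewrite /rot cosD sinD /=; congr pair; ring. Qed.

Lemma measurable_rot t : measurable_fun setT (rot t).
Proof.
apply: measurable_fun_pair.
  by apply: measurable_funB; exact: measurable_funM.
by apply: measurable_funD; exact: measurable_funM.
Qed.

(** A rotation is a product of three shears, with parameter [tan (t / 2)]; the
    half turn is the square of a quarter turn. *)
Lemma integral_rot Phi t : measurable_fun setT Phi -> (forall p, (0 <= Phi p)%E) ->
  (\int[area]_p Phi (rot t p) = \int[area]_p Phi p)%E.
Proof.
have small Psi s : cos (s / 2) != 0 -> measurable_fun setT Psi -> (forall p, (0 <= Psi p)%E) ->
    (\int[area]_p Psi (rot s p) = \int[area]_p Psi p)%E.
  move=> c0 mPsi Psi0; pose c := cos (s / 2); pose T := sin (s / 2) / c.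
  have msx (k : R) : measurable_fun setT (fun p : R * R => (p.1 + k * p.2, p.2)).
    by apply: measurable_fun_pair => //; apply: measurable_funD => //; exact: measurable_funM.
  have msy (k : R) : measurable_fun setT (fun p : R * R => (p.1, p.2 + k * p.1)).
    by apply: measurable_fun_pair => //; apply: measurable_funD => //; exact: measurable_funM.
  have sE : s = s / 2 + s / 2 by rewrite -splitr.
  pose S p := (p.1 + - T * p.2, p.2) : R * R.
  pose S' p := (p.1, p.2 + sin s * p.1) : R * R.
  have E p : rot s p = S (S' (S p)).
    have [sE' cE] : sin s = T * c * c + c * (T * c) /\ cos s = c * c - T * c * (T * c).
      by rewrite {1 2}sE sinD cosD -/c /T divfK.
    have k : c * c + T * c * (T * c) - 1 = 0.
      by rewrite /T divfK // -!expr2 cos2Dsin2 subrr.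
    case: p => x y; rewrite /S /S' /rot /= sE' cE; congr pair; apply: subr0_eq.
      transitivity ((x - 2 * T * y) * (c * c + T * c * (T * c) - 1)); first by ring.
      by rewrite k mulr0.
    transitivity (y * (c * c + T * c * (T * c) - 1)); first by ring.
    by rewrite k mulr0.
  under eq_integral do rewrite E.
  have mS : measurable_fun setT (fun p => Psi (S p)) by apply: measurableT_comp => //; exact: msx.
  have mS' : measurable_fun setT (fun p => Psi (S (S' p))).
    by apply: (measurableT_comp mS); exact: msy.
  apply: (etrans (integral_shear_x (- T) mS' (fun p => Psi0 _))).
  apply: (etrans (integral_shear_y (sin s) mS (fun p => Psi0 _))).
  exact: (integral_shear_x (- T) mPsi Psi0).
move=> mPhi Phi0; have [c0|c0] := eqVneq (cos (t / 2)) 0; last exact: small.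
have c1 : cos (t / 2 / 2) != 0.
  apply/eqP => c1; have := cosD (t / 2 / 2) (t / 2 / 2); rewrite -splitr c0 c1 !mul0r sub0r.
  move/eqP; rewrite eq_sym oppr_eq0 mulf_eq0 orbb => /eqP s1.
  by have := cos2Dsin2 (t / 2 / 2); rewrite c1 s1 expr0n /= addr0 => /eqP; rewrite eq_sym oner_eq0.
have mr : measurable_fun setT (fun p => Phi (rot (t / 2) p)).
  by apply: measurableT_comp => //; exact: measurable_rot.
rewrite -(small _ (t / 2) c1 mPhi Phi0) -(small _ (t / 2) c1 mr) //.
by apply: eq_integral => p _; rewrite rotD -splitr.
Qed.

End PlaneMeasure.


(** * Radial weights on the disc *)

Section AreaBound.
Variable R : realType.
Local Notation mu := (@lebesgue_measure R).
Local Notation area := (mu \x mu)%E.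
Implicit Types (U : R[i] -> R) (z w : R[i]) (r s t gam M : R) (p q : R * R).

(** An open set is a countable union of boxes with rational data. *)
Lemma open2_measurable (O : set (R * R)) :
  (forall p, O p -> exists2 e : R, 0 < e &
     forall q, `|q.1 - p.1| < e -> `|q.2 - p.2| < e -> O q) -> measurable O.
Proof.
move=> HO; pose box (i : rat * rat * rat) : set (R * R) :=
  ball (ratr i.1.1 : R) (ratr i.2 : R) `*` ball (ratr i.1.2 : R) (ratr i.2 : R).
have mbox i : measurable (box i) by apply: measurableX; exact: measurable_ball.
pose F n := if unpickle n is Some i then if `[< box i `<=` O >] then box i else set0 else set0.
have FE i : F (pickle i) = if `[< box i `<=` O >] then box i else set0.
  by rewrite /F pickleK.
have -> : O = \bigcup_n F n.
  apply/seteqP; split => [p Op|p [n _]]; last first.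
    by rewrite /F; case: unpickle => [i|//]; case: asboolP => [iO /iO|].
  have [e e0 He] := HO _ Op.
  have e2 : 0 < e / 2 by rewrite divr_gt0.
  have [d /itvP dP] := rat_in_itvoo e2.
  have d0 : 0 < ratr d :> R by rewrite dP.
  have near (x : R) : exists a : rat, `|ratr a - x| < ratr d.
    have xd : x < x + ratr d by rewrite ltrDl.
    have [a /itvP aP] := rat_in_itvoo xd.
    by exists a; rewrite gtr0_norm ?subr_gt0 ?aP // ltrBlDl aP.
  have [a aP] := near p.1; have [b bP] := near p.2.
  suff ib : box (a, b, d) `<=` O.
    exists (pickle (a, b, d)); first exact: I.
    by rewrite FE asboolT.
  move=> q [/= qa qb]; have dd : ratr d < e / 2 by rewrite dP.
  rewrite /ball /= in qa qb.
  apply: He.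
    have := ler_distD (ratr a) q.1 p.1; rewrite (distrC q.1 (ratr a)); lra.
  have := ler_distD (ratr b) q.2 p.2; rewrite (distrC q.2 (ratr b)); lra.
rewrite /F; apply: bigcupT_measurable => n; case: unpickle => [i|//].
by case: asboolP => // _; exact: mbox.
Qed.

(** With the value [0] outside the disc, continuity on the disc alone gives a
    measurable function on the plane. *)
Definition ext U p : R := if normc (complex_point p) < 1 then U (complex_point p) else 0.

Lemma ext_ge0 U p : (forall z, 0 <= U z) -> 0 <= ext U p.
Proof. by move=> U0; rewrite /ext; case: ifP. Qed.

Lemma measurable_ext U : (forall z, 0 <= U z) -> (forall z, normc z < 1 -> rcont_at U z) ->
  measurable_fun setT (ext U).
Proof.
move=> U0 cU; apply: (measurability _ (RGenOInfty.measurableE R)) => //.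
move=> /= _ [_ [x ->] <-]; rewrite setTI.
have [x0|x0] := ltP x 0.
  rewrite (_ : _ @^-1` _ = setT) //; apply/seteqP; split => // p _ /=.
  by rewrite in_itv /= andbT (lt_le_trans x0) // ext_ge0.
apply: open2_measurable => p /=; rewrite in_itv /= andbT /ext; case: ifPn => [p1 xU|_]; last by rewrite ltNge x0.
have [|d d0 Hd] := cU _ p1 (U (complex_point p) - x); first by rewrite subr_gt0.
pose e := Num.min (d / 2) ((1 - normc (complex_point p)) / 2).
exists e; first by rewrite lt_min !divr_gt0 // subr_gt0.
move=> q; rewrite !lt_min => /andP[a1 a2] /andP[b1 b2]; rewrite in_itv /= andbT.
have := normc_le_ReIm (complex_point q - complex_point p).
have -> : complex.Re (complex_point q - complex_point p) = q.1 - p.1 by [].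
have -> : complex.Im (complex_point q - complex_point p) = q.2 - p.2 by [].
move=> H; have q1 : normc (complex_point q) < 1 by apply: in_disc_sub; lra.
have /Hd : normc (complex_point q - complex_point p) < d by lra.
by rewrite q1 ltr_norml => /andP[]; lra.
Qed.

(** Equal to [(1 - |z|^2) `^ gam] on the disc, and positive everywhere. *)
Definition wt gam z := expR (gam * ln (1 - normc z ^+ 2)).

Lemma rcont_wt gam z : normc z < 1 -> rcont_at (wt gam) z.
Proof.
move=> z1; apply: rcont_comp; last exact: continuous_expR.
apply: rcont_mul; first exact: rcont_cst.
apply: rcont_ln; first exact: sqr_normc_lt1.
apply: rcont_add; first exact: rcont_cst.
by apply: rcont_opp; apply: hol_rcont_sqr => //; exact: hol_id.
Qed.

Let D s : set (R * R) := [set p | normc (complex_point p) ^+ 2 < s].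

Lemma sqr_normc_point p : normc (complex_point p) ^+ 2 = p.1 ^+ 2 + p.2 ^+ 2.
Proof. exact: sqr_normcE. Qed.

Let mD s : measurable (D s).
Proof.
have mq : measurable_fun setT (fun p : R * R => p.1 ^+ 2 + p.2 ^+ 2).
  by apply: measurable_funD; apply: measurable_funX.
have := mq measurableT `]-oo, s[%classic (measurable_itv _); rewrite setTI.
by congr measurable; apply/seteqP; split => p; rewrite /D /mkset sqr_normc_point /= in_itv.
Qed.

(** The area of discs is homogeneous, which makes the area of a thin annulus
    proportional to its width. *)
Lemma area_disc s : 0 <= s -> area (D s) = (s%:E * area (D 1))%E.
Proof.
rewrite le_eqVlt => /predU1P[<-|s0].
  rewrite mul0e (_ : D 0 = set0) ?measure0 //; apply/seteqP; split => // p.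
  by rewrite /D /mkset ltNge sqr_ge0.
have E u : area (D u) = (\int[area]_p (\1_(D u) p)%:E)%E by rewrite integral_indic; [rewrite setIT|exact: measurableT|exact: mD].
have ss : 0 < Num.sqrt s by rewrite sqrtr_gt0.
have mI : measurable_fun setT (fun p => (\1_(D s) p)%:E : \bar R).
  by apply/measurable_EFinP; apply: measurable_indic; exact: mD.
have I0 p : (0 <= (\1_(D s) p)%:E :> \bar R)%E by rewrite lee_fin.
rewrite !E (integral_dilation ss mI I0).
rewrite sqr_sqrtr ?ltW //; congr (_ * _)%E; apply: eq_integral => p _; congr (_%:E).
rewrite !indicE; congr (_%:R); congr nat_of_bool; apply/idP/idP => /set_mem H; apply: mem_set; move: H;
  by rewrite /D /mkset !sqr_normc_point [_.1]/= [_.2]/= !exprMn sqr_sqrtr ?(ltW s0) // -mulrDr -{2}[s]mulr1 ltr_pM2l.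
Qed.

Lemma area_disc_fin : exists2 c, 0 <= c & area (D 1) = c%:E.
Proof.
have H : (area (D 1) <= 4%:E)%E.
  have -> : 4%:E = area (ball (0 : R) 1 `*` ball (0 : R) 1).
    transitivity (mu (ball (0%R : R) 1%R) * mu (ball (0%R : R) 1%R))%E.
      by rewrite lebesgue_measure_ball // -EFinM; congr (_%:E); ring.
    by apply/esym; apply: product_measure1E; exact: measurable_ball.
  have mB : measurable (ball (0 : R) 1 `*` ball (0 : R) 1).
    by apply: measurableX; exact: measurable_ball.
  rewrite le_measure ?inE //; first exact: mD.
  move=> p; rewrite /D /mkset sqr_normc_point => H.
  have := sqr_ge0 p.1; have := sqr_ge0 p.2 => a b.
  by split; rewrite /ball /= sub0r normrN -(@ltr_pXn2r _ 2) ?nnegrE // expr1n -normrX ger0_norm //; lra.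
have H0 := measure_ge0 area (D 1).
exists (fine (area (D 1))); first exact: fine_ge0.
by rewrite fineK // ge0_fin_numE // (le_lt_trans H) // ltry.
Qed.

(** On the annulus where [1 - |z|^2] is between [e^(-n-1)] and [e^(-n)] the weight is at
    most [e^(- gam (n + 1))], and the area is at most a multiple of [e^(-n)]. *)
Lemma integral_wt_neg gam : -1 < gam -> gam < 0 -> (\int[area]_p (ext (wt gam) p)%:E < +oo)%E.
Proof.
move=> g1 g0; have [c c0 cE] := area_disc_fin.
pose ann (n : nat) : set (R * R) := D 1 `\` D (1 - expR (- n%:R)).
have mann n : measurable (ann n) by exact: measurableD.
have en1 n : expR (- n%:R) <= 1 :> R by rewrite expR_le1 oppr_le0.
have annE n : area (ann n) = (expR (- n%:R) * c)%:E.
  have fin1 : (area (D 1) < +oo)%E by rewrite cE ltry.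
  have s0 : 0 <= 1 - expR (- n%:R) :> R by rewrite subr_ge0.
  have sub : D (1 - expR (- n%:R)) `<=` D 1.
    by move=> p /lt_le_trans; apply; rewrite gerBl expR_ge0.
  have -> : area (ann n) = (area (D 1) - area (D (1 - expR (- n%:R))%R))%E.
    rewrite /ann measureD; try first [exact: mD|exact: fin1].
    by congr (_ - area _)%E; apply/setIidPr.
  by rewrite (area_disc s0) cE -EFinM -EFinB; congr (_%:E); ring.
pose k (n : nat) := expR (- gam * (n%:R + 1)) : R.
have mk : forall n : nat, measurable_fun [set: R * R] (fun p => (k n * \1_(ann n) p)%:E).
  move=> n.
  by apply/measurable_EFinP; apply: measurable_funM => //; exact: measurable_indic.
have k0 (n : nat) p : (0 <= (k n * \1_(ann n) p)%:E)%E.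
  by rewrite lee_fin mulr_ge0 ?expR_ge0.
apply: (@le_lt_trans _ _ (\int[area]_p (\sum_(n <oo) (k n * \1_(ann n) p)%:E))%E).
  apply: ge0_le_integral => //.
  - by move=> p _; rewrite lee_fin; apply: ext_ge0 => z; exact: expR_ge0.
  - apply/measurable_EFinP; apply: measurable_ext => z; [exact: expR_ge0|exact: rcont_wt].
  - apply: (ge0_emeasurable_sum (P := xpredT) (h := fun n p => (k n * \1_(ann n) p)%:E)) => n *.
      exact: k0.
    exact: mk.
  move=> p _; rewrite /ext; case: ifPn => [p1|_]; last exact: nneseries_ge0.
  pose x := 1 - normc (complex_point p) ^+ 2.
  have x0 : 0 < x by exact: sqr_normc_lt1.
  have x1 : x <= 1 by rewrite gerBl sqr_ge0.
  pose n := Num.truncn (- ln x).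
  have lx : 0 <= - ln x by rewrite oppr_ge0 ln_le0.
  have /andP[n1 n2] := truncn_itv lx.
  have pn : ann n p.
    split; first by rewrite /D /mkset -subr_gt0.
    rewrite /D /mkset; apply/negP; rewrite -leNgt lerBlDl -lerBlDr -/x -[leLHS]lnK ?posrE // ler_expR; lra.
  apply: (@le_trans _ _ (\sum_(0 <= i < n.+1) (k i * \1_(ann i) p)%:E)%E); last exact: nneseries_lim_ge.
  rewrite big_nat_recr //= -[leLHS]add0e leeD //; first exact: sume_ge0.
  rewrite indicE mem_set // mulr1 lee_fin ler_expR /k -/x -natr1 in n2 *.
  have : 0 < - gam by lra.
  move=> gp; rewrite -[gam]opprK mulNr -mulrN -/n opprK ler_pM2l //; lra.
rewrite integral_nneseries //.
have E (n : nat) : (\int[area]_p ((k n * \1_(ann n) p)%R%:E) =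
    (expR (- gam) * c * expR (- (1 + gam)) ^+ n)%:E)%E.
  under eq_integral do rewrite EFinM.
  have mI : measurable_fun [set: R * R] (fun p => (\1_(ann n) p)%:E : \bar R).
    by apply/measurable_EFinP; exact: measurable_indic.
  rewrite (ge0_integralZl_EFin area measurableT _ mI (expR_ge0 _)); last first.
    by move=> p _; rewrite lee_fin.
  have -> : (\int[area]_p (\1_(ann n) p)%:E = area (ann n))%E.
    by rewrite integral_indic; [rewrite setIT|exact: measurableT|exact: mann].
  rewrite annE -EFinM /k mulrA -expRD -expRM_natl mulrAC -expRD; congr (_ * _)%:E.
  by congr expR; ring.
apply: (@le_lt_trans _ _ (expR (- gam) * c * (1 - expR (- (1 + gam)))^-1)%:E); last exact: ltry.
apply: lime_le; first by apply: is_cvg_nneseries => n _ _; apply: integral_ge0.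
apply: nearW => n; rewrite (eq_bigr _ (fun i _ => E i)) sumEFin lee_fin big_mkord -mulr_sumr.
by rewrite ler_wpM2l ?mulr_ge0 ?expR_ge0 // geo_sum ?expR_ge0 // expR_lt1; lra.
Qed.

Lemma integral_wt gam : -1 < gam -> (\int[area]_p (ext (wt gam) p)%:E < +oo)%E.
Proof.
move=> g1; have [g0|g0] := ltP gam (- (1 / 2)); first by apply: integral_wt_neg => //; lra.
apply: (@le_lt_trans _ _ (\int[area]_p (ext (wt (- (1 / 2))) p)%:E)%E); last by apply: integral_wt_neg; lra.
apply: ge0_le_integral => //.
- by move=> p _; rewrite lee_fin; apply: ext_ge0 => z; exact: expR_ge0.
- by apply/measurable_EFinP; apply: measurable_ext => z; [exact: expR_ge0|exact: rcont_wt].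
- by apply/measurable_EFinP; apply: measurable_ext => z; [exact: expR_ge0|exact: rcont_wt].
move=> p _; rewrite lee_fin /ext; case: ifPn => // p1; rewrite ler_expR ler_wnM2r // ln_le0 //.
by rewrite gerBl sqr_ge0.
Qed.

End AreaBound.


(** * Averaging over rotations *)

Section Rotation.
Variable R : realType.
Local Notation mu := (@lebesgue_measure R).
Local Notation area := (mu \x mu)%E.
Implicit Types (U : R[i] -> R) (z w : R[i]) (r s t gam M : R) (p q : R * R).

Lemma segintE (f : R -> R) a b : cont_seg a b f ->
  (segint a b f)%:E = (\int[mu]_(t in `[a, b]) (f t)%:E)%E.
Proof.
move=> cf; rewrite /segint /Rintegral fineK //.
by apply: integrable_fin_num => //; exact: cont_seg_integrable.
Qed.

Lemma segint_shift (f : R -> R) a b c : (forall t, {for t, continuous f}) ->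
  (forall t, 0 <= f t) -> segint (a + c) (b + c) f = segint a b (fun t => f (t + c)).
Proof.
move=> cf f0; apply: EFin_inj.
have mf : measurable_fun setT f by apply: continuous_measurable_fun => t; exact: cf.
have cfc t : {for t, continuous (fun t => f (t + c))}.
  apply: (@continuous_comp _ _ _ (fun t => t + c) f); last exact: cf.
  by apply: continuousD; [exact: id|exact: cst_continuous].
rewrite !segintE; try by move=> t _; first [exact: cf|exact: cfc].
rewrite [LHS]integral_mkcond [RHS]integral_mkcond.
rewrite (@integral_affine _ _ 1 c) // ?mul1e; last 2 first.
- apply/(measurable_restrictT _ (measurable_itv _)); apply: measurable_funTS.
  by apply/measurable_EFinP.
- by move=> x; rewrite patchE; case: ifP => // _; rewrite lee_fin.
apply: eq_integral => x _; rewrite !patchE mul1r.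
have -> : (x + c \in `[a + c, b + c]%classic) = (x \in `[a, b]%classic).
  by apply/idP/idP => /set_mem H; apply: mem_set; move: H; rewrite /= !in_itv /= !lerD2r.
by [].
Qed.

(** Translation of the angle, by periodicity. *)
Lemma circ_mean_rot U r s : (forall t, rcont_at U (circle 0 r t)) -> (forall z, 0 <= U z) ->
  circ_mean (fun z => U (cis s * z)) 0 r = circ_mean U 0 r.
Proof.
move=> cU U0.
have pos s' : 0 <= s' <= 2 * pi -> circ_mean (fun z => U (cis s' * z)) 0 r = circ_mean U 0 r.
  move=> /andP[s0 s1]; rewrite /circ_mean; congr (_ * _).
  pose f t := U (circle 0 r t).
  have cf t : {for t, continuous f} by exact: rcont_circle.
  have cs x y : cont_seg x y f by move=> t _; exact: cf.
  have fE t : U (cis s' * circle 0 r t) = f (t + s').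
    by rewrite /f /circle !add0r mulrCA -cisD addrC.
  have -> : segint 0 (2 * pi) (fun t => U (cis s' * circle 0 r t)) = segint 0 (2 * pi) (fun t => f (t + s')).
    by apply: eq_segint => t _; exact: fE.
  have f0 t : 0 <= f t by exact: U0.
  have p0 := pi2_gt0 R.
  rewrite -(segint_shift _ _ _ cf f0) add0r.
  have s2 : 2 * pi <= 2 * pi + s' by rewrite lerDl.
  rewrite (segint_split s1 s2 (cs _ _)) (segint_split s0 s1 (cs _ _)) addrC; congr (_ + _).
  rewrite -{1}[2 * pi]add0r [2 * pi + s']addrC (segint_shift _ _ _ cf f0).
  by apply: eq_segint => t _; rewrite /f circle2pi.
have [t /andP[t1 t2] E] := polarE (cis s); rewrite normc_cis mul1r in E; rewrite E.
have pi0 := pi_gt0 R.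
have [t0|t0] := leP 0 t; first by apply: pos; rewrite t0 /=; lra.
rewrite -(pos (t + 2 * pi)); last by apply/andP; split; lra.
by apply: eq_circ_mean => x; rewrite cisD cis2pi mulr1.
Qed.

Lemma complex_point_rot t p : complex_point (rot t p) = cis t * complex_point p.
Proof. by case: p => x y; apply: complex_ext; rewrite !ReImE /=; ring. Qed.

Lemma normc_point_rot t p : normc (complex_point (rot t p)) = normc (complex_point p).
Proof. by rewrite complex_point_rot normcM normc_cis mul1r. Qed.

Lemma measurable_rot2 : measurable_fun setT (fun u : R * (R * R) => rot u.1 u.2).
Proof.
have mc : measurable_fun setT (fun u : R * (R * R) => cos u.1).
  by apply: measurableT_comp => //; apply: continuous_measurable_fun; exact: continuous_cos.
have ms : measurable_fun setT (fun u : R * (R * R) => sin u.1).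
  by apply: measurableT_comp => //; apply: continuous_measurable_fun; exact: continuous_sin.
have m1 : measurable_fun setT (fun u : R * (R * R) => u.2.1) by exact: measurableT_comp.
have m2 : measurable_fun setT (fun u : R * (R * R) => u.2.2) by exact: measurableT_comp.
apply: measurable_fun_pair.
  by apply: measurable_funB; exact: measurable_funM.
by apply: measurable_funD; exact: measurable_funM.
Qed.

(** Tonelli's theorem on [R * (R * R)] needs the plane measure as a
    sigma-finite measure. *)
Definition plane_area : set (measurableTypeR R * measurableTypeR R) -> \bar R := area.

HB.instance Definition _ := Measure.on plane_area.

Let plane_area_sigma_finite : sigma_finite setT plane_area.
Proof.
pose F (n : nat) : set (R * R) := ball (0 : R) n%:R `*` ball (0 : R) n%:R.
exists F => [|n].
  apply/seteqP; split => // -[x y] _.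
  pose n := (Num.truncn (Num.max `|x| `|y|)).+1.
  have := truncnS_gt (Num.max `|x| `|y|); rewrite -/n gt_max => /andP[xn yn].
  by exists n => //; split; rewrite /ball /= sub0r normrN.
split; first by apply: measurableX; exact: measurable_ball.
have -> : plane_area (F n) = (mu (ball (0%R : R) n%:R) * mu (ball (0%R : R) n%:R))%E.
  by apply: product_measure1E; exact: measurable_ball.
by rewrite lebesgue_measure_ball // -EFinM ltry.
Qed.

HB.instance Definition _ := Measure_isSigmaFinite.Build _ _ _ plane_area plane_area_sigma_finite.

(** Averaging over rotations replaces the first factor by its circular means. *)
Lemma area_bound U gam M : (forall z, 0 <= U z) -> (forall z, normc z < 1 -> rcont_at U z) ->
  (forall r, 0 <= r -> r < 1 -> circ_mean U 0 r <= M) -> -1 < gam ->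
  (\int[area]_p (ext (fun z => (U z * wt gam z)%R) p)%:E < +oo)%E.
Proof.
move=> U0 cU HM g1; pose V z := U z * wt gam z.
have w0 z : 0 <= wt gam z by exact: expR_ge0.
have V0 z : 0 <= V z by rewrite mulr_ge0.
have cV z : normc z < 1 -> rcont_at V z.
  by move=> z1; apply: rcont_mul; [exact: cU|exact: rcont_wt].
pose Phi p : \bar R := (ext V p)%:E.
have mPhi : measurable_fun setT Phi by apply/measurable_EFinP; exact: measurable_ext.
have Phi0 p : (0 <= Phi p)%E by rewrite lee_fin ext_ge0.
have M0 : 0 <= M.
  apply: le_trans (HM 0 (lexx _) ltr01); rewrite -[leLHS](circ_mean_cst 0 (0 : R[i]) 0).
  apply: le_circ_mean => t; [exact: rcont_cst|apply: cU|exact: U0].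
  by rewrite normc_circle0.
rewrite -/V.
pose D := `[0, 2 * pi]%classic : set R.
pose g (u : R * (R * R)) : \bar R := ((\1_D u.1)%:E * Phi (rot u.1 u.2))%E.
have mD : measurable D by exact: measurable_itv.
have mI : measurable_fun [set: R] (fun t => (\1_D t)%:E : \bar R).
  by apply/measurable_EFinP; exact: measurable_indic.
have mg : measurable_fun setT g.
  apply: emeasurable_funM; first by apply: (measurableT_comp mI).
  by apply: measurableT_comp => //; exact: measurable_rot2.
have g0 u : (0 <= g u)%E by rewrite mule_ge0 // lee_fin.
have avg : ((2 * pi)%:E * \int[area]_p Phi p = \int[area]_p \int[mu]_t g (t, p))%E.
  have F := @fubini_tonelli _ _ _ _ R mu plane_area g mg g0.
  rewrite -F {F}; have -> : ((2 * pi)%:E = \int[mu]_t (\1_D t)%:E)%E.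
    rewrite integral_indic; [|exact: measurableT|exact: mD].
    rewrite setIT; apply/esym.
    by apply: etrans (lebesgue_measure_itv _) _; rewrite /= lte_fin pi2_gt0 sube0.
  have I0 : (0 <= \int[area]_p Phi p)%E by exact: integral_ge0.
  rewrite -(ge0_integralZr mu measurableT mI _ I0); last by move=> t _; rewrite lee_fin.
  apply: eq_integral => t _; rewrite -(integral_rot t mPhi Phi0).
  have mr : measurable_fun setT (fun p => Phi (rot t p)).
    by apply: measurableT_comp => //; exact: measurable_rot.
  by rewrite -(@ge0_integralZl_EFin _ _ R area setT measurableT _ _ mr (\1_D t)).
have gE p : (\int[mu]_t g (t, p) = cint (fun t => Phi (rot t p)))%E.
  rewrite /cint [RHS]integral_mkcond; apply: eq_integral => t _; rewrite /g /= patchE indicE.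
  by case: ifP => _; rewrite ?mul1e ?mul0e.
have inner p : (cint (fun t => Phi (rot t p)) <= (2 * pi * M)%:E * (ext (wt gam) p)%:E)%E.
  rewrite /Phi /ext; case: (ltP (normc (complex_point p)) 1) => p1; last first.
    rewrite mule0 (@eq_cint _ _ (fun=> (0 : R)%:E)) ?cint_cst ?mulr0 // => t.
    by rewrite normc_point_rot ltNge p1.
  set r := normc (complex_point p) in p1 *; have r0 : 0 <= r by exact: normc_ge0.
  have [s _ E] := polarE (complex_point p); rewrite -/r in E.
  pose k := wt gam (complex_point p).
  have cr t : rcont_at U (circle 0 r t) by apply: cU; rewrite normc_circle0.
  have cr' t : rcont_at (fun z => U (cis s * z)) (circle 0 r t).
    have c0 : rcont_at U (cis s * circle 0 r t) by apply: cU; rewrite normcM normc_cis mul1r normc_circle0.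
    apply/rcontE; have /rcontE c1 := c0.
    apply: (cont_comp (phi := fun z => cis s * z) _ c1).
    by apply: cont_mul; [exact: cont_cst|exact: cont_id].
  have cr2 t : rcont_at (fun z => k * U (cis s * z)) (circle 0 r t).
    by apply: rcont_mul => //; exact: rcont_cst.
  rewrite (@eq_cint _ _ (fun t => (k * U (cis s * circle 0 r t))%:E)); last first.
    move=> t; rewrite normc_point_rot -/r p1 /V complex_point_rot; congr (_%:E).
    rewrite mulrC /k; congr (_ * _); first by rewrite /wt normcM normc_cis mul1r.
    by rewrite E /circle add0r; congr U; ring.
  rewrite (cint_circ_mean cr2) circ_meanZ // circ_mean_rot // -EFinM lee_fin -/k.
  rewrite -!mulrA ler_pM2l // ler_pM2l ?pi_gt0 // mulrC ler_wpM2r //; first exact: w0.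
  exact: HM.
have mwt : measurable_fun setT (fun p => (ext (wt gam) p)%:E : \bar R).
  by apply/measurable_EFinP; apply: measurable_ext => // z; exact: rcont_wt.
have fin2 : ((2 * pi)%:E * \int[area]_p Phi p < +oo)%E.
  rewrite avg.
  apply: (@le_lt_trans _ _ (\int[area]_p ((2 * pi * M)%:E * (ext (wt gam) p)%:E))%E).
    apply: ge0_le_integral => //.
    - by move=> p _; exact: integral_ge0.
    - exact: (@measurable_fun_fubini_tonelli_G _ _ _ _ R mu g mg g0).
    - exact: measurable_funeM.
    by move=> p _; rewrite gE.
  have K0 : 0 <= 2 * pi * M by rewrite mulr_ge0 // ltW // pi2_gt0.
  rewrite (@ge0_integralZl_EFin _ _ R area setT measurableT _ _ mwt _ K0); last first.
    by move=> p _; rewrite lee_fin ext_ge0.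
  by rewrite lte_mul_pinfty // ?integral_wt // lee_fin.
rewrite ltey; apply/eqP => Iy; move: fin2; rewrite [X in (_ * X)%E]Iy mulry gtr0_sg ?pi2_gt0 //.
by rewrite mul1e ltxx.
Qed.

End Rotation.


(** * Growth of the harmonic function and uniqueness of its parts *)

Section PairGrowth.
Variable R : realType.
Implicit Types (z w c : R[i]) (r s t k : R) (phi chi psi xi eta h g F : R[i] -> R[i]).

(** The maximum principle for [eta z / z] on circles of radius close to [1]. *)
Lemma schwarz eta z : hol eta -> (forall z, normc z < 1 -> normc (eta z) < 1) -> eta 0 = 0 ->
  normc z < 1 -> normc (eta z) <= normc z.
Proof.
move=> he e1 eta0 z1; have n0 : normc (0 : R[i]) < 1 by rewrite normc0.
pose E := ddiff eta 0; have hE : hol E by exact: hol_ddiff.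
have EE w : eta w = w * E w by rewrite (ddiffE eta 0 w) eta0 add0r subr0.
rewrite EE normcM ler_piMr ?normc_ge0 // leNgt; apply/negP => E1.
have E0 : 0 < normc (E z) by exact: lt_trans E1.
have E1' : (normc (E z))^-1 < 1 by rewrite invf_lt1.
pose s := (1 + Num.max (normc z) (normc (E z))^-1) / 2.
have m1 : Num.max (normc z) (normc (E z))^-1 < 1 by rewrite gt_max z1.
have zm : normc z <= Num.max (normc z) (normc (E z))^-1 by rewrite le_max lexx.
have em : (normc (E z))^-1 <= Num.max (normc z) (normc (E z))^-1 by rewrite le_max lexx orbT.
have z0 := normc_ge0 z.
have s0 : 0 < s by rewrite /s; lra.
have s1 : s < 1 by rewrite /s; lra.
have zs : normc z <= s by rewrite /s; lra.
have es : (normc (E z))^-1 < s by rewrite /s; lra.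
have := @max_modulus _ E s s^-1 hE (ltW s0) s1 _ z zs.
move=> H; have /H : forall w, normc w = s -> normc (E w) <= s^-1.
  move=> w ws; have := ltW (e1 w _); rewrite ws => /(_ s1).
  by rewrite EE normcM ws mulrC -ler_pdivlMr // mul1r.
by rewrite leNgt -[normc (E z)]invrK ltf_pV2 ?posrE ?invr_gt0 // es.
Qed.

(** Cauchy's estimate on the disc of radius [(1 - |z|) / 2] around [z]. *)
Lemma growth_deriv F (C : R) z : hol F -> 0 <= C ->
  (forall z, normc z < 1 -> normc (F z) <= C / (1 - normc z) ^+ 2) -> normc z < 1 ->
  normc (dv F z) <= 32 * C / (1 - normc z) ^+ 3.
Proof.
move=> hF C0 HF z1; pose d := 1 - normc z; have d0 : 0 < d by rewrite subr_gt0.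
have d2 : 0 < d / 2 by rewrite divr_gt0.
have dd : d / 2 < d by rewrite /d in d0 *; lra.
have := @deriv_bound _ F (dv F) z (d / 2) d (C / (d / 2) ^+ 2) d2 dd.
have -> : 4 * (C / (d / 2) ^+ 2) / (d / 2) = 32 * C / d ^+ 3.
  by field; rewrite gt_eqF.
apply => w wd; first by apply: hol_dv => //; exact: in_disc_sub wd.
have w1 : d / 2 <= 1 - normc w by have := lerB_normc w z; rewrite /d in wd *; lra.
have w1' : normc w < 1 by lra.
apply: le_trans (HF _ w1') _; rewrite ler_wpM2l // lef_pV2 ?posrE ?exprn_gt0 //; last lra.
by rewrite lerXn2r ?nnegrE //; lra.
Qed.

Lemma growth_integrate phi (K : R) z : hol phi -> 0 <= K -> phi 0 = 0 ->
  (forall z, normc z < 1 -> normc (dv phi z) <= K / (1 - normc z) ^+ 3) -> normc z < 1 ->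
  normc (phi z) <= K / 2 / (1 - normc z) ^+ 2.
Proof.
move=> h K0 phi0 HK z1; pose B s := K / 2 * ((1 - s) ^+ 2)^-1.
have hB s : 0 <= s < 1 -> is_derive s 1 B (K / (1 - s) ^+ 3).
  move=> /andP[s0 s1]; have s1' : 1 - s != 0 by rewrite gt_eqF // subr_gt0.
  have d1 : is_derive s 1 (fun s => 1 - s) (0 - 1 : R).
    exact: (@is_deriveB R R^o R^o (cst 1) id).
  have d2 := @is_deriveX R R^o _ 2 s 1 _ d1.
  have d3 := @is_deriveV R _ s _ _ (expf_neq0 2 s1') d2.
  have := @is_deriveZ R R^o R^o _ (K / 2) s 1 _ d3.
  have -> : K / 2 \*: (fun y => (((fun s : R => 1 - s) ^+ 2) y)^-1) = B.
    by apply/funext => y; rewrite /B /= exprfctE.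
  congr (is_derive _ _ _ _); rewrite /GRing.scale /= exprfctE; field.
  by rewrite s1'.
have := ray_bound h hB HK z1; rewrite phi0 subr0 => /le_trans; apply.
by rewrite /B subr0 expr1n invr1 mulr1 gerBl divr_ge0.
Qed.

(** A bound of order [-2] for [h + c g] becomes one of order [-3] for its derivative,
    hence for [h'] and [g'], and integration brings the order back to [-2]. *)
Lemma pair_growth h g c k (C : R) : hol h -> hol g -> h 0 = 0 -> g 0 = 0 -> 0 <= C ->
  k < 1 -> (forall z, normc z < 1 -> normc (dv g z) <= k * normc (dv h z)) -> normc c = 1 ->
  (forall z, normc z < 1 -> normc (h z + c * g z) <= C / (1 - normc z) ^+ 2) ->
  exists2 K : R, 0 < K & forall z, normc z < 1 -> normc (h z + (g z)^*) <= K / (1 - normc z) ^+ 2.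
Proof.
move=> hh hg h0 g0 C0 k1 gk c1 HF; pose K := 32 * C / (1 - k).
have k1' : 0 < 1 - k by rewrite subr_gt0.
have K0 : 0 <= K by rewrite divr_ge0 // ?mulr_ge0 // ltW.
pose F z := h z + c * g z; have hF : hol F by apply: hol_add => //; exact: hol_scale.
have h' z : normc z < 1 -> normc (dv h z) <= K / (1 - normc z) ^+ 3.
  move=> z1; have := growth_deriv hF C0 HF z1.
  have -> : dv F z = dv h z + c * dv g z.
    by apply: dvE; exact: (hasd_add (hol_dv hh z1) (hasd_scale c (hol_dv hg z1))).
  move=> A; have := lerB_normc (dv h z) (- (c * dv g z)).
  rewrite opprK normcN normcM c1 mul1r => B.
  have : normc (dv h z) * (1 - k) <= 32 * C / (1 - normc z) ^+ 3 by have := gk z z1; lra.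
  by rewrite -ler_pdivlMr // /K mulrAC.
have g' z : normc z < 1 -> normc (dv g z) <= K / (1 - normc z) ^+ 3.
  move=> z1; apply: le_trans (h' _ z1); apply: le_trans (gk _ z1) _.
  by rewrite ler_piMl ?normc_ge0 // ltW.
exists (K + 1) => [|z z1]; first by rewrite ltr_wpDl.
apply: le_trans (le_normcD _ _) _; rewrite normc_conj.
have A := growth_integrate hh K0 h0 h' z1; have B := growth_integrate hg K0 g0 g' z1.
apply: (@le_trans _ _ (K / (1 - normc z) ^+ 2)).
  have -> : K / (1 - normc z) ^+ 2 = K / 2 / (1 - normc z) ^+ 2 + K / 2 / (1 - normc z) ^+ 2.
    by rewrite -mulrDl -splitr.
  exact: lerD.
by rewrite ler_pM2r ?lerDl // invr_gt0 exprn_gt0 // subr_gt0.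
Qed.

(** A function that is both analytic and conjugate to an analytic function has
    derivatives [d = e^*] and [d i = (e i)^*] along the two axes, so [d = 0]. *)
Lemma conj_hol_dv0 phi chi z : hol phi -> hol chi ->
  (forall w, normc w < 1 -> phi w = (chi w)^*) -> normc z < 1 -> dv phi z = 0.
Proof.
move=> hphi hchi E z1; pose d := dv phi z; pose e := dv chi z.
have z1' : 0 < 1 - normc z by rewrite subr_gt0.
apply/eqP; rewrite -normc_eq0P; apply/eqP/le_anti; rewrite normc_ge0 andbT.
apply/ler_addgt0Pr => eps eps0; rewrite add0r.
have e2 : 0 < eps / 2 by rewrite divr_gt0.
have [d1 d10 H1] := hasd_eps (hol_dv hphi z1) e2.
have [d2 d20 H2] := hasd_eps (hol_dv hchi z1) e2.
pose t := Num.min (1 - normc z) (Num.min d1 d2) / 2.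
have m0 : 0 < Num.min (1 - normc z) (Num.min d1 d2) by rewrite !lt_min z1' d10.
have t0 : 0 < t by rewrite divr_gt0.
have : t < Num.min (1 - normc z) (Num.min d1 d2) by rewrite /t; lra.
rewrite !lt_min => /and3P[tz td1 td2].
have key u : normc u = 1 -> normc (d * u - (e * u)^*) <= eps.
  move=> u1; pose w := z + t%:C * u.
  have wz : w - z = t%:C * u by rewrite /w addrAC subrr add0r.
  have nw : normc (w - z) = t by rewrite wz normcM u1 mulr1 normc_real gtr0_norm.
  have w1 : normc w < 1 by apply: (@in_disc_sub _ z); rewrite nw.
  have := H1 w; have := H2 w; rewrite nw => /(_ td2) A /(_ td1).
  rewrite -/d wz E // (E z) // => B; move: A; rewrite -/e wz -normc_conj => A.
  rewrite -(ler_pM2l t0).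
  have -> : t * normc (d * u - (e * u)^*) = normc (t%:C * (d * u - (e * u)^*)).
    by rewrite normcM normc_real gtr0_norm.
  have -> : t%:C * (d * u - (e * u)^*) = (chi w - chi z - e * (t%:C * u))^* -
      ((chi w)^* - (chi z)^* - d * (t%:C * u)).
    by apply: complex_ext; rewrite !ReImE /=; ring.
  by apply: le_trans (normcB _ _) _; move: A B; lra.
have A := key 1 (normc1 _); have B := key (imu R) (normc_imu R).
have : normc (imu R * (d * 1 - (e * 1)^*) + (d * imu R - (e * imu R)^*)) <= eps + eps.
  by apply: le_trans (le_normcD _ _) _; rewrite normcM normc_imu mul1r lerD.
have -> : imu R * (d * 1 - (e * 1)^*) + (d * imu R - (e * imu R)^*) = (imu R * d) + (imu R * d).
  by apply: complex_ext; rewrite !ReImE /=; ring.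
rewrite -mulr2n -mulr_natr normcM normcM normc_imu mul1r.
have -> : normc (2%:R : R[i]) = 2.
  by rewrite -(rmorph_nat (@real_complex R)) normc_real ger0_norm.
rewrite -/d; lra.
Qed.

Lemma canonical_rep_dv f h1 g1 h2 g2 z : canonical_rep f h1 g1 -> canonical_rep f h2 g2 ->
  normc z < 1 -> dv h1 z = dv h2 z /\ dv g1 z = dv g2 z.
Proof.
move=> [/analytic_hol a1 /analytic_hol b1 E1 _ _] [/analytic_hol a2 /analytic_hol b2 E2 _ _] z1.
have E w : normc w < 1 -> h1 w - h2 w = (g2 w - g1 w)^*.
  move=> /discE w1; have := E1 _ w1; rewrite E2 // => H.
  have -> : h1 w - h2 w = h1 w + (g1 w)^* - (g1 w)^* - h2 w by ring.
  by rewrite -H rmorphB; ring.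
have hd := hol_sub a1 a2; have gd := hol_sub b2 b1.
have H1 := conj_hol_dv0 hd gd E z1.
have E' w : normc w < 1 -> g2 w - g1 w = (h1 w - h2 w)^* by move=> /E ->; rewrite conjcK.
have H2 := conj_hol_dv0 gd hd E' z1.
move: H1 H2; rewrite (dvE (hasd_sub (hol_dv a1 z1) (hol_dv a2 z1))).
rewrite (dvE (hasd_sub (hol_dv b2 z1) (hol_dv b1 z1))).
by move=> /subr0_eq -> /subr0_eq ->.
Qed.

End PairGrowth.


(** * Membership in the Hardy and Bergman spaces *)

Section Final.
Variable R : realType.
Local Notation mu := (@lebesgue_measure R).
Local Notation area := (mu \x mu)%E.
Implicit Types (z w c : R[i]) (r s t k p q beta : R) (f h g : R[i] -> R[i]).

(** The representations in the definition have the same derivatives by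
    [canonical_rep_dv], so their properties hold for a single pair. As the
    dilatation is [0] by convention where [h' = 0], bounding [g'] by [k h'] also
    uses that the map is sense-preserving. *)
Lemma class_SHq_pair (K : R) f : 1 <= K -> class_SHq K f ->
  exists h g psi xi eta (c : R[i]) (k : R),
  [/\ canonical_rep f h g, [/\ hol h, hol g, hol psi, hol xi & hol eta],
     [/\ k < 1, normc c = 1, inj_disc psi, psi 0 = 0 & dv psi 0 = 1] &
     [/\ forall z, normc z < 1 -> normc (dv g z) <= k * normc (dv h z),
         forall z, normc z < 1 -> normc (xi z) <= 1,
         forall z, normc z < 1 -> normc (eta z) < 1, eta 0 = 0 &
         forall z, normc z < 1 -> h z + c * g z = xi z * psi (eta z)]].
Proof.
move=> K1 [[[_ _ [h1 [g1 [rep1 sp]]]] [h2 [g2 [rep2 dil]]]] [h [g [rep [t [psi [psiS qs]]]]]]].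
have [psia psii psi0 psi1] := psiS.
have [xi [eta [[xia xi1] [etaa eta1] eta0 FE]]] := qs.
have [ah ag _ _ _] := rep; have n0 : normc (0 : R[i]) < 1 by rewrite normc0.
have K0 : 0 < K + 1 by lra.
exists h, g, psi, xi, eta, (cis t), ((K - 1) / (K + 1)); split => //.
- by split; exact: analytic_hol.
- split => //; first by rewrite ltr_pdivrMr //; lra.
  + exact: normc_cis.
  + by move=> z w z1 w1; apply: psii; apply: mem_set; apply/discE.
  + by rewrite -(cderiv_dv psia).
split => //.
- move=> z z1.
  have [a1 b1 _ _ _] := rep1; have [a2 b2 _ _ _] := rep2.
  have [E1 E2] := canonical_rep_dv rep1 rep z1.
  have [E3 E4] := canonical_rep_dv rep2 rep z1.
  have zd : disc z by apply/discE.
  have := sp z zd; rewrite /jacobian (cderiv_dv a1 z1) (cderiv_dv b1 z1) E1 E2 => J.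
  have := dil z zd; rewrite /dilatation (cderiv_dv a2 z1) (cderiv_dv b2 z1) E3 E4.
  have hp : 0 < normc (dv h z).
    rewrite lt_def normc_ge0 andbT; apply/eqP => h0; move: J; rewrite h0 expr0n /= sub0r.
    by have := sqr_ge0 (normc (dv g z)); lra.
  by rewrite normcM normcV ler_pdivrMr.
- move=> z /discE /xi1; rewrite -[1]/(1%:C); rewrite -lecR.
  by [].
- by move=> z /discE /eta1 /discE.
by move=> z /discE /FE.
Qed.

Lemma integral_mean_circ (p : R) f U (r : R) : (forall t, rcont_at U (circle 0 r t)) ->
  (forall t, normc (f (r%:C * cis t)) `^ p = U (circle 0 r t)) -> (forall z, 0 <= U z) ->
  integral_mean p r f = ((circ_mean U 0 r) `^ (p^-1))%:E.
Proof.
move=> cU fU U0; rewrite /integral_mean.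
have -> : (\int[lebesgue_measure]_(t in `[0%R, (2 * pi)%R]) ((normc (f (r%:C * cis t))) `^ p)%:E)%E =
    (2 * pi * circ_mean U 0 r)%:E.
  by rewrite -cint_circ_mean //; apply: eq_cint => t; rewrite fU.
by rewrite -EFinM mulrA mulVf ?gt_eqF ?pi2_gt0 // mul1r poweR_EFin.
Qed.

Lemma hardy_membership f h g p (M : R) : harmonic_disc f -> hol h -> hol g ->
  (forall z, disc z -> f z = h z + (g z)^*) -> 0 < p -> 0 <= M ->
  (forall r, 0 < r -> r < 1 -> circ_mean (fun z => normc (h z + (g z)^*) `^ p) 0 r <= M) ->
  harmonic_hardy p f.
Proof.
move=> harm hh hg fE p0 M0 HM; split=> //.
apply: (@le_lt_trans _ _ (M `^ (p^-1))%:E); last exact: ltry.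
apply: ge_ereal_sup => x [r /=]; rewrite in_itv /= => /andP[r0 r1] <-.
have inD t : normc (circle 0 r t) < 1 by apply: circle_in_disc => //; exact: ltW.
pose U z := normc (h z + (g z)^*) `^ p.
have U0 z : 0 <= U z by exact: powR_ge0.
have cU t : rcont_at U (circle 0 r t).
  apply: rcont_powR => // [w|]; first exact: normc_ge0.
  by apply: rcont_normc; apply: cont_add; [|apply: cont_conj]; exact: hol_cont.
have fU t : normc (f (r%:C * cis t)) `^ p = U (circle 0 r t).
  have E : r%:C * cis t = circle 0 r t by rewrite /circle add0r.
  by rewrite E fE //; apply/discE.
rewrite (integral_mean_circ cU fU U0) lee_fin.
have m0 : 0 <= circ_mean U 0 r.
  rewrite -[leLHS](circ_mean_cst 0 (0 : R[i]) r); apply: le_circ_mean => // t; exact: rcont_cst.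
by rewrite ge0_ler_powR ?nnegrE ?invr_ge0 ?(ltW p0) // HM.
Qed.

(** For [p >= 1/2], [q] must lie in [](p - (1 + beta) / 2), 1/2[], which is not empty by
    the bound on [p]. *)
Lemma exponent_split p beta : 0 < p -> -1 < beta -> p < (2 + beta) / 2 ->
  exists q, [/\ 0 < q, q < 1 / 2, q <= p & -1 < beta - 2 * (p - q)].
Proof.
move=> p0 b1 pb; have [p2|p2] := ltP p (1 / 2).
  by exists p; split => //; lra.
have [c|c] := leP (p - (1 + beta) / 2) 0.
  by exists (1 / 4); split; lra.
by exists ((1 / 2 + (p - (1 + beta) / 2)) / 2); split; lra.
Qed.

(** The growth bound trades the power [p - q] of [f] for the power
    [-2 (p - q)] of the distance to the boundary. *)
Lemma bergman_membership f h g q p beta (K M : R) : class_H f -> hol h -> hol g ->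
  (forall z, disc z -> f z = h z + (g z)^*) -> h 0 = 0 -> g 0 = 0 ->
  0 < q -> q <= p -> -1 < beta -> -1 < beta - 2 * (p - q) -> 0 < K -> 0 <= M ->
  (forall z, normc z < 1 -> normc (h z + (g z)^*) <= K / (1 - normc z) ^+ 2) ->
  (forall r, 0 < r -> r < 1 -> circ_mean (fun z => normc (h z + (g z)^*) `^ q) 0 r <= M) ->
  harmonic_bergman p beta f.
Proof.
move=> fH hh hg fE h0 g0 q0 qp b1 gam1 K0 M0 HK HM; split => //.
set gam := beta - 2 * (p - q) in gam1.
have p0 : 0 < p by exact: lt_le_trans qp.
pose F z := normc (h z + (g z)^*); have F0 z : 0 <= F z by exact: normc_ge0.
have cF z : normc z < 1 -> rcont_at F z.
  by move=> z1; apply: rcont_normc; apply: cont_add; [|apply: cont_conj]; exact: hol_cont.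
have cFe e z : 0 < e -> normc z < 1 -> rcont_at (fun z => F z `^ e) z.
  by move=> e0 z1; apply: rcont_powR => //; exact: cF.
have wt0 e z : 0 <= wt e z by exact: expR_ge0.
pose V z := F z `^ p * (pi^-1 * ((beta + 1) * wt beta z)).
have V0 z : 0 <= V z.
  rewrite mulr_ge0 ?powR_ge0 // mulr_ge0 ?invr_ge0 ?pi_ge0 // mulr_ge0 //; lra.
have cV z : normc z < 1 -> rcont_at V z.
  move=> z1; apply: rcont_mul; first exact: cFe.
  by do 2 (apply: rcont_mul; first exact: rcont_cst); exact: rcont_wt.
pose U z := F z `^ q; have U0 z : 0 <= U z by exact: powR_ge0.
have cU z : normc z < 1 -> rcont_at U z by exact: cFe.
have HU r : 0 <= r -> r < 1 -> circ_mean U 0 r <= M.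
  rewrite le_eqVlt => /predU1P[<- _|]; last exact: HM.
  have -> : circ_mean U 0 0 = circ_mean (fun=> 0) 0 0.
    apply: eq_circ_mean => t; rewrite /circle rmorph0 mul0r addr0 /U /F h0 g0.
    by rewrite rmorph0 addr0 normc0 powR0 // gt_eqF.
  by rewrite circ_mean_cst.
have fin := area_bound U0 cU HU gam1.
have cUw z : normc z < 1 -> rcont_at (fun z => U z * wt gam z) z.
  by move=> z1; apply: rcont_mul; [exact: cU|exact: rcont_wt].
pose C : R := (4 * K) `^ (p - q) * (pi^-1 * (beta + 1)).
have C0 : 0 <= C.
  rewrite mulr_ge0 ?powR_ge0 // mulr_ge0 ?invr_ge0 ?pi_ge0 //; lra.
have point z : normc z < 1 -> V z <= C * (U z * wt gam z).
  move=> z1; set r := normc z in z1 *; have r0 : 0 <= r by exact: normc_ge0.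
  have d0 : 0 < 1 - r by rewrite subr_gt0.
  pose x := 1 - r ^+ 2; have x0 : 0 < x by exact: sqr_normc_lt1.
  have FK : F z <= 4 * K / x ^+ 2.
    apply: le_trans (HK _ z1) _; rewrite -/r -mulrA [leRHS]mulrCA ler_pM2l //.
    have -> : 4 / x ^+ 2 = (1 - r) ^- 2 * (2 / (1 + r)) ^+ 2.
      by rewrite /x; field; rewrite !gt_eqF //; nra.
    rewrite ler_peMr ?invr_ge0 ?exprn_ge0 ?(ltW d0) // exprn_ege1 // ler_pdivlMr; lra.
  have Fs : F z `^ p = U z * F z `^ (p - q).
    rewrite /U; have [->|Fz] := eqVneq (F z) 0.
      by rewrite powR0 ?gt_eqF // powR0 ?gt_eqF // mul0r.
    by rewrite -powRD ?Fz ?implybT // addrC subrK.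
  have Fpq : F z `^ (p - q) <= (4 * K) `^ (p - q) * expR (- 2 * (p - q) * ln x).
    have -> : expR (- 2 * (p - q) * ln x) = (x ^- 2) `^ (p - q).
      rewrite /powR gt_eqF ?invr_gt0 ?exprn_gt0 // lnV ?posrE ?exprn_gt0 // lnXn //.
      by congr expR; rewrite -mulr_natl; ring.
    have pq0 : 0 <= p - q by rewrite subr_ge0.
    rewrite -powRM ?mulr_ge0 ?invr_ge0 ?exprn_ge0 ?(ltW K0) ?(ltW x0) //.
    rewrite ge0_ler_powR ?nnegrE ?divr_ge0 ?mulr_ge0 ?exprn_ge0 ?(ltW K0) ?(ltW x0) //.
  have wE : wt gam z = expR (- 2 * (p - q) * ln x) * wt beta z.
    by rewrite /wt -expRD; congr expR; rewrite /gam -/r -/x; ring.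
  rewrite /V Fs wE /C.
  have k0 : 0 <= pi^-1 * ((beta + 1) * wt beta z).
    by rewrite mulr_ge0 ?invr_ge0 ?pi_ge0 // mulr_ge0 //; lra.
  have := ler_wpM2r k0 (ler_wpM2l (U0 z) Fpq); move/le_trans; apply.
  by rewrite le_eqVlt; apply/orP; left; apply/eqP; ring.
have mV : measurable_fun setT (fun x => (ext V x)%:E : \bar R).
  by apply/measurable_EFinP; exact: measurable_ext.
have mU : measurable_fun setT (fun x => (ext (fun z => U z * wt gam z) x)%:E : \bar R).
  by apply/measurable_EFinP; apply: measurable_ext => // z; rewrite mulr_ge0.
have -> : (\int[area]_(x in @plane_disc R)
    (normc (f (complex_point x)) `^ p * area_density beta (complex_point x))%:E =
    \int[area]_x (ext V x)%:E)%E.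
  rewrite integral_mkcond; apply: eq_integral => x _; rewrite patchE /ext.
  case: ifPn => [/set_mem/discE x1|x1]; last first.
    by case: ifPn => // x2; move: x1; rewrite (mem_set (_ : plane_disc x)) //; apply/discE.
  rewrite x1 fE; last exact/discE.
  congr (_ * _)%:E; rewrite /area_density /wt; congr (_ * (_ * _)).
  by rewrite /powR gt_eqF // sqr_normc_lt1.
apply: (@le_lt_trans _ _ (\int[area]_x (C%:E * (ext (fun z => U z * wt gam z)%R x)%:E))%E).
  apply: ge0_le_integral => //.
  - by move=> x _; rewrite lee_fin ext_ge0.
  - exact: measurable_funeM.
  move=> x _; rewrite -EFinM lee_fin /ext; case: ifPn => [x1|_]; last by rewrite mulr0.
  exact: point.
have E0 x : (0 <= (ext (fun z => U z * wt gam z)%R x)%:E)%E.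
  by rewrite lee_fin; apply: ext_ge0 => z; rewrite mulr_ge0.
rewrite (@ge0_integralZl_EFin _ _ R area setT measurableT _ (fun x _ => E0 x) mU _ C0).
rewrite lte_mul_pinfty ?lee_fin //.
Qed.

End Final.

Theorem theorem5 (R : realType) (K : R) (hK : 1 <= K) (f : R[i] -> R[i])
    (hf : class_SHq K f) :
  (forall p : R, 0 < p -> p < 1 / 2 -> harmonic_hardy p f) /\
  (forall p beta : R, -1 < beta -> 0 < p -> p < (2 + beta) / 2 ->
     harmonic_bergman p beta f).
Proof.
have [h [g [psi [xi [eta [c [k [rep [hh hg hpsi hxi heta] [k1 c1 inj psi0 d1]
  [gk xi1 eta1 eta0 FE]]]]]]]]] := class_SHq_pair hK hf.
have [_ _ fE [h0 g0] _] := rep.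
have fH : class_H f by case: hf => [[[]]].
have HM p := @hardy_mean R h g psi xi eta c k p hh hg k1 gk c1 hpsi inj psi0 d1 hxi xi1 heta eta1 eta0 FE.
split=> [p p0 p2|p beta b1 p0 pb].
  have [M M0 MP] := HM p p0 p2.
  by apply: (hardy_membership _ hh hg fE p0 M0 MP); case: fH.
have [q [q0 q2 qp gam1]] := exponent_split p0 b1 pb.
have [M M0 MP] := HM q q0 q2.
have e0 : 0 < 1 + expR 2 :> R by rewrite addr_gt0 // expR_gt0.
pose C : R := 8 * (1 + expR 2); have C0 : 0 <= C by rewrite mulr_ge0 // ltW.
have [|L L0 HL] := @pair_growth R h g c k C hh hg h0 g0 C0 k1 gk c1.
  move=> z z1; rewrite FE // normcM; apply: le_trans (ler_piMl (normc_ge0 _) (xi1 _ z1)) _.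
  apply: le_trans (growth hpsi inj psi0 d1 (eta1 _ z1)) _.
  have ez := schwarz heta eta1 eta0 z1; have e1 := eta1 _ z1.
  rewrite ler_wpM2l // lef_pV2 ?posrE ?exprn_gt0 ?subr_gt0 //.
  by rewrite lerXn2r ?nnegrE ?subr_ge0 ?(ltW z1) ?(ltW e1) // lerD2l lerN2.
exact: (bergman_membership fH hh hg fE h0 g0 q0 qp b1 gam1 L0 M0 HL MP).
Qed.
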